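(* Assume (A1), (A2), (A3), (A4), (A7) stated in the context. Let $\mathbf T_n$ be any regular asymptotically linear (RAL) estimator of $x^\star$ computed from a sample $\xi_0,\xi_1,\dots,\xi_n$ of the chain with kernel $P$. Then \[ \lim_{n\to\infty}n\cdot\mathbb E(\mathbf T_n-x^\star)(\mathbf T_n-x^\star)^\top\succeq G^{-1}SG^{-\top}, \] where $\succeq$ is the Loewner order and $S:=\mathbb E_{\xi\sim\pi}[U(x^\star,\xi)U(x^\star,\xi)^\top-\mathcal PU(x^\star,\xi)\mathcal PU(x^\star,\xi)^\top]$.
   Context: Setting. $\Xi$ is a Polish space; $P$ is a Markov transition kernel on $\Xi$ with stationary distribution $\pi$. For $F(x,\xi)$, $\mathcal PF(x,\xi):=\int F(x,\xi')P(\xi,d\xi')$, $\mathcal P^t$ its iterate. $\|\cdot\|$ is a norm on $\mathbb R^d$. $H:\mathbb R^d\times\Xi\to\mathbb R^d$ measurable, $g(x):=\int H(x,\xi)\pi(d\xi)$, $g(x^\star)=0$. $U(x,\xi):=\sum_{t\ge0}(\mathcal P^tH(x,\xi)-g(x))$. Perturbations: let $\mathcal B$ be the class of bounded measurable $h:\Xi\times\Xi\to\mathbb R$ with $\int h(\xi,\xi')P(\xi,d\xi')=0$ for all $\xi$. For $h\in\mathcal B$ and $n$ large, define the kernel $P_{nh}(\xi,d\xi')=P(\xi,d\xi')(1+n^{-1/2}h(\xi,\xi'))$, let $\pi_{nh}$ be its stationary distribution and $x^\star_{nh}$ the root of $\int H(x,\xi)\pi_{nh}(d\xi)=0$. An estimator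 $\mathbf T_n$ (measurable function of the data) is regular for $x^\star$ with limit $\mathbf L$ if for all $h\in\mathcal B$, $\sqrt n(\mathbf T_n-x^\star_{nh})\to\mathbf L$ in distribution when the data are generated by $P_{nh}$. It is RAL if it is regular and asymptotically linear: there is a measurable $\varphi$ with $\sqrt n(\mathbf T_n-x^\star)=n^{-1/2}\sum_{i=1}^n\varphi(\xi_{i-1},\xi_i)+o_{P}(1)$, where under $\xi\sim\pi,\xi'\sim P(\xi,\cdot)$, $\mathbb E\varphi(\xi,\xi')=0$ and $\mathbb E\varphi\varphi^\top$ is nonsingular. (A1) $\exists L_G,\delta_G>0$ and $G$ with all eigenvalues of strictly positive real part such that $\|g(x)-G(x-x^\star)\|\le L_G\|x-x^\star\|^2$ when $\|x-x^\star\|\le\delta_G$. (A2) $\exists p>2,\sigma>0$: $\sup_t(\mathbb E\|H(x^\star,\xi_t)\|^p)^{1/p}<\infty$ along the chain, and $\sup_\xi\|\mathcal PH(x^\star,\xi)\|\le\sigma$. (A3) $\exists L_H$: $(\int\|H(x,\xi')-H(y,\xi')\|^pP(\xi,d\xi'))^{1/p}\le L_H\|x-y\|$ for all $x,y,\xi$. (A4) $\pi$ is the unique stationary distribution and $d_{TV}(P^t(\xi,\cdot),\pi)\le\kappa\rho^t/2$ for all $\xi,t$, some $\kappa\ge e$, $\rho\in[0,1)$. (A7) $\exists\gamma\in[0,1),c>0$: $\|\mathcal P(H(x,\xi)-H(y,\xi))-c(x-y)\|\le\gamma c\|x-y\|$ for all $x,y,\xi$.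
   Formalization: The limit of n·E(T_n−x* )(T_n−x* )^T is assumed to exist as a finite real matrix, with second moments finite for large n; a regular asymptotically linear estimator alone does not guarantee this. *)

(* Defs.v *)
From HB Require Import structures.
From mathcomp Require Import all_boot all_order all_algebra.
From mathcomp Require Import all_classical all_reals all_analysis.
From mathcomp Require Import complex.
Import Order.TTheory GRing.Theory Num.Theory numFieldNormedType.Exports numFieldTopology.Exports.

Set Implicit Arguments.
Unset Strict Implicit.
Unset Printing Implicit Defensive.

Local Open Scope classical_set_scope.
Local Open Scope ring_scope.

Definition borelT (T : ptopologicalType) := g_sigma_algebraType (@open T).

Definition polish (R : realType) (T : topologicalType) : Prop :=
  (exists D : set T, countable D /\ closure D = setT) /\
  exists dist : T -> T -> R,
    [/\ (forall x y, dist x y = 0 <-> x = y),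
        (forall x y, dist x y = dist y x),
        (forall x y z, dist x z <= dist x y + dist y z),
        (forall A : set T, open A <->
           forall x, A x -> exists2 e : R, 0 < e & forall y, dist x y < e -> A y) &
        (forall u : nat -> T,
           (forall e : R, 0 < e -> exists N, forall m n, (N <= m)%N -> (N <= n)%N ->
              dist (u m) (u n) < e) ->
           exists l, forall e : R, 0 < e -> exists N, forall n, (N <= n)%N ->
              dist (u n) l < e)].

Definition is_norm (R : realType) (d : nat) (nrm : 'cV[R]_d -> R) : Prop :=
  [/\ (forall x, nrm x = 0 -> x = 0),
      (forall (a : R) x, nrm (a *: x) = `|a| * nrm x) &
      (forall x y, nrm (x + y) <= nrm x + nrm y)].

Definition loewner_ge (R : realType) (d : nat) (A B : 'M[R]_d) : Prop :=
  forall v : 'cV[R]_d, 0 <= (v^T *m (A - B) *m v) 0 0.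

Definition eig_pos_re (R : realType) (d : nat) (G : 'M[R]_d) : Prop :=
  forall z : R[i], root (map_poly (fun r : R => Complex r 0) (char_poly G)) z ->
    0 < complex.Re z.

Section chain.
Context (R : realType) (dX : measure_display) (X : measurableType dX).
Local Open Scope ereal_scope.

Definition wint (P : R.-pker X ~> X) (w : X -> X -> R) (x : X)
    (f : X -> \bar R) : \bar R :=
  \int[P x]_y ((w x y)%:E * f y).

(* E[F(x, xi_1, ..., xi_n) | xi_0 = x] for the chain with transition
   w(x,y) P(x,dy); F takes the sample [:: xi_0; ...; xi_n]. *)
Fixpoint pexp (P : R.-pker X ~> X) (w : X -> X -> R) (n : nat)
    (F : seq X -> \bar R) (x : X) : \bar R :=
  match n with
  | 0 => F [:: x]
  | n'.+1 => wint P w x (fun y => pexp P w n' (fun s => F (x :: s)) y)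
  end.

Definition chainE (nu : probability X R) (P : R.-pker X ~> X)
    (w : X -> X -> R) (n : nat) (F : seq X -> \bar R) : \bar R :=
  \int[nu]_x pexp P w n F x.

Definition w1 : X -> X -> R := fun _ _ => 1%R.
Definition wpert (h : X -> X -> R) (n : nat) : X -> X -> R :=
  fun x y => (1 + h x y / Num.sqrt (n%:R))%R.

Definition stationary (P : R.-pker X ~> X) (w : X -> X -> R)
    (mu : probability X R) : Prop :=
  forall A : set X, measurable A ->
    mu A = \int[mu]_x wint P w x (fun y => (\1_A y)%:E).

Definition Pops (P : R.-pker X ~> X) (f : X -> R) (x : X) : R :=
  fine (\int[P x]_y (f y)%:E).
Definition Pop (P : R.-pker X ~> X) (d : nat) (f : X -> 'cV[R]_d) (x : X)
    : 'cV[R]_d := \col_i Pops P (fun y => f y i ord0) x.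
Definition Pows (P : R.-pker X ~> X) (t : nat) (f : X -> R) : X -> R :=
  iter t (Pops P) f.
Definition Pow (P : R.-pker X ~> X) (d : nat) (t : nat) (f : X -> 'cV[R]_d)
    : X -> 'cV[R]_d := iter t (@Pop P d) f.

Definition vmean (mu : probability X R) (d : nat) (f : X -> 'cV[R]_d)
    : 'cV[R]_d := \col_i fine (\int[mu]_y (f y i ord0)%:E).

Definition gfun (pi : probability X R) (d : nat)
    (H : 'cV[R]_d -> X -> 'cV[R]_d) (x : 'cV[R]_d) : 'cV[R]_d :=
  vmean pi (H x).

Definition Ufun (P : R.-pker X ~> X) (pi : probability X R) (d : nat)
    (H : 'cV[R]_d -> X -> 'cV[R]_d) (x : 'cV[R]_d) (xi : X) : 'cV[R]_d :=
  \col_i limn (fun N => (\sum_(t < N)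
                    ((Pow P t (H x) xi) i ord0 - (gfun pi H x) i ord0))%R).

Definition Smat (P : R.-pker X ~> X) (pi : probability X R) (d : nat)
    (H : 'cV[R]_d -> X -> 'cV[R]_d) (x : 'cV[R]_d) : 'M[R]_d :=
  let U := Ufun P pi H x in
  let PU := Pop P U in
  \matrix_(i, j) fine (\int[pi]_xi
      ((U xi i ord0 * U xi j ord0 - PU xi i ord0 * PU xi j ord0)%R)%:E).

Definition classB (P : R.-pker X ~> X) (h : X -> X -> R) : Prop :=
  [/\ measurable_fun setT (fun q : X * X => h q.1 q.2),
      (exists M : R, forall x y, (`|h x y| <= M)%R) &
      (forall x, \int[P x]_y (h x y)%:E = 0)].

Definition is_root_of (mu : probability X R) (d : nat)
    (H : 'cV[R]_d -> X -> 'cV[R]_d) (x : 'cV[R]_d) : Prop :=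
  forall i, mu.-integrable setT (fun y => (H x y i ord0)%:E) /\
            \int[mu]_y (H x y i ord0)%:E = 0.

Definition conv_dist (nu : probability X R) (P : R.-pker X ~> X)
    (w : nat -> X -> X -> R) (d : nat) (Y : nat -> seq X -> 'cV[R]_d)
    (L : probability (borelT 'cV[R]_d) R) : Prop :=
  forall f : 'cV[R]_d -> R, continuous f ->
    (exists M : R, forall y, (`|f y| <= M)%R) ->
    (fun n => fine (chainE nu P (w n) n (fun s => (f (Y n s))%:E)))
      @ \oo --> fine (\int[L]_y (f y)%:E).

Definition regular (nu : probability X R) (P : R.-pker X ~> X) (d : nat)
    (H : 'cV[R]_d -> X -> 'cV[R]_d) (T : nat -> seq X -> 'cV[R]_d) : Prop :=
  exists L : probability (borelT 'cV[R]_d) R,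
    forall h, classB P h ->
    forall (pin : nat -> probability X R) (xn : nat -> 'cV[R]_d),
      (\forall n \near \oo,
          stationary P (wpert h n) (pin n) /\ is_root_of (pin n) H (xn n)) ->
      conv_dist nu P (wpert h)
        (fun n s => Num.sqrt (n%:R) *: (T n s - xn n)) L.

Definition asymp_linear (nu : probability X R) (P : R.-pker X ~> X)
    (pi : probability X R) (d : nat) (nrm : 'cV[R]_d -> R)
    (T : nat -> seq X -> 'cV[R]_d) (xs : 'cV[R]_d) : Prop :=
  exists phi : X -> X -> 'cV[R]_d,
    [/\ (forall i, measurable_fun setT (fun q : X * X => phi q.1 q.2 i ord0)),
        (forall i, \int[pi]_x \int[P x]_y ((phi x y i ord0) ^+ 2)%:E < +oo),
        (forall i, \int[pi]_x \int[P x]_y (phi x y i ord0)%:E = 0),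
        (\matrix_(i, j) fine (\int[pi]_x \int[P x]_y
              (phi x y i ord0 * phi x y j ord0)%:E)) \in unitmx &
        (forall eps : R, (0 < eps)%R ->
          (fun n => fine (chainE nu P w1 n (fun s =>
             ((eps < nrm (Num.sqrt (n%:R) *: (T n s - xs)
                 - (Num.sqrt (n%:R))^-1 *:
                     \sum_(k < n) phi (nth point s k) (nth point s k.+1)))%R%:R)%:E)))
          @ \oo --> 0%R)].

Definition RAL nu P pi d H nrm T xs :=
  @regular nu P d H T /\ @asymp_linear nu P pi d nrm T xs.

(* measurable structure on the sample space X^{n+1} and reading a sample *)
Fixpoint pT (n : nat) : {dd : measure_display & measurableType dd} :=
  match n with
  | 0 => existT _ dX X
  | n'.+1 => existT (fun dd => measurableType dd) _
               ((X * projT2 (pT n'))%type : measurableType _)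
  end.

Fixpoint tolist (n : nat) : projT2 (pT n) -> seq X :=
  match n return projT2 (pT n) -> seq X with
  | 0 => fun x => [:: x]
  | n'.+1 => fun p => p.1 :: @tolist n' p.2
  end.

Definition estimator_measurable (d : nat) (T : nat -> seq X -> 'cV[R]_d) : Prop :=
  forall n i, measurable_fun setT (fun p : projT2 (pT n) => T n (@tolist n p) i ord0).

End chain.

(* Main.v *)
(* Only the regularity of the estimator matters, through a Chapman-Robbins argument.
   For h in the class B, the law of the sample under P_nh has density
   prod_k (1 + n^(-1/2) h(xi_k, xi_(k+1))) with respect to its law under P, and the second
   moment of this density is asymptotically at most exp(kbar), kbar := E_pi[P h^2].  The
   roots x_nh satisfy sqrt n (x_nh - x_0) -> - G^(-1) E_pi[P (h U)].  Regularity with h and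
   with 0 gives the same limit law to sqrt n (T_n - x_nh) under P_nh and to
   sqrt n (T_n - x_0) under P; hence, under P_nh and in the limit, sqrt n v^T (T_n - x_0) is
   shifted by - beta, beta := E_pi[P (h m)] with m := v^T G^(-1) U, and Cauchy-Schwarz
   against the density yields, after rescaling h, 2 beta <= v^T M v + kbar.  The choice
   h(x, y) = m_K(y) - (P m_K)(x), m_K a bounded truncation of m, gives
   E_pi[m^2 - (P m)^2] = v^T G^(-1) S G^(-T) v on the left as K tends to infinity.

   The stationary law pi_nh is obtained from a contraction in sup
   norm, the root x_nh from a fixed point of x |-> x - g_nh(x) / c, a contraction
   by (A7). *)

(* Regularity speaks of all sequences of stationary laws and roots of the perturbed problem; it can
   be used only once such sequences are known to exist, hence the two constructions. What resists is
   unboundedness. At [xs] only [P H] is bounded, not [H] itself, so the Poisson equation is solved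
   for [P H], and [U] is [H xs] plus a bounded function. Total variation controls bounded functions
   only, so the integrability of [H xs] under pi_nh is drawn from its second moment under [pi] by a
   comparison of tails. The truncation of m cuts all the coordinates of [U] together, for the
   expansion of the root needs [P (h U)] bounded in each coordinate. The second moment of the
   density is the total mass of the chain with weights [(1 + n^(-1/2) h)^2]; it grows like the n-th
   power of [1 + kbar / n], which is the origin of exp(kbar). Replacing h by e h with e small turns
   [exp(kbar) - 1] into kbar. The contraction (A7) holds in the given norm, whence a Jensen
   inequality in that norm with constant one: passing through another norm would lose the factor
   [gamma < 1]. *)
Require Import Defs.
From HB Require Import structures.
From mathcomp Require Import all_boot all_order all_algebra.
From mathcomp Require Import all_classical all_reals all_analysis.
From mathcomp Require Import complex.
From mathcomp Require Import measurable_realfun ring lra.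
Import Order.TTheory GRing.Theory Num.Theory numFieldNormedType.Exports numFieldTopology.Exports.
Local Open Scope classical_set_scope.
Local Open Scope ring_scope.

Set Implicit Arguments.
Unset Strict Implicit.
Unset Printing Implicit Defensive.

(** * Bounded measurable functions and probability kernels *)

Section bounded_measurable.
Context d (T : measurableType d) (R : realType).
Implicit Types f g : T -> R.

Definition bm f := measurable_fun setT f /\ exists M : R, forall x, `|f x| <= M.

Lemma bm_cst (c : R) : bm (fun=> c).
Proof. by split; [exact: measurable_cst|exists `|c|]. Qed.

Lemma bmD f g : bm f -> bm g -> bm (fun x => f x + g x).
Proof.
move=> [mf [M fM]] [mg [N gN]]; split; first exact: measurable_funD.
by exists (M + N) => x; rewrite (le_trans (ler_normD _ _))// lerD.
Qed.

Lemma bmM f g : bm f -> bm g -> bm (fun x => f x * g x).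
Proof.
move=> [mf [M fM]] [mg [N gN]]; split; first exact: measurable_funM.
by exists (M * N) => x; rewrite normrM ler_pM.
Qed.

Lemma bmZ (c : R) f : bm f -> bm (fun x => c * f x).
Proof. by apply: bmM; exact: bm_cst. Qed.

Lemma bmB f g : bm f -> bm g -> bm (fun x => f x - g x).
Proof.
move=> bf bg; rewrite (_ : (fun _ => _) = (fun x => f x + (-1) * g x)).
  by apply: bmD => //; exact: bmZ.
by apply/funext => x; rewrite mulN1r.
Qed.

Lemma bm_sum (I : finType) (f : I -> T -> R) :
  (forall i, bm (f i)) -> bm (fun x => \sum_i f i x).
Proof.
move=> bf; elim: (index_enum I) => [|i r ih].
  by under eq_fun do rewrite big_nil; exact: bm_cst.
by under eq_fun do rewrite big_cons; exact: bmD.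
Qed.

Lemma bm_indic (A : set T) : measurable A -> bm (\1_A : T -> R).
Proof.
move=> mA; split; first exact: measurable_indic.
by exists 1 => x; rewrite indicE; case: (_ \in _); rewrite ?normr1 ?normr0.
Qed.

Context (mu : {measure set T -> \bar R}) (mu1 : mu setT = 1%E).

Lemma integrable_sum (I : finType) (f : I -> T -> R) :
  (forall i, mu.-integrable setT (EFin \o f i)) ->
  mu.-integrable setT (EFin \o (fun x => \sum_i f i x)) /\
  \int[mu]_x (\sum_i f i x) = \sum_i \int[mu]_x f i x.
Proof.
move=> fi; have h (r : seq I) :
    mu.-integrable setT (EFin \o (fun x => \sum_(i <- r) f i x)) /\
    \int[mu]_x (\sum_(i <- r) f i x) = \sum_(i <- r) \int[mu]_x f i x.
  elim: r => [|i r [ih1 ih2]].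
    have e : (fun x => \sum_(i <- [::]) f i x) = (fun=> 0 : R).
      by apply/funext => x; rewrite big_nil.
    rewrite e big_nil; split; first exact: integrable0.
    by rewrite /Rintegral integral0.
  have e : (fun x => \sum_(j <- i :: r) f j x) = (fun x => f i x + \sum_(j <- r) f j x).
    by apply/funext => x; rewrite big_cons.
  rewrite e big_cons; split; first exact: (integrableD measurableT (fi i) ih1).
  by rewrite RintegralD// ih2.
exact: h.
Qed.

Lemma bm_integrable f : bm f -> mu.-integrable setT (EFin \o f).
Proof.
move=> [mf [M fM]]; apply: measurable_bounded_integrable => //.
  by rewrite mu1 ltry.
exists M; split; first by rewrite num_real.
by move=> N MN x _; exact: le_trans (fM x) (ltW MN).
Qed.

Lemma Rint_cst (c : R) : \int[mu]_x c = c.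
Proof. by rewrite Rintegral_cst// mu1 mulr1. Qed.

Lemma Rint_norm_le f (M : R) : measurable_fun setT f ->
  (forall x, `|f x| <= M) -> `|\int[mu]_x f x| <= M.
Proof.
move=> mf fM; have bf : bm f by split => //; exists M.
rewrite (le_trans (le_normr_Rintegral _ _))//; first exact: bm_integrable.
rewrite -[leRHS]Rint_cst; apply: le_Rintegral => //.
- by apply: bm_integrable; split; [exact: measurableT_comp|exists M => x; rewrite normr_id].
- exact/bm_integrable/bm_cst.
Qed.

Lemma Rint_dct (f_ : nat -> T -> R) f g :
  (forall n, measurable_fun setT (f_ n)) -> measurable_fun setT f ->
  (forall x, f_ ^~ x @ \oo --> f x) ->
  mu.-integrable setT (EFin \o g) -> (forall n x, `|f_ n x| <= g x) ->
  (fun n => \int[mu]_x f_ n x) @ \oo --> \int[mu]_x f x.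
Proof.
move=> mf_ mf cf ig fg.
have mE n : measurable_fun setT (EFin \o f_ n) by exact/measurable_EFinP.
have mE' : measurable_fun setT (EFin \o f) by exact/measurable_EFinP.
have [||ifl _ h] := @dominated_convergence _ _ _ mu setT measurableT
  (fun n => EFin \o f_ n) _ _ mE mE' _ ig.
- by apply: aeW => x _; apply: cvg_EFin; [exact: nearW|exact: cf].
- by apply: aeW => x n _; rewrite lee_fin.
by apply: fine_cvg; rewrite fineK//; exact: integrable_fin_num.
Qed.

End bounded_measurable.

(** * Integrals against a kernel along a measurable map *)

Section kernel_pullback.
Context (R : realType) dX (X : measurableType dX) dZ (Z : measurableType dZ).
Variables (P : R.-pker X ~> X) (g : Z -> X).
Hypothesis mg : measurable_fun setT g.

(** The proof of measurability is an argument of the function, though absent from its body, so that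
    the kernel structure declared below can recover it by unification. *)
Definition kpullback of measurable_fun setT g := fun z : Z => P (g z).

Let measurable_kpullback (U : set X) : measurable U ->
  measurable_fun setT ((kpullback mg) ^~ U).
Proof. by move=> mU; apply: (measurableT_comp (measurable_kernel P U mU)). Qed.

HB.instance Definition _ := isKernel.Build _ _ Z X R (kpullback mg) measurable_kpullback.
HB.instance Definition _ :=
  Kernel_isProbability.Build _ _ Z X R (kpullback mg) (fun z => prob_kernel (s := P) (g z)).

(** The integrand may depend on [z] as well as on the new state. With the kernel pulled back to [Z]
    this is the measurability of a kernel integral, applied to the positive and negative parts. *)
Lemma measurable_int_pker (k : Z * X -> \bar R) : measurable_fun setT k ->
  measurable_fun setT (fun z => (\int[P (g z)]_y k (z, y))%E).
Proof.
move=> mk; under eq_fun do rewrite integralE.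
apply: emeasurable_funB.
- under eq_fun do under eq_integral do rewrite (funeposE (fun _ => _)) -(funeposE k).
  exact: measurable_fun_integral_finite_kernel (kpullback mg)
    (fun z => funepos_ge0 k z) (measurable_funepos mk).
- under eq_fun do under eq_integral do rewrite (funenegE (fun _ => _)) -(funenegE k).
  exact: measurable_fun_integral_finite_kernel (kpullback mg)
    (fun z => funeneg_ge0 k z) (measurable_funeneg mk).
Qed.

End kernel_pullback.

(** * Kernel integrals of functions of two consecutive states *)

Section kernel_operator.
Context (R : realType) dX (X : measurableType dX) (P : R.-pker X ~> X).
Implicit Types (k : X -> X -> R) (f : X -> R).

Definition kint k (x : X) : R := \int[P x]_y k x y.

Definition jmeas k := measurable_fun setT (fun q : X * X => k q.1 q.2).
Definition kintegrable k := forall x, (P x).-integrable setT (EFin \o k x).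

Lemma jmeas_section k x : jmeas k -> measurable_fun setT (k x).
Proof. by move=> mk; exact: (measurableT_comp mk (pair1_measurable x)). Qed.

Lemma measurable_kint k : jmeas k -> measurable_fun setT (kint k).
Proof.
move=> mk; apply: measurableT_comp => //.
by apply: (measurable_int_pker P (@measurable_id _ _ setT)
  (k := fun q => (k q.1 q.2)%:E)); exact/measurable_EFinP.
Qed.

Lemma jmeas_snd f : measurable_fun setT f -> jmeas (fun _ => f).
Proof. by move=> mf; exact: (measurableT_comp mf). Qed.

Lemma jmeas_fst f : measurable_fun setT f -> jmeas (fun x _ => f x).
Proof. by move=> mf; exact: (measurableT_comp mf). Qed.

Definition jbm k := bm (fun q : X * X => k q.1 q.2).

Lemma jbm_section k x : jbm k -> bm (k x).
Proof.
move=> [mk [M kM]]; split; first exact: jmeas_section.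
by exists M => y; exact: (kM (x, y)).
Qed.

Lemma jbm_snd f : bm f -> jbm (fun _ => f).
Proof. by move=> [mf [M fM]]; split; [exact: jmeas_snd|exists M => q; exact: fM]. Qed.

Lemma jbm_fst f : bm f -> jbm (fun x _ => f x).
Proof. by move=> [mf [M fM]]; split; [exact: jmeas_fst|exists M => q; exact: fM]. Qed.

Lemma jbm_kintegrable k : jbm k -> kintegrable k.
Proof.
move=> bk x; apply: bm_integrable; last exact: jbm_section.
exact: prob_kernel.
Qed.

Lemma kint_le_bound k (M : R) : jmeas k -> (forall x y, `|k x y| <= M) ->
  forall x, `|kint k x| <= M.
Proof.
move=> mk kM x; apply: Rint_norm_le => //; first exact: prob_kernel.
exact: jmeas_section.
Qed.

Lemma bm_kint k : jbm k -> bm (kint k).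
Proof.
move=> [mk [M kM]]; split; first exact: measurable_kint.
by exists M => x; apply: kint_le_bound => // y z; exact: (kM (y, z)).
Qed.

Lemma kintD k l x : kintegrable k -> kintegrable l ->
  kint (fun x y => k x y + l x y) x = kint k x + kint l x.
Proof. by move=> ik il; rewrite /kint RintegralD. Qed.

Lemma kintB k l x : kintegrable k -> kintegrable l ->
  kint (fun x y => k x y - l x y) x = kint k x - kint l x.
Proof. by move=> ik il; rewrite /kint RintegralB. Qed.

Lemma kintZ (c : X -> R) k x : kintegrable k ->
  kint (fun x y => c x * k x y) x = c x * kint k x.
Proof. by move=> ik; rewrite /kint RintegralZl. Qed.

Lemma kint_le k l x : kintegrable k -> kintegrable l ->
  (forall y, k x y <= l x y) -> kint k x <= kint l x.
Proof. by move=> ik il kl; apply: le_Rintegral => // y _; exact: kl. Qed.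

Lemma kint_cst (c : X -> R) x : kint (fun x _ => c x) x = c x.
Proof. by rewrite /kint Rint_cst//; exact: prob_kernel. Qed.

Lemma kintegrableD k l : kintegrable k -> kintegrable l ->
  kintegrable (fun x y => k x y + l x y).
Proof. by move=> ik il x; exact: (integrableD measurableT (ik x) (il x)). Qed.

Lemma kintegrableB k l : kintegrable k -> kintegrable l ->
  kintegrable (fun x y => k x y - l x y).
Proof. by move=> ik il x; exact: (integrableB measurableT (ik x) (il x)). Qed.

Lemma kintegrableZ (c : X -> R) k : kintegrable k ->
  kintegrable (fun x y => c x * k x y).
Proof. by move=> ik x; exact: (integrableZl measurableT (c x) (ik x)). Qed.

Lemma kintegrable_bounded_mul h k : jbm h -> jmeas k -> kintegrable k ->
  kintegrable (fun x y => h x y * k x y).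
Proof.
move=> [mh [M hM]] mk ik x.
have hM' y : `|h x y| <= M by exact: (hM (x, y)).
have M0 : 0 <= M by exact: le_trans (hM' x).
have iM : (P x).-integrable setT (fun y => M%:E * (k x y)%:E)%E.
  exact: (integrableZl measurableT M (ik x)).
apply: (le_integrable measurableT _ _ iM).
- apply/measurable_EFinP; apply: measurable_funM; exact: jmeas_section.
- move=> y _ /=; rewrite lee_fin !normrM (ger0_norm M0).
  exact: ler_wpM2r.
Qed.

End kernel_operator.

(** * Functionals controlled on indicators *)

Section layer_cake.
Context d (T : measurableType d) (R : realType).
Implicit Types f : T -> R.

(** The sum counts the positive integers up to [y], so it is the integer part of [y]. *)
Lemma count_levels (n : nat) (y : R) : 0 <= y -> y <= n%:R ->
  y - 1 <= \sum_(k < n) ((k.+1%:R <= y)%R : nat)%:R <= y.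
Proof.
move=> y0; elim: n => [|n ih] yn.
  by rewrite big_ord0; lra.
rewrite big_ord_recr /=; have [yn1|yn1] := leP (n%:R : R) y; last first.
  rewrite (_ : (n.+1%:R <= y) = false) ?addr0; first by apply: ih; exact: ltW.
  by apply/negbTE; rewrite -ltNge (lt_trans yn1)// ltr_nat.
rewrite (eq_bigr (fun=> 1)); last first.
  by move=> i _; rewrite (le_trans _ yn1)// ler_nat.
rewrite sumr_const card_ord -[1 *+ n]/(n%:R).
move: yn; rewrite -natr1 => yn.
by case: (leP (n%:R + 1) y) => h /=; lra.
Qed.

(** Superlevel sets are used rather than slices: all the weights equal [1 / n], so a bound valid on
    every indicator passes to the average without loss. *)
Definition levels (n : nat) f (x : T) : R :=
  n%:R^-1 * \sum_(k < n) \1_[set y | k.+1%:R <= n%:R * f y] x.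

Lemma measurable_level f n k : measurable_fun setT f ->
  measurable [set y : T | (k.+1%:R : R) <= n%:R * f y].
Proof.
move=> mf; have mnf : measurable_fun setT (fun y => n%:R * f y).
  by apply: measurable_funM.
have := mnf measurableT _ (measurable_itv `[(k.+1%:R : R), +oo[).
rewrite setTI; congr measurable; apply/seteqP; split => y /=;
  by rewrite in_itv/= andbT.
Qed.

Lemma bm_levels n f : measurable_fun setT f -> bm (levels n f).
Proof.
move=> mf; apply: bmZ; apply: (@bm_sum _ _ _ 'I_n
  (fun k => \1_[set y | k.+1%:R <= n%:R * f y])) => k.
exact/bm_indic/measurable_level.
Qed.

Lemma levels_approx n f x : 0 <= f x <= 1 -> `|f x - levels n.+1 f x| <= n.+1%:R^-1.
Proof.
move=> /andP[f0 f1]; rewrite /levels.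
under eq_bigr do rewrite indicE mem_setE.
have n0 : (0 : R) < n.+1%:R by [].
have /andP[h1 h2] : n.+1%:R * f x - 1 <=
   \sum_(k < n.+1) ((k.+1%:R <= n.+1%:R * f x)%R : nat)%:R <= n.+1%:R * f x.
  by apply: count_levels; [rewrite mulr_ge0|rewrite ler_piMr].
set s := \sum_(k < _) _ in h1 h2 *.
have -> : f x - n.+1%:R^-1 * s = n.+1%:R^-1 * (n.+1%:R * f x - s).
  by rewrite mulrBr mulKf ?gt_eqF.
by rewrite normrM ger0_norm// ler_piMr// ler_norml; lra.
Qed.

(** A function with values in [0, 1] is within [1 / n] of an average of [n] indicators, on which
    [Phi] is at most [e]. The crude constant [C] serves only to make the remainder vanish with
    [1 / n], and is absent from the conclusion. *)
Lemma functional_bound (Phi : (T -> R) -> R) (C e : R) :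
  (forall f g, bm f -> bm g -> Phi (fun x => f x + g x) = Phi f + Phi g) ->
  (forall c f, bm f -> Phi (fun x => c * f x) = c * Phi f) ->
  (forall f M, bm f -> (forall x, `|f x| <= M) -> `|Phi f| <= C * M) ->
  (forall A, measurable A -> `|Phi (\1_A)| <= e) ->
  forall f, measurable_fun setT f -> (forall x, 0 <= f x <= 1) -> `|Phi f| <= e.
Proof.
move=> PD PZ PB PA f mf f01; apply/ler_addgt0Pr => r r0.
have Psum n (F : nat -> T -> R) : (forall k, bm (F k)) ->
    Phi (fun x => \sum_(k < n) F k x) = \sum_(k < n) Phi (F k).
  move=> bF; elim: n => [|n ih].
    under eq_fun do rewrite big_ord0; rewrite big_ord0.
    rewrite (_ : (fun=> 0) = (fun=> 0 * (0 : R))); first by rewrite PZ ?mul0r//; exact: bm_cst.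
    by apply/funext => ?; rewrite mul0r.
  under eq_fun do rewrite big_ord_recr /=.
  by rewrite big_ord_recr/= PD ?ih//; exact: bm_sum.
have bf : bm f by split => //; exists 1 => x; have /andP[? ?] := f01 x; rewrite ger0_norm.
have [n nr] : exists n, `|C| * n.+1%:R^-1 <= r.
  exists (Num.bound (`|C| / r)); rewrite ler_pdivrMr// mulrC -ler_pdivrMr//.
  rewrite (le_trans (ltW (archi_boundP _)))// ?ler_nat//.
  by rewrite divr_ge0// ltW.
have bl := bm_levels n.+1 mf.
have -> : f = (fun x => levels n.+1 f x + (f x - levels n.+1 f x)).
  by apply/funext => x; rewrite addrC subrK.
rewrite PD//; last exact: bmB.
rewrite (le_trans (ler_normD _ _))// lerD//; last first.
  apply: le_trans nr; apply: (le_trans (PB _ n.+1%:R^-1 _ _)); [exact: bmB| |].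
  - by move=> x; exact: levels_approx.
  - by rewrite ler_wpM2r// ler_norm.
have bi k : bm (\1_[set y | k.+1%:R <= n.+1%:R * f y] : T -> R).
  exact/bm_indic/measurable_level.
rewrite /levels PZ; last exact: (@bm_sum _ _ _ 'I_n.+1 (fun k => \1_[set y | k.+1%:R <= n.+1%:R * f y])).
rewrite (Psum n.+1 (fun k => \1_[set y | k.+1%:R <= n.+1%:R * f y]))//.
rewrite normrM ger0_norm// ler_pdivrMl//.
apply: (le_trans (ler_norm_sum _ _ _)).
apply: (@le_trans _ _ (\sum_(k < n.+1) e)).
  by apply: ler_sum => k _; apply/PA/measurable_level.
by rewrite sumr_const card_ord mulr_natl.
Qed.

(** Since [Phi] kills constants, [f] may be moved into [0, 1] by an affine map of slope [1 / (2 M)];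
    this is the origin of the factor [2 M]. With [e = 0] it identifies two functionals that agree on
    indicators. *)
Lemma functional_bound0 (Phi : (T -> R) -> R) (C e : R) :
  (forall f g, bm f -> bm g -> Phi (fun x => f x + g x) = Phi f + Phi g) ->
  (forall c f, bm f -> Phi (fun x => c * f x) = c * Phi f) ->
  (forall f M, bm f -> (forall x, `|f x| <= M) -> `|Phi f| <= C * M) ->
  (forall A, measurable A -> `|Phi (\1_A)| <= e) -> Phi (fun=> 1) = 0 ->
  forall f M, 0 <= M -> measurable_fun setT f -> (forall x, `|f x| <= M) ->
  `|Phi f| <= 2 * M * e.
Proof.
move=> PD PZ PB PA P1 f M M_ge0 mf fM.
have e0 : 0 <= e by apply: le_trans (PA set0 measurable0).
have bf : bm f by split => //; exists M.
have [M0|M0] := leP M 0.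
  have -> : f = (fun x => 0 * f x).
    apply/funext => x; rewrite mul0r; apply/eqP; rewrite -normr_le0.
    exact: le_trans (fM x) _.
  rewrite PZ// mul0r normr0.
  by rewrite !mulr_ge0.
pose h x := (2 * M)^-1 * (f x + M).
have mh : measurable_fun setT h by apply: measurable_funM => //; exact: measurable_funD.
have bh : bm h by apply: bmZ; apply: bmD => //; exact: bm_cst.
have M2 : 0 < 2 * M by rewrite mulr_gt0.
have -> : f = (fun x => 2 * M * h x + (- M) * 1).
  apply/funext => x; rewrite /h mulVKf ?gt_eqF//; lra.
rewrite PD; [|exact: bmZ|exact/bmZ/bm_cst].
rewrite PZ// (PZ _ (fun=> 1)); last exact: bm_cst.
rewrite P1 mulr0 addr0 normrM (ger0_norm (ltW M2)) ler_pM2l//.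
apply: (functional_bound PD PZ PB PA mh) => x.
have := fM x; rewrite ler_norml => /andP[? ?]; rewrite /h.
by rewrite mulr_ge0 ?invr_ge0 ?(ltW M2)//=; [rewrite ler_pdivrMl//; lra|lra].
Qed.
End layer_cake.

(** * Uniform ergodicity and the Poisson equation *)

Section poisson.
Context (R : realType) dX (X : measurableType dX) (P : R.-pker X ~> X).
Implicit Types (f : X -> R).

Lemma PopsE f : Pops P f = kint P (fun _ => f).
Proof. by []. Qed.

Lemma bm_Pops f : bm f -> bm (Pops P f).
Proof. by move=> bf; apply: bm_kint; exact: jbm_snd. Qed.

Lemma bm_Pows t f : bm f -> bm (Pows P t f).
Proof. by move=> bf; elim: t => //= t ih; exact: bm_Pops. Qed.

Lemma PowsS t f : Pows P t.+1 f = Pops P (Pows P t f).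
Proof. by []. Qed.

Lemma Pops_norm_le f (M : R) : bm f -> (forall x, `|f x| <= M) ->
  forall x, `|Pops P f x| <= M.
Proof. by move=> [mf _] fM; apply: kint_le_bound => //; exact: jmeas_snd. Qed.

Lemma Pows_norm_le t f (M : R) : bm f -> (forall x, `|f x| <= M) ->
  forall x, `|Pows P t f x| <= M.
Proof.
move=> bf fM; elim: t => //= t ih x; apply: Pops_norm_le => //; exact: bm_Pows.
Qed.

Lemma kintegrable_bm f : bm f -> kintegrable P (fun _ => f).
Proof. by move=> bf; exact/jbm_kintegrable/jbm_snd. Qed.

Lemma PopsD f g : bm f -> bm g ->
  Pops P (fun x => f x + g x) = (fun x => Pops P f x + Pops P g x).
Proof. by move=> bf bg; apply/funext => x; apply: kintD; exact: kintegrable_bm. Qed.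

Lemma PopsZ (c : R) f : bm f -> Pops P (fun x => c * f x) = (fun x => c * Pops P f x).
Proof. by move=> bf; apply/funext => x; apply: (kintZ (fun=> c)); exact: kintegrable_bm. Qed.

Lemma Pops_cst (c : R) : Pops P (fun=> c) = (fun=> c).
Proof. by apply/funext => x; exact: (kint_cst P (fun=> c)). Qed.

Lemma PopsB f g : bm f -> bm g ->
  Pops P (fun x => f x - g x) = (fun x => Pops P f x - Pops P g x).
Proof. by move=> bf bg; apply/funext => x; apply: kintB; exact: kintegrable_bm. Qed.

Lemma PowsD t f g : bm f -> bm g ->
  Pows P t (fun x => f x + g x) = (fun x => Pows P t f x + Pows P t g x).
Proof.
move=> bf bg; elim: t => // t ih.
by rewrite PowsS ih PopsD//; exact: bm_Pows.
Qed.

Lemma PowsZ t (c : R) f : bm f -> Pows P t (fun x => c * f x) = (fun x => c * Pows P t f x).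
Proof.
move=> bf; elim: t => // t ih; by rewrite PowsS ih PopsZ//; exact: bm_Pows.
Qed.

Lemma Pows_cst t (c : R) : Pows P t (fun=> c) = (fun=> c).
Proof. by elim: t => // t ih; rewrite PowsS ih Pops_cst. Qed.

Variables (pi : probability X R) (kappa rho : R).
Hypothesis kappa_ge0 : 0 <= kappa.
Hypothesis rho01 : 0 <= rho < 1.
Hypothesis ergodic : forall xi t (A : set X), measurable A ->
  `|Pows P t (fun y => \1_A y) xi - fine (pi A)| <= kappa * rho ^+ t / 2.

Let rho_ge0 : 0 <= rho. Proof. by have /andP[] := rho01. Qed.

(** The functional [P^t - pi] kills constants and is bounded on indicators by the total variation
    hypothesis, whose factor 1/2 cancels the 2 of [functional_bound0]. *)
Lemma Pows_ergodic f (M : R) t x : 0 <= M -> bm f -> (forall y, `|f y| <= M) ->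
  `|Pows P t f x - \int[pi]_y f y| <= M * kappa * rho ^+ t.
Proof.
move=> M0 bf fM.
have -> : M * kappa * rho ^+ t = 2 * M * (kappa * rho ^+ t / 2) by field.
have ipi g : bm g -> pi.-integrable setT (EFin \o g).
  by move=> bg; apply: bm_integrable => //; exact: probability_setT.
apply: (@functional_bound0 _ _ _ (fun f => Pows P t f x - \int[pi]_y f y) 2) => //.
- move=> g h bg bh; rewrite PowsD// RintegralD//; [ring|exact: ipi|exact: ipi].
- by move=> c g bg; rewrite PowsZ// RintegralZl ?mulrBr//; exact: ipi.
- move=> g N bg gN; rewrite (le_trans (ler_normB _ _))// mulr_natl mulr2n lerD//.
    exact: Pows_norm_le.
  by apply: Rint_norm_le => //; [exact: probability_setT|case: bg].
- move=> A mA; have := ergodic x t mA; congr (`| _ - _| <= _).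
  by rewrite /Rintegral integral_indic// setIT.
- by rewrite Pows_cst Rint_cst ?subrr//; exact: probability_setT.
- by case: bf.
Qed.

Definition poisson_sol f (x : X) : R :=
  limn (fun N => \sum_(t < N) (Pows P t f x - \int[pi]_y f y)).

Section sol.
Variables (f : X -> R) (M : R).
Hypotheses (M_ge0 : 0 <= M) (bf : bm f) (fM : forall x, `|f x| <= M).

Let c := \int[pi]_y f y.
Let S (N : nat) x := \sum_(t < N) (Pows P t f x - c).

Let bS N : bm (S N).
Proof. by apply: (bm_sum (f := fun (t : 'I_N) x => Pows P t f x - c)) => t; apply: bmB; [exact: bm_Pows|exact: bm_cst]. Qed.

Let SE x : (fun N => S N x) = series (fun t => Pows P t f x - c).
Proof. by apply/funext => N; rewrite /series/= big_mkord. Qed.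

Let Sle N x : `|S N x| <= M * kappa / (1 - rho).
Proof.
have [r0 r1] := andP rho01.
apply: (le_trans (ler_norm_sum _ _ _)).
apply: (@le_trans _ _ (\sum_(t < N) M * kappa * rho ^+ t)).
  by apply: ler_sum => t _; exact: Pows_ergodic.
rewrite -mulr_sumr ler_wpM2l ?mulr_ge0//.
rewrite -[leRHS]div1r ler_pdivlMr ?subr_gt0//.
by have := subrX1 rho N; have := exprn_ge0 N rho_ge0; lra.
Qed.

Lemma poisson_sol_cvg x :
  (fun N => \sum_(t < N) (Pows P t f x - c)) @ \oo --> poisson_sol f x.
Proof.
suff : cvgn (series (fun t => Pows P t f x - c)) by rewrite -SE.
apply: normed_cvg.
apply: (@series_le_cvg _ _ (geometric (M * kappa) rho)).
- by move=> n /=.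
- by move=> n /=; rewrite mulr_ge0 ?exprn_ge0// mulr_ge0.
- by move=> n /=; exact: Pows_ergodic.
- by apply: is_cvg_geometric_series; have [r0 r1] := andP rho01; rewrite ger0_norm.
Qed.

Lemma poisson_sol_le x : `|poisson_sol f x| <= M * kappa / (1 - rho).
Proof.
have h : (fun N => `|S N x|) @ \oo --> `|poisson_sol f x|.
  by apply: cvg_norm; exact: poisson_sol_cvg.
rewrite -(cvg_lim _ h)//; apply: limr_le; first by apply/cvg_ex; eexists; exact: h.
by apply: nearW => N; exact: Sle.
Qed.

Lemma bm_poisson_sol : bm (poisson_sol f).
Proof.
split; last by exists (M * kappa / (1 - rho)); exact: poisson_sol_le.
by apply: (measurable_fun_cvg (fun N => proj1 (bS N))) => x _; exact: poisson_sol_cvg.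
Qed.

(** Applying [P] to a partial sum shifts it by one index, which removes the term [f - c] of time 0.
    The partial sums are bounded uniformly, so [P] passes to the limit by dominated convergence. *)
Lemma poisson_solP x :
  Pops P (poisson_sol f) x = poisson_sol f x - f x + c.
Proof.
have h1 : (fun N => Pops P (S N) x) @ \oo --> Pops P (poisson_sol f) x.
  apply: (@Rint_dct _ _ _ (P x) S _ (fun=> M * kappa / (1 - rho))).
  - by move=> N; case: (bS N).
  - by case: bm_poisson_sol.
  - by move=> y; exact: poisson_sol_cvg.
  - by apply: bm_integrable; [exact: prob_kernel|exact: bm_cst].
  - by move=> N y; exact: Sle.
have h2 : (fun N => S N.+1 x - f x + c) @ \oo --> poisson_sol f x - f x + c.
  apply: cvgD; last exact: cvg_cst.
  apply: cvgB; last exact: cvg_cst.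
  by rewrite (cvg_shiftS (fun N => S N x)); exact: poisson_sol_cvg.
suff e : (fun N => Pops P (S N) x) = (fun N => S N.+1 x - f x + c).
  by rewrite e in h1; exact: cvg_unique h1 h2.
apply/funext => N; elim: N => [|N ih].
  rewrite /S; under eq_fun do rewrite big_ord0.
  by rewrite Pops_cst big_ord_recr big_ord0 /=; lra.
have eS n : S n.+1 = (fun y => S n y + (Pows P n f y - c)).
  by apply/funext => y; rewrite /S big_ord_recr.
rewrite {1}eS PopsD//; last by apply: bmB; [exact: bm_Pows|exact: bm_cst].
rewrite ih PopsB ?Pops_cst; [|exact: bm_Pows|exact: bm_cst].
rewrite [in RHS]eS -PowsS; ring.
Qed.

End sol.
End poisson.

(** * Stationary laws of tilted kernels *)

Section stationary_functions.
Context (R : realType) dX (X : measurableType dX) (P : R.-pker X ~> X).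
Variables (w : X -> X -> R) (mu : probability X R).
Hypotheses (bw : jbm w) (w_ge0 : forall x y, 0 <= w x y).
Hypothesis w_stat : stationary P w mu.
Implicit Types (f : X -> R).

Let mu1 : mu setT = 1%E. Proof. exact: probability_setT. Qed.

Let bwf f : bm f -> jbm (fun x y => w x y * f y).
Proof. by move=> bf; apply: bmM => //; exact: jbm_snd. Qed.

Lemma EFin_kint k x : kintegrable P k -> (kint P k x)%:E = (\int[P x]_y (k x y)%:E)%E.
Proof. by move=> ik; rewrite /kint /Rintegral fineK//; apply: integrable_fin_num => //; exact: ik. Qed.

Lemma EFin_Rint f : mu.-integrable setT (EFin \o f) ->
  (\int[mu]_y f y)%:E = (\int[mu]_y (f y)%:E)%E.
Proof. by move=> ik; rewrite /Rintegral fineK//; exact: integrable_fin_num. Qed.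

(** Stationarity is given on measurable sets. The difference of the two sides is a bounded linear
    functional of [f] that vanishes on indicators, so [functional_bound0] applies with [e = 0]. *)
Lemma stationary_bm f : bm f -> \int[mu]_x f x = \int[mu]_x kint P (fun x y => w x y * f y) x.
Proof.
move=> bf; have [mf [M0 fM0]] := bf; have [mw [W wW]] := bw.
pose M := `|M0|; have fM x : `|f x| <= M by rewrite (le_trans (fM0 x))// ler_norm.
have M0' : 0 <= M by exact: normr_ge0.
have ii g : bm g -> mu.-integrable setT (EFin \o g) by move=> bg; exact: bm_integrable.
have ik g : bm g -> kintegrable P (fun x y => w x y * g y).
  by move=> bg; exact/jbm_kintegrable/bwf.
apply/eqP; rewrite -subr_eq0 -normr_le0.
rewrite [leRHS](_ : _ = 2 * M * 0); last by rewrite mulr0.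
pose Phi g := \int[mu]_x g x - \int[mu]_x kint P (fun x y => w x y * g y) x.
have PhiA A : measurable A -> Phi (\1_A) = 0.
  move=> mA; rewrite /Phi {1}/Rintegral integral_indic// setIT.
  apply/eqP; rewrite subr_eq0; apply/eqP; congr fine; apply: (etrans (w_stat mA)).
  apply: eq_integral => x _.
  rewrite EFin_kint; last exact/ik/bm_indic.
  by apply: eq_integral => y _.
apply: (@functional_bound0 _ _ _ Phi (1 + W)) => //.
- move=> g h bg bh; rewrite /Phi RintegralD; [|exact: measurableT|exact: ii|exact: ii].
  under [X in _ - X]eq_Rintegral => x _.
    rewrite (_ : (fun x y => _) = (fun x y => w x y * g y + w x y * h y)); last first.
      by apply/funext => ?; apply/funext => ?; rewrite mulrDr.
    rewrite kintD; [|exact: ik|exact: ik]; over.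
  rewrite RintegralD; [ring|exact: measurableT|exact/ii/bm_kint/bwf|exact/ii/bm_kint/bwf].
- move=> c g bg; rewrite /Phi RintegralZl; [|exact: measurableT|exact: ii].
  under [X in _ - X]eq_Rintegral => x _.
    rewrite (_ : (fun x y => _) = (fun x y => c * (w x y * g y))); last first.
      by apply/funext => ?; apply/funext => ?; rewrite mulrCA.
    rewrite (kintZ (fun=> c)); last exact: ik.
    over.
  by rewrite RintegralZl ?mulrBr//; exact/ii/bm_kint/bwf.
- move=> g N bg gN; rewrite (le_trans (ler_normB _ _))// mulrDl mul1r lerD//.
    by apply: Rint_norm_le => //; case: bg.
  apply: Rint_norm_le => //; first by apply: measurable_kint; case: (bwf bg).
  apply: kint_le_bound; first by case: (bwf bg).
  by move=> x y; rewrite normrM ler_pM//; exact: (wW (x, y)).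
- by move=> A mA; rewrite PhiA// normr0.
- rewrite (_ : (fun=> 1) = \1_setT); first by rewrite PhiA.
  by apply/funext => x; rewrite indicE in_setT.
Qed.

(** The identity is kept in the extended reals: finiteness of one side then gives finiteness of the
    other, and this is how integrability is transferred. The truncations [min (f, n)] and two
    monotone limits reduce it to bounded functions. *)
Lemma stationary_ge0 f : measurable_fun setT f -> (forall x, 0 <= f x) ->
  (\int[mu]_x (f x)%:E = \int[mu]_x \int[P x]_y (w x y * f y)%:E)%E.
Proof.
move=> mf f0; pose fn n x : R := Num.min (f x) n%:R.
have fn0 n x : 0 <= fn n x by rewrite le_min f0 ler0n.
have mfn n : measurable_fun setT (fn n).
  by apply: measurable_minr.
have bfn n : bm (fn n).
  by split => //; exists n%:R => x; rewrite ger0_norm// ge_min lexx orbT.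
have ndf x : {homo (fun n => fn n x) : n m / (n <= m)%N >-> n <= m}.
  by move=> n m nm; rewrite /fn le_min ge_min lexx/= ge_min ler_nat nm orbT.
have cf x : (fun n => fn n x) @ \oo --> f x.
  apply: cvg_near_cst; exists (Num.bound (f x)) => // n /= hn.
  apply/min_idPl; apply: (le_trans (ltW (archi_boundP (f0 x)))).
  by rewrite ler_nat.
have c1 : (fun n => \int[mu]_x (fn n x)%:E)%E @ \oo --> (\int[mu]_x (f x)%:E)%E.
  have -> : (\int[mu]_x (f x)%:E)%E = (\int[mu]_x limn (fun n => (fn n x)%:E))%E.
    apply: eq_integral => x _; apply/esym/cvg_lim => //.
    by apply: cvg_EFin; [exact: nearW|exact: cf].
  apply: cvg_monotone_convergence => //.
  - by move=> n; apply/measurable_EFinP.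
  - by move=> n x _; rewrite lee_fin.
  - by move=> x _ n m nm; rewrite lee_fin ndf.
have c2 : (fun n => \int[mu]_x \int[P x]_y (w x y * fn n y)%:E)%E @ \oo -->
    (\int[mu]_x \int[P x]_y (w x y * f y)%:E)%E.
  have mw x : measurable_fun setT (w x) by apply: jmeas_section; case: bw.
  have mi n x : measurable_fun setT (fun y => (w x y * fn n y)%:E).
    by apply/measurable_EFinP; exact: measurable_funM.
  have le_wf n x y : (0 <= (w x y * fn n y)%:E)%E by rewrite lee_fin mulr_ge0.
  have nd x y : {homo (fun n => (w x y * fn n y)%:E) : n m / (n <= m)%N >-> (n <= m)%E}.
    by move=> n m nm; rewrite lee_fin ler_wpM2l// ndf.
  have -> : (\int[mu]_x \int[P x]_y (w x y * f y)%:E)%E =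
      (\int[mu]_x limn (fun n => \int[P x]_y (w x y * fn n y)%:E))%E.
    apply: eq_integral => x _.
    rewrite -(monotone_convergence (P x) measurableT (mi^~ x))//.
    apply: eq_integral => y _; apply/esym/cvg_lim => //.
    apply: cvg_EFin; first exact: nearW.
    by apply: cvgMr; exact: cf.
  apply: cvg_monotone_convergence => //.
  - move=> n; apply: (measurable_int_pker P (@measurable_id _ _ setT)
      (k := fun q => (w q.1 q.2 * fn n q.2)%:E)).
    by apply/measurable_EFinP; case: (bwf (bfn n)).
  - by move=> n x _; apply: integral_ge0 => y _.
  - move=> x _ n m nm; apply: ge0_le_integral => // y _.
    exact: nd.
have e n : (\int[mu]_x (fn n x)%:E = \int[mu]_x \int[P x]_y (w x y * fn n y)%:E)%E.
  rewrite -EFin_Rint; last exact: bm_integrable.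
  rewrite stationary_bm// EFin_Rint; last exact/(bm_integrable mu1)/bm_kint/bwf.
  by apply: eq_integral => x _; rewrite EFin_kint//; exact/jbm_kintegrable/bwf.
rewrite (_ : (fun n => _) = (fun n => \int[mu]_x (fn n x)%:E)%E) in c2; last first.
  by apply/funext => n; rewrite e.
exact: cvg_unique c1 c2.
Qed.

Lemma stationary_integrable f : kintegrable P (fun _ => f) -> mu.-integrable setT (EFin \o f) ->
  mu.-integrable setT (EFin \o kint P (fun x y => w x y * f y)).
Proof.
move=> kf fi; have mf : measurable_fun setT f by have /measurable_EFinP := measurable_int mu fi.
have kwf := kintegrable_bounded_mul bw (jmeas_snd mf) kf.
have mwf : jmeas (fun x y => w x y * f y).
  by apply: measurable_funM; [case: bw|exact: jmeas_snd].
apply/integrableP; split; first by apply/measurable_EFinP/measurable_kint.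
have /integrableP[_] := fi; apply: le_lt_trans.
rewrite (_ : (fun x => `|(EFin \o f) x|)%E = (fun x => `|f x|%:E)); last first.
  by apply/funext => x.
have mnf : measurable_fun setT (fun x => `|f x|) by exact: measurableT_comp.
rewrite (stationary_ge0 mnf)//.
have mabs : measurable_fun setT (fun q : X * X => (w q.1 q.2 * `|f q.2|)%:E).
  apply/measurable_EFinP; apply: measurable_funM; first by case: bw.
  by apply: measurableT_comp => //; exact: (jmeas_snd mf).
apply: ge0_le_integral => //.
- by apply: measurableT_comp => //; apply/measurable_EFinP; exact: measurable_kint.
- exact: (measurable_int_pker P (@measurable_id _ _ setT) (k := fun q => (w q.1 q.2 * `|f q.2|)%:E)).
- move=> x _ /=; rewrite -[(`|_|)%:E]/(`|(kint P (fun x y => w x y * f y) x)%:E|)%E EFin_kint//.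
  apply: (le_trans (le_abse_integral _ _ _)) => //.
    by apply/measurable_EFinP; exact: (jmeas_section (k := fun x y => w x y * f y)).
  rewrite le_eqVlt; apply/orP; left; apply/eqP; apply: eq_integral => y _ /=.
  by rewrite normrM (ger0_norm (w_ge0 _ _)).
Qed.

Lemma stationary_int f : kintegrable P (fun _ => f) -> mu.-integrable setT (EFin \o f) ->
  \int[mu]_x f x = \int[mu]_x kint P (fun x y => w x y * f y) x.
Proof.
move=> kf fi; have mf : measurable_fun setT f by have /measurable_EFinP := measurable_int mu fi.
pose fp x := Num.max (f x) 0; pose fm x := Num.max (- f x) 0.
have fE : f = (fun x => fp x - fm x).
  by apply/funext => x; rewrite /fp /fm; case: (leP (f x) 0) => h; case: (leP (- f x) 0) => h'; lra.
have mfp : measurable_fun setT fp by exact: measurable_maxr.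
have mfm : measurable_fun setT fm by apply: measurable_maxr => //; exact: measurable_funN.
have fp0 x : 0 <= fp x by rewrite le_max lexx orbT.
have fm0 x : 0 <= fm x by rewrite le_max lexx orbT.
have fpf x : `|fp x| <= `|f x| by rewrite ger0_norm// /fp; case: (leP (f x) 0) => // ?; rewrite ler_norm.
have fmf x : `|fm x| <= `|f x|.
  by rewrite ger0_norm// /fm -normrN; case: (leP (- f x) 0) => // ?; rewrite ler_norm.
have ifp : mu.-integrable setT (EFin \o fp).
  by apply: (le_integrable measurableT _ _ fi); [exact/measurable_EFinP|move=> x _; rewrite lee_fin].
have ifm : mu.-integrable setT (EFin \o fm).
  by apply: (le_integrable measurableT _ _ fi); [exact/measurable_EFinP|move=> x _; rewrite lee_fin].
have kfp : kintegrable P (fun _ => fp).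
  by move=> x; apply: (le_integrable measurableT _ _ (kf x)); [exact/measurable_EFinP|move=> y _; rewrite lee_fin].
have kfm : kintegrable P (fun _ => fm).
  by move=> x; apply: (le_integrable measurableT _ _ (kf x)); [exact/measurable_EFinP|move=> y _; rewrite lee_fin].
have kwfp := kintegrable_bounded_mul bw (jmeas_snd mfp) kfp.
have kwfm := kintegrable_bounded_mul bw (jmeas_snd mfm) kfm.
have e (g : X -> R) : measurable_fun setT g -> (forall x, 0 <= g x) ->
    kintegrable P (fun x y => w x y * g y) ->
    \int[mu]_x g x = \int[mu]_x kint P (fun x y => w x y * g y) x.
  move=> mg g0 kg; rewrite /Rintegral; congr fine; rewrite stationary_ge0//.
  by apply: eq_integral => x _; rewrite EFin_kint.
rewrite fE RintegralB// e// (e fm)// -RintegralB//; [|exact: stationary_integrable|exact: stationary_integrable].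
apply: eq_Rintegral => x _; rewrite -kintB//; apply: eq_Rintegral => y _.
by rewrite mulrBr.
Qed.

End stationary_functions.

(** * Powers of a tilted transition operator *)

Section tilted_operator.
Context (R : realType) dX (X : measurableType dX) (P : R.-pker X ~> X).
Variables (w : X -> X -> R) (a : R).
Hypotheses (jw : jmeas w) (w_ge0 : forall x y, 0 <= w x y).
Hypothesis w_near1 : forall x y, `|w x y - 1| <= a.
Hypothesis w_mean1 : forall x, kint P w x = 1.
Implicit Types (f g : X -> R).

Definition tilt f (x : X) : R := kint P (fun x y => w x y * f y) x.

Lemma tilt_jbm : jbm w.
Proof.
split => //; exists (1 + a) => q.
rewrite -[w _ _](subrK 1) addrC (le_trans (ler_normD _ _))// normr1 lerD2l.
exact: w_near1.
Qed.

Lemma tilt_jbmM f : bm f -> jbm (fun x y => w x y * f y).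
Proof. by move=> bf; apply: bmM; [exact: tilt_jbm|exact: jbm_snd]. Qed.

Lemma bm_tilt f : bm f -> bm (tilt f).
Proof. by move=> bf; exact/bm_kint/tilt_jbmM. Qed.

Let kwf f : bm f -> kintegrable P (fun x y => w x y * f y).
Proof. by move=> bf; exact/jbm_kintegrable/tilt_jbmM. Qed.

Lemma tiltD f g : bm f -> bm g ->
  tilt (fun x => f x + g x) = (fun x => tilt f x + tilt g x).
Proof.
move=> bf bg; apply/funext => x; rewrite -kintD; [|exact: kwf|exact: kwf].
by apply: eq_Rintegral => y _; rewrite mulrDr.
Qed.

Lemma tiltZ c f : bm f -> tilt (fun x => c * f x) = (fun x => c * tilt f x).
Proof.
move=> bf; apply/funext => x; rewrite -(kintZ (fun=> c)); last exact: kwf.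
by apply: eq_Rintegral => y _; rewrite mulrCA.
Qed.

Lemma tilt_cst (c : R) : tilt (fun=> c) = (fun=> c).
Proof.
apply/funext => x; rewrite -[RHS]mulr1 -(w_mean1 x).
rewrite -(kintZ (fun=> c)); last exact/jbm_kintegrable/tilt_jbm.
by apply: eq_Rintegral => y _; rewrite mulrC.
Qed.

Lemma tilt_le f g : bm f -> bm g -> (forall x, f x <= g x) ->
  forall x, tilt f x <= tilt g x.
Proof.
move=> bf bg fg x; apply: kint_le; [exact: kwf|exact: kwf|].
by move=> y; apply: ler_wpM2l.
Qed.

Lemma tilt_norm_le f (M : R) : bm f -> (forall x, `|f x| <= M) ->
  forall x, `|tilt f x| <= M.
Proof.
move=> bf fM x; rewrite ler_norml; apply/andP; split.
  have -> : - M = tilt (fun=> - M) x by rewrite tilt_cst.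
  apply: tilt_le => //; first exact: bm_cst.
  by move=> y; have := fM y; rewrite ler_norml => /andP[].
have -> : M = tilt (fun=> M) x by rewrite tilt_cst.
apply: tilt_le => //; first exact: bm_cst.
by move=> y; have := fM y; rewrite ler_norml => /andP[].
Qed.

Lemma tilt_Pops_dist f (M : R) : bm f -> (forall x, `|f x| <= M) ->
  forall x, `|tilt f x - Pops P f x| <= a * M.
Proof.
move=> bf fM x; rewrite PopsE /tilt -kintB; [|exact: kwf|exact: kintegrable_bm].
apply: kint_le_bound.
  apply: measurable_funB; first by case: (tilt_jbmM bf).
  by apply: jmeas_snd; case: bf.
move=> y z; rewrite -[X in _ - X]mul1r -mulrBl normrM ler_pM//.
Qed.

Lemma bm_tilt_iter t f : bm f -> bm (iter t tilt f).
Proof. by move=> bf; elim: t => //= t; exact: bm_tilt. Qed.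

Lemma tilt_iter_norm_le t f (M : R) : bm f -> (forall x, `|f x| <= M) ->
  forall x, `|iter t tilt f x| <= M.
Proof.
move=> bf fM; elim: t => //= t ih; apply: tilt_norm_le => //; exact: bm_tilt_iter.
Qed.

Lemma tilt_iterD t f g : bm f -> bm g ->
  iter t tilt (fun x => f x + g x) = (fun x => iter t tilt f x + iter t tilt g x).
Proof.
by move=> bf bg; elim: t => //= t ->; rewrite tiltD//; exact: bm_tilt_iter.
Qed.

Lemma tilt_iterZ t c f : bm f ->
  iter t tilt (fun x => c * f x) = (fun x => c * iter t tilt f x).
Proof. by move=> bf; elim: t => //= t ->; rewrite tiltZ//; exact: bm_tilt_iter. Qed.

Lemma tilt_iter_cst t (c : R) : iter t tilt (fun=> c) = (fun=> c).
Proof. by elim: t => //= t ->; rewrite tilt_cst. Qed.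

Lemma tilt_iter_ge0 t f : bm f -> (forall x, 0 <= f x) -> forall x, 0 <= iter t tilt f x.
Proof.
move=> bf f0; elim: t => //= t ih x.
rewrite -[leLHS]/((fun _ : X => 0) x) -(tilt_cst 0); apply: tilt_le => //.
- exact: bm_cst.
- exact: bm_tilt_iter.
Qed.

(** Replacing one step of [P] by a tilted step costs [a M], and the tilted operator, being a
    sup-norm contraction, does not amplify the errors made earlier; they add up to [t a M]. *)
Lemma tilt_iter_Pows_dist t f (M : R) : bm f -> (forall x, `|f x| <= M) ->
  forall x, `|iter t tilt f x - Pows P t f x| <= t%:R * a * M.
Proof.
move=> bf fM; elim: t => [|t ih] x; first by rewrite subrr normr0 !mul0r.
rewrite iterS PowsS; have bt := bm_tilt_iter t bf; have bp := bm_Pows P t bf.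
have -> : tilt (iter t tilt f) x - Pops P (Pows P t f) x =
    tilt (fun y => iter t tilt f y + (-1) * Pows P t f y) x +
    (tilt (Pows P t f) x - Pops P (Pows P t f) x).
  by rewrite tiltD ?tiltZ//; [ring|exact: bmZ].
rewrite (le_trans (ler_normD _ _))// -natr1 mulrDl mul1r mulrDl lerD//.
  apply: tilt_norm_le => [|y]; first by apply: bmD => //; exact: bmZ.
  by rewrite mulN1r; exact: ih.
by apply: tilt_Pops_dist => //; exact: Pows_norm_le.
Qed.

Lemma tilt_dct (f_ : nat -> X -> R) f (M : R) : (forall n, measurable_fun setT (f_ n)) ->
  (forall n x, `|f_ n x| <= M) -> (forall x, f_ ^~ x @ \oo --> f x) ->
  forall x, (fun n => tilt (f_ n) x) @ \oo --> tilt f x.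
Proof.
move=> mf_ fM cf x; have mw : measurable_fun setT (w x) by exact: jmeas_section.
have mf : measurable_fun setT f by apply: (measurable_fun_cvg mf_) => y _; exact: cf.
apply: (@Rint_dct _ _ _ _ (fun n y => w x y * f_ n y) _ (fun=> (1 + a) * M)).
- by move=> n; exact: measurable_funM.
- exact: measurable_funM.
- by move=> y; apply: cvgMr; exact: cf.
- by apply: bm_integrable; [exact: prob_kernel|exact: bm_cst].
- move=> n y; rewrite normrM ler_pM//.
  rewrite -[w _ _](subrK 1) addrC (le_trans (ler_normD _ _))// normr1 lerD2l.
  exact: w_near1.
Qed.

Lemma tilt_iter_dct t (f_ : nat -> X -> R) f (M : R) :
  (forall n, measurable_fun setT (f_ n)) ->
  (forall n x, `|f_ n x| <= M) -> (forall x, f_ ^~ x @ \oo --> f x) ->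
  forall x, (fun n => iter t tilt (f_ n) x) @ \oo --> iter t tilt f x.
Proof.
move=> mf_ fM cf; have bf_ n : bm (f_ n) by split => //; exists M.
elim: t => //= t ih x.
apply: (@tilt_dct (fun n => iter t tilt (f_ n)) _ M) => //.
- by move=> n; case: (bm_tilt_iter t (bf_ n)).
- by move=> n y; exact: tilt_iter_norm_le.
Qed.

End tilted_operator.

(** * Existence of a stationary law for a tilted kernel *)

Section stationary_existence.
Context (R : realType) dX (X : measurableType dX) (P : R.-pker X ~> X).
Variables (pi : probability X R) (kappa rho : R).
Hypothesis ergodic : forall xi t (A : set X), measurable A ->
  `|Pows P t (fun y => \1_A y) xi - fine (pi A)| <= kappa * rho ^+ t / 2.
Variables (w : X -> X -> R) (a : R).
Hypotheses (jw : jmeas w) (w_ge0 : forall x y, 0 <= w x y).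
Hypothesis w_near1 : forall x y, `|w x y - 1| <= a.
Hypothesis w_mean1 : forall x, kint P w x = 1.
Variable N : nat.
Hypothesis N_half : N%:R * a + kappa * rho ^+ N <= 2^-1.
Implicit Types (f g : X -> R) (M c e : R) (j m n : nat).

Let Q := tilt P w.
Let D := iter N Q.

Let pi1 : pi setT = 1%E. Proof. exact: probability_setT. Qed.
Let ipi f : bm f -> pi.-integrable setT (EFin \o f).
Proof. exact: bm_integrable. Qed.

Let bQ f : bm f -> bm (Q f). Proof. exact: (bm_tilt P jw w_near1). Qed.
Let bD f : bm f -> bm (D f). Proof. exact: (bm_tilt_iter P jw w_near1). Qed.
Let bDj j f : bm f -> bm (iter j D f).
Proof. by move=> bf; elim: j => //= j; exact: bD. Qed.
Let DB f c : bm f -> D (fun x => f x - c) = (fun x => D f x - c).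
Proof.
move=> bf; rewrite /D (tilt_iterD P jw w_near1 N bf (bm_cst X (- c))).
by rewrite (tilt_iter_cst jw w_near1 w_mean1).
Qed.
Let D_norm_le f M : bm f -> (forall x, `|f x| <= M) -> forall x, `|D f x| <= M.
Proof. exact: (tilt_iter_norm_le jw w_ge0 w_near1 w_mean1). Qed.

(* [N] steps of the tilted operator halve the oscillation of a function, so that [D^j f]
   converges uniformly to a constant [L f]; [L] is the integral against the stationary
   law of the tilted chain. *)
Let ell j f := \int[pi]_x iter j D f x.

(** Two errors add up: [N a] for running [N] tilted steps in place of [N] steps of [P], and
    [kappa rho^N] for the mixing of [P]. By [N_half] their sum is at most 1/2. *)
Let D_contract f M : 0 <= M -> bm f -> (forall x, `|f x| <= M) ->
  forall x, `|D f x - \int[pi]_y f y| <= 2^-1 * M.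
Proof.
move=> M0 bf fM x; rewrite -(subrK (Pows P N f x) (D f x)) -addrA.
rewrite (le_trans (ler_normD _ _))//.
apply: (@le_trans _ _ (N%:R * a * M + M * kappa * rho ^+ N)).
  rewrite lerD//; first exact: (tilt_iter_Pows_dist jw w_ge0 w_near1 w_mean1).
  exact: (Pows_ergodic ergodic).
rewrite (_ : _ + _ = (N%:R * a + kappa * rho ^+ N) * M); last by ring.
exact: ler_wpM2r.
Qed.

Let pow_ge0 j M : 0 <= M -> 0 <= 2^-1 ^+ j * M.
Proof. by move=> M0; rewrite mulr_ge0// exprn_ge0. Qed.

Let Dj_near j f M : 0 <= M -> bm f -> (forall x, `|f x| <= M) ->
  forall x, `|iter j.+1 D f x - ell j f| <= 2^-1 ^+ j.+1 * M.
Proof.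
(* The constant changes along the induction: if [D^j f] is close to some [c], one more [D] brings it
   twice as close to the [pi]-mean of [D^j f], that is [ell j f]. Hence the shift of one between the
   exponent of [D] and the index of [ell]. *)
move=> M0 bf fM; have : exists c, forall x, `|iter j D f x - c| <= 2^-1 ^+ j * M.
  elim: j => [|j [c hc]]; first by exists 0 => x; rewrite subr0 expr0 mul1r.
  exists (ell j f) => x.
  have := D_contract (pow_ge0 j M0) (bmB (bDj j bf) (bm_cst X c)) hc x.
  rewrite DB; last exact: bDj.
  rewrite RintegralB//; [|exact/ipi/bDj|exact/ipi/bm_cst].
  rewrite Rint_cst// exprS -mulrA => h; apply: le_trans h.
  by rewrite [X in _ <= `|X|](_ : _ = iter j.+1 D f x - ell j f)//= /ell; ring.
move=> [c hc] x.
have := D_contract (pow_ge0 j M0) (bmB (bDj j bf) (bm_cst X c)) hc x.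
rewrite DB; last exact: bDj.
rewrite RintegralB//; [|exact/ipi/bDj|exact/ipi/bm_cst].
rewrite Rint_cst// exprS -mulrA => h; apply: le_trans h.
by rewrite [X in _ <= `|X|](_ : _ = iter j.+1 D f x - ell j f)//= /ell; ring.
Qed.

(** [D] fixes constants and contracts the sup norm, so later iterates stay in the ball around
    [ell j f] that [D^(j+1) f] has entered. This makes [ell] a Cauchy sequence. *)
Let Dj_near_add j m f M : 0 <= M -> bm f -> (forall x, `|f x| <= M) ->
  forall x, `|iter (m + j.+1) D f x - ell j f| <= 2^-1 ^+ j.+1 * M.
Proof.
move=> M0 bf fM; elim: m => [|m ih] x; first exact: Dj_near.
rewrite addSn iterS.
have := D_norm_le (bmB (bDj (m + j.+1) bf) (bm_cst X (ell j f))) ih x.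
by rewrite DB//; exact: bDj.
Qed.

Let ell_near j m f M : 0 <= M -> bm f -> (forall x, `|f x| <= M) ->
  `|ell (m + j.+1) f - ell j f| <= 2^-1 ^+ j.+1 * M.
Proof.
move=> M0 bf fM; have bfj := bDj (m + j.+1) bf.
rewrite /ell -[X in _ - X](Rint_cst pi1) -RintegralB//; [|exact: ipi|exact/ipi/bm_cst].
apply: Rint_norm_le => //; last exact: Dj_near_add.
by apply: measurable_funB => //; case: bfj.
Qed.

Let half_small e M : 0 < e -> exists j, 2^-1 ^+ j.+1 * M < e.
Proof.
move=> e0; have M0 : 0 < `|M| + 1 by rewrite ltr_wpDl.
have := @cvg_geometric R 1 2^-1.
rewrite ger0_norm ?invr_ge0// invf_lt1// ltr1n => /(_ isT).
move=> /cvgrPdist_lt /(_ (e / (`|M| + 1)))[|n _ hn]; first by rewrite divr_gt0.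
exists n; have := hn n.+1 (leqnSn n); rewrite /= mul1r sub0r normrN ger0_norm ?exprn_ge0 ?invr_ge0//.
rewrite ltr_pdivlMr//; apply: le_lt_trans; rewrite ler_wpM2l ?exprn_ge0 ?invr_ge0//.
by rewrite (le_trans (ler_norm M))// lerDl.
Qed.

Let L f : R := limn (fun j => ell j f).

Let L_cvg f : bm f -> (fun j => ell j f) @ \oo --> L f.
Proof.
move=> bf; have [_ [M0 fM0]] := bf.
have fM x : `|f x| <= `|M0| by rewrite (le_trans (fM0 x))// ler_norm.
suff : cvgn (fun j => ell j f) by [].
apply: cauchy_cvg; apply: cauchy_exP => e e0.
have [j hj] := half_small `|M0| e0.
exists (ell j f); exists j.+1 => // n /= hn.
rewrite -ball_normE /= distrC (le_lt_trans _ hj)//.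
by rewrite -(subnK hn); exact: ell_near.
Qed.

Let L_near j f M : 0 <= M -> bm f -> (forall x, `|f x| <= M) ->
  `|L f - ell j f| <= 2^-1 ^+ j.+1 * M.
Proof.
move=> M0 bf fM.
have h : (fun m => `|ell (m + j.+1) f - ell j f|) @ \oo --> `|L f - ell j f|.
  apply: cvg_norm; apply: cvgB; last exact: cvg_cst.
  by rewrite (cvg_shiftn j.+1 (fun m => ell m f)); exact: L_cvg.
rewrite -(cvg_lim _ h)//; apply: limr_le; first by apply/cvg_ex; eexists; exact: h.
by apply: nearW => m; exact: ell_near.
Qed.

Let DjD j f g : bm f -> bm g ->
  iter j D (fun x => f x + g x) = (fun x => iter j D f x + iter j D g x).
Proof.
move=> bf bg; elim: j => // j ih.
by rewrite iterS ih {1}/D (tilt_iterD P jw w_near1)//; exact: bDj.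
Qed.

Let DjZ j c f : bm f -> iter j D (fun x => c * f x) = (fun x => c * iter j D f x).
Proof.
move=> bf; elim: j => // j ih.
by rewrite iterS ih {1}/D (tilt_iterZ P jw w_near1)//; exact: bDj.
Qed.

Let LD f g : bm f -> bm g -> L (fun x => f x + g x) = L f + L g.
Proof.
move=> bf bg; apply: cvg_lim => //.
have -> : (fun j => ell j (fun x => f x + g x)) = (fun j => ell j f + ell j g).
  apply/funext => j; rewrite /ell -RintegralD//; [|exact/ipi/bDj|exact/ipi/bDj].
  by rewrite DjD.
by apply: cvgD; exact: L_cvg.
Qed.

Let LZ c f : bm f -> L (fun x => c * f x) = c * L f.
Proof.
move=> bf; apply: cvg_lim => //.
have -> : (fun j => ell j (fun x => c * f x)) = (fun j => c * ell j f).
  apply/funext => j; rewrite /ell -RintegralZl//; last exact/ipi/bDj.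
  by rewrite DjZ.
by apply: cvgMr; exact: L_cvg.
Qed.

Let L_ge0 f : bm f -> (forall x, 0 <= f x) -> 0 <= L f.
Proof.
move=> bf f0; apply: limr_ge; first by apply/cvg_ex; eexists; exact: L_cvg.
apply: nearW => j; apply: Rintegral_ge0 => x _; elim: j x => //= j ih x.
by apply: (tilt_iter_ge0 jw w_ge0 w_near1 w_mean1) => //; exact: bDj.
Qed.

Let L_cst c : L (fun=> c) = c.
Proof.
apply: cvg_lim => //; rewrite (_ : (fun j => _) = (fun=> c)); first exact: cvg_cst.
apply/funext => j; rewrite /ell (_ : iter j D _ = fun=> c) ?Rint_cst//.
by elim: j => //= j ->; rewrite /D (tilt_iter_cst jw w_near1 w_mean1).
Qed.

Let L_norm_le f M : bm f -> (forall x, `|f x| <= M) -> `|L f| <= M.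
Proof.
move=> bf fM.
have h : (fun j => `|ell j f|) @ \oo --> `|L f| by apply: cvg_norm; exact: L_cvg.
rewrite -(cvg_lim _ h)//; apply: limr_le; first by apply/cvg_ex; eexists; exact: h.
apply: nearW => j; have [mj _] := bDj j bf; apply: Rint_norm_le => //.
by elim: j {mj} => //= j ih; apply: D_norm_le => //; exact: bDj.
Qed.

(** [Q] commutes with [D], so [D^(j+1) (Q f) = Q (D^(j+1) f)] lies in the same ball around [ell j f]
    as [D^(j+1) f]. Both limits are thus within [2^-(j+1) M] of [ell j f], for every [j]. *)
Let LQ f : bm f -> L (Q f) = L f.
Proof.
move=> bf; have [_ [M0 fM0]] := bf.
have fM x : `|f x| <= `|M0| by rewrite (le_trans (fM0 x))// ler_norm.
apply/eqP; rewrite -subr_eq0 -normr_le0; apply/ler_addgt0Pr => e e0; rewrite add0r.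
have e2 : 0 < e / 2 by rewrite divr_gt0.
have [j hj] := half_small `|M0| e2.
have l1 := L_near j (normr_ge0 M0) bf fM.
have QD : iter j.+1 D (Q f) = Q (iter j.+1 D f).
  by rewrite /D -!iterM -iterS -iterSr.
have l2 : `|L (Q f) - ell j f| <= e / 2.
  have hh m x : `|iter (m + j.+1) D (Q f) x - ell j f| <= 2^-1 ^+ j.+1 * `|M0|.
    elim: m x => [|m ih] x.
      rewrite add0n QD.
      have := tilt_norm_le jw w_ge0 w_near1 w_mean1
         (bmB (bDj j.+1 bf) (bm_cst X (ell j f))) (Dj_near j (normr_ge0 M0) bf fM) x.
      rewrite (tiltD P jw w_near1 (bDj j.+1 bf) (bm_cst X (- ell j f))).
      by rewrite (tilt_cst jw w_near1 w_mean1).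
    rewrite addSn iterS.
    have := D_norm_le (bmB (bDj (m + j.+1) (bQ bf)) (bm_cst X (ell j f))) ih x.
    by rewrite DB//; exact/bDj/bQ.
  have h : (fun m => `|ell (m + j.+1) (Q f) - ell j f|) @ \oo --> `|L (Q f) - ell j f|.
    apply: cvg_norm; apply: cvgB; last exact: cvg_cst.
    by rewrite (cvg_shiftn j.+1 (fun m => ell m (Q f))); exact/L_cvg/bQ.
  rewrite -(cvg_lim _ h)//; apply: limr_le; first by apply/cvg_ex; eexists; exact: h.
  apply: nearW => m; apply: le_trans (ltW hj); have bm' := bDj (m + j.+1) (bQ bf).
  rewrite /ell -[X in _ - X](Rint_cst pi1) -RintegralB//; [|exact: ipi|exact/ipi/bm_cst].
  apply: Rint_norm_le => //.
  by apply: measurable_funB => //; case: bm'.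
rewrite -(subrK (ell j f) (L (Q f))) -addrA (le_trans (ler_normD _ _))//.
rewrite (splitr e) lerD// distrC (le_trans l1)// ltW//.
Qed.

(** Continuity of [L] along bounded pointwise limits, from which sigma-additivity follows. The
    distance from [L] to [ell j] is uniform over functions bounded by 1, and [ell j] is a finite
    composition of integrals to which dominated convergence applies. *)
Let L_dct (f_ : nat -> X -> R) f : (forall n, measurable_fun setT (f_ n)) ->
  (forall n x, `|f_ n x| <= 1) -> (forall x, f_ ^~ x @ \oo --> f x) ->
  (fun n => L (f_ n)) @ \oo --> L f.
Proof.
move=> mf_ f1 cf; have bf_ n : bm (f_ n) by split => //; exists 1.
have mf : measurable_fun setT f by apply: (measurable_fun_cvg mf_) => y _; exact: cf.
have fle1 x : `|f x| <= 1.
  have h : (fun n => `|f_ n x|) @ \oo --> `|f x| by apply: cvg_norm; exact: cf.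
  rewrite -(cvg_lim _ h)//; apply: limr_le; first by apply/cvg_ex; eexists; exact: h.
  by apply: nearW.
have bf : bm f by split => //; exists 1.
apply/cvgrPdist_le => e e0; have e3 : 0 < e / 3 by rewrite divr_gt0.
have [j hj] := half_small 1 e3.
have cj x : (fun n => iter j D (f_ n) x) @ \oo --> iter j D f x.
  have -> g : iter j D g = iter (j * N) Q g by rewrite /D iterM.
  under eq_fun do rewrite -iterM; exact: (tilt_iter_dct jw w_ge0 w_near1 w_mean1 (M := 1)).
have ce : (fun n => ell j (f_ n)) @ \oo --> ell j f.
  apply: (@Rint_dct _ _ _ pi (fun n => iter j D (f_ n)) _ (fun=> 1)) => //.
  - by move=> n; case: (bDj j (bf_ n)).
  - by case: (bDj j bf).
  - exact/ipi/bm_cst.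
  - by move=> n; elim: (j) => //= i ih; apply: D_norm_le => //; exact: bDj.
move/cvgrPdist_le : ce => /(_ _ e3) [n0 _ hn0]; exists n0 => // n /hn0 /= h.
have h1 := L_near j ler01 bf fle1; have h2 := L_near j ler01 (bf_ n) (f1 n).
have -> : L f - L (f_ n) = (L f - ell j f) + (ell j f - ell j (f_ n)) + (ell j (f_ n) - L (f_ n)) by ring.
rewrite (le_trans (ler_normD _ _))// (_ : e = e / 3 + e / 3 + e / 3); last by field.
rewrite lerD//; last by rewrite distrC (le_trans h2)// ltW.
by rewrite (le_trans (ler_normD _ _))// lerD// (le_trans h1)// ltW.
Qed.

(** The positivity of [L] is known for measurable functions only, whereas a measure must be
    nonnegative on every set; hence the value 0 off the sigma-algebra. *)
Let mu (A : set X) : \bar R := if `[< measurable A >] then (L (\1_A))%:E else 0%E.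
Let muE (A : set X) : measurable A -> mu A = (L (\1_A))%:E.
Proof. by move=> mA; rewrite /mu asboolT. Qed.

Let mu0 : mu set0 = 0%E.
Proof. by rewrite muE// indic0 L_cst. Qed.

Let mu_ge0 A : (0 <= mu A)%E.
Proof.
rewrite /mu; case: asboolP => // mA; rewrite lee_fin; apply: L_ge0; first exact: bm_indic.
by move=> x; rewrite indicE.
Qed.

Let mu_sigma : semi_sigma_additive mu.
Proof.
move=> F mF tF mUF; rewrite muE//.
pose f_ n x : R := \sum_(i < n) \1_(F i) x.
have bf_ n : bm (f_ n) by apply: (@bm_sum _ _ _ 'I_n (fun i => \1_(F i))) => i; exact: bm_indic.
(* The pointwise convergence of the sums of indicators is the sigma-additivity of the Dirac mass at
   [x]. *)
have cf x : (fun n => f_ n x) @ \oo --> (\1_(\bigcup_n F n) x : R).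
  have := @measure_semi_sigma_additive _ _ _ (@dirac _ X x R) F mF tF mUF.
  move=> /(@fine_cvg _ _ _ _ _ (\1_(\bigcup_n F n) x : R)); apply: cvg_trans.
  apply: near_eq_cvg; apply: nearW => n.
  by rewrite /= /f_ big_mkord -[RHS]/(fine (\sum_(i < n) \1_(F i) x)%:E) -sumEFin.
have f1 n x : `|f_ n x| <= 1.
  rewrite ger0_norm; last by apply: sumr_ge0 => i _; rewrite indicE.
  have nd : {homo (fun m => f_ m x) : m k / (m <= k)%N >-> m <= k}.
    apply/nondecreasing_seqP => m; rewrite /f_ big_ord_recr/= lerDl.
    by rewrite indicE.
  have cv : cvgn (fun m => f_ m x) by apply/cvg_ex; eexists; exact: cf.
  rewrite (le_trans (nondecreasing_cvgn_le nd cv n))// (cvg_lim _ (cf x))//.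
have := L_dct (fun n => proj1 (bf_ n)) f1 cf.
move=> h; rewrite (_ : (fun n => _) = EFin \o (fun n => L (f_ n))).
  by apply: cvg_EFin; [exact: nearW|exact: h].
apply/funext => n /=; rewrite big_mkord.
rewrite (eq_bigr (fun i : 'I_n => (L (\1_(F i)))%:E)); last by move=> i _; rewrite muE.
rewrite sumEFin; congr EFin; elim: n => [|n ih].
  by rewrite big_ord0 /f_; under eq_fun do rewrite big_ord0; rewrite L_cst.
rewrite big_ord_recr /= ih -LD//; last exact: bm_indic.
by congr L; apply/funext => x; rewrite /f_ big_ord_recr.
Qed.

HB.instance Definition _ := isMeasure.Build _ _ _ mu mu0 mu_ge0 mu_sigma.

Let mu_setT : mu setT = 1%E.
Proof. by rewrite muE// indicT L_cst. Qed.

HB.instance Definition _ := Measure_isProbability.Build _ _ _ mu mu_setT.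

Lemma tilted_stationary : exists nu : probability X R, stationary P w nu.
Proof.
exists mu => A mA; apply: (etrans (muE mA)).
have bA : bm (\1_A : X -> R) by exact: bm_indic.
rewrite -(LQ bA).
(* Integration against [mu] and [L] agree on indicators by construction, hence on bounded functions;
   stationarity is then the invariance [LQ]. *)
have e f : bm f -> \int[mu]_x f x = L f.
  move=> bf; have [mf [M0 fM0]] := bf.
  have fM x : `|f x| <= `|M0| by rewrite (le_trans (fM0 x))// ler_norm.
  have iimu g : bm g -> (mu : {measure set X -> \bar R}).-integrable setT (EFin \o g) by exact: bm_integrable.
  apply/eqP; rewrite -subr_eq0 -normr_le0 -[leRHS](mulr0 (2 * `|M0|)).
  have PA B : measurable B -> \int[mu]_x \1_B x - L (\1_B) = 0.
    move=> mB; rewrite /Rintegral integral_indic// setIT.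
    by apply/eqP; rewrite subr_eq0; apply/eqP; exact: (congr1 fine (muE mB)).
  apply: (@functional_bound0 _ _ _ (fun f => \int[mu]_x f x - L f) 2 0) => //.
  - move=> g h bg bh; rewrite LD// RintegralD//; [ring|exact: iimu|exact: iimu].
  - by move=> c g bg; rewrite LZ// RintegralZl ?mulrBr//; exact: iimu.
  - move=> g K bg gK; rewrite (le_trans (ler_normB _ _))// mulr_natl mulr2n lerD//.
      by apply: Rint_norm_le => //; case: bg.
    exact: L_norm_le.
  - by move=> B mB; rewrite PA// normr0.
  - rewrite L_cst Rint_cst ?subrr//.
rewrite -(e _ (bQ bA)) EFin_Rint; last exact/(bm_integrable _ (bQ bA)).
apply: eq_integral => x _; rewrite EFin_kint//.
exact/jbm_kintegrable/(tilt_jbmM jw w_near1).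
Qed.

End stationary_existence.

(** * Expectations over samples and likelihood ratios *)

Section samples.
Context (R : realType) dX (X : measurableType dX) (P : R.-pker X ~> X).

Local Notation space n := (projT2 (pT X n)).

(** Measurability is read on the product space through [tolist], so only the samples of length
    [n + 1] count. *)
Definition smeas n (F : seq X -> R) :=
  measurable_fun setT (fun p : space n => F (tolist p)).

(** The parameter space is what lets the induction run: after one step the initial state is a
    parameter of the remaining functional, and [Z] becomes [Z * X]. *)
Lemma measurable_pexp (w : X -> X -> R) (jw : jmeas w) n dZ (Z : measurableType dZ)
    (F : Z -> seq X -> \bar R) :
  measurable_fun setT (fun q : Z * space n => F q.1 (tolist q.2)) ->
  measurable_fun setT (fun q : Z * X => pexp P w n (F q.1) q.2).
Proof.
elim: n dZ Z F => [//|n ih] dZ Z F mF.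
pose F' (zx : Z * X) s := F zx.1 (zx.2 :: s).
have mF' : measurable_fun setT (fun q : (Z * X) * space n => F' q.1 (tolist q.2)).
  have h : measurable_fun setT (fun q : (Z * X) * space n => (q.1.1, (q.1.2, q.2))).
    apply: measurable_fun_pair; first exact: (measurableT_comp measurable_fst measurable_fst).
    apply: measurable_fun_pair; last exact: measurable_snd.
    exact: (measurableT_comp measurable_snd measurable_fst).
  exact: (measurableT_comp mF h).
have := ih _ _ F' mF'; move=> {}ih.
apply: (measurable_int_pker P (@measurable_snd _ _ Z X)
  (k := fun q => ((w q.1.2 q.2)%:E * pexp P w n (F' q.1) q.2)%E)).
apply: emeasurable_funM => //; apply/measurable_EFinP.
have h : measurable_fun setT (fun q : (Z * X) * X => (q.1.2, q.2)).
  apply: measurable_fun_pair; last exact: measurable_snd.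
  exact: (measurableT_comp measurable_snd measurable_fst).
exact: (measurableT_comp jw h).
Qed.

Lemma measurable_pexp1 (w : X -> X -> R) (jw : jmeas w) n F : smeas n F ->
  measurable_fun setT (fun x => pexp P w n (EFin \o F) x).
Proof.
move=> mF.
have h : measurable_fun setT (fun q : X * space n => (F (tolist q.2))%:E).
  by apply/measurable_EFinP; exact: (measurableT_comp mF measurable_snd).
have m := measurable_pexp jw (F := fun=> EFin \o F) h.
have h2 : measurable_fun setT (fun x : X => (x, x)).
  by apply: measurable_fun_pair; exact: measurable_id.
exact: (measurableT_comp m h2).
Qed.

Lemma smeas_cons n F x : smeas n.+1 F -> smeas n (fun s => F (x :: s)).
Proof. by move=> mF; exact: (measurableT_comp mF (pair1_measurable x)). Qed.

Lemma measurable_pexp_cons (w : X -> X -> R) (jw : jmeas w) n F x : smeas n.+1 F ->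
  measurable_fun setT (fun y => pexp P w n (fun s => (F (x :: s))%:E) y).
Proof. by move=> /(smeas_cons x); exact: (measurable_pexp1 jw). Qed.

Lemma smeasD n F G : smeas n F -> smeas n G -> smeas n (fun s => F s + G s).
Proof. exact: measurable_funD. Qed.
Lemma smeasB n F G : smeas n F -> smeas n G -> smeas n (fun s => F s - G s).
Proof. exact: measurable_funB. Qed.
Lemma smeasM n F G : smeas n F -> smeas n G -> smeas n (fun s => F s * G s).
Proof. exact: measurable_funM. Qed.
Lemma smeas_cst n (c : R) : smeas n (fun=> c).
Proof. exact: measurable_cst. Qed.
Lemma smeas_norm n F : smeas n F -> smeas n (fun s => `|F s|).
Proof. by move=> mF; exact: measurableT_comp. Qed.
Lemma smeas_sum n (I : finType) (F : I -> seq X -> R) :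
  (forall i, smeas n (F i)) -> smeas n (fun s => \sum_i F i s).
Proof. by move=> mF; apply: measurable_sum. Qed.

Lemma pexp_ext (w : X -> X -> R) n F G y : (forall s, F (y :: s) = G (y :: s)) ->
  pexp P w n F y = pexp P w n G y.
Proof.
case: n => [|n] FG /=; first exact: FG.
by congr wint; apply/funext => z; congr pexp; apply/funext => s; exact: FG.
Qed.

Lemma pexp_ge0 (w : X -> X -> R) n F : (forall x y, 0 <= w x y) -> (forall s, 0 <= F s)%E ->
  forall x, (0 <= pexp P w n F x)%E.
Proof.
move=> w0; elim: n F => [|n ih] F F0 x /=; first exact: F0.
by apply: integral_ge0 => y _; rewrite mule_ge0 ?lee_fin// ih.
Qed.

Lemma pexp1S n F x :
  pexp P (@w1 R dX X) n.+1 F x = (\int[P x]_y pexp P (@w1 _ _ _) n (fun s => F (x :: s)) y)%E.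
Proof. by rewrite /= /wint; under eq_integral do rewrite mul1e. Qed.

Let jw1 : jmeas (@w1 R dX X). Proof. exact: measurable_cst. Qed.

Local Notation px n F x := (pexp P (@w1 R dX X) n F x).

Lemma pexp_le n (F G : seq X -> R) : smeas n F -> smeas n G -> (forall s, 0 <= F s) -> 
  (forall p : space n, F (tolist p) <= G (tolist p)) ->
  forall x, (px n (EFin \o F) x <= px n (EFin \o G) x)%E.
Proof.
elim: n F G => [|n ih] F G mF mG F0 FG x; first by rewrite /= lee_fin; exact: (FG x).
rewrite !pexp1S; apply: ge0_le_integral => //.
- by move=> y _; apply: pexp_ge0 => // s; rewrite lee_fin.
- exact: measurable_pexp_cons.
- exact: measurable_pexp_cons.
- move=> y _; apply: (ih _ _ (smeas_cons x mF) (smeas_cons x mG)) => // p.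
  exact: (FG (x, p)).
Qed.

Lemma pexpD_ge0 n (F G : seq X -> R) : smeas n F -> smeas n G -> (forall s, 0 <= F s) ->
  (forall s, 0 <= G s) ->
  forall x, px n (fun s => (F s + G s)%:E) x = (px n (EFin \o F) x + px n (EFin \o G) x)%E.
Proof.
elim: n F G => [//|n ih] F G mF mG F0 G0 x.
rewrite !pexp1S -ge0_integralD//.
- by apply: eq_integral => y _; rewrite ih//; exact: smeas_cons.
- by move=> y _; apply: pexp_ge0 => // s; rewrite lee_fin.
- exact: measurable_pexp_cons.
- by move=> y _; apply: pexp_ge0 => // s; rewrite lee_fin.
- exact: measurable_pexp_cons.
Qed.

Lemma pexpZ_ge0 n (c : R) (F : seq X -> R) : 0 <= c -> smeas n F -> (forall s, 0 <= F s) ->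
  forall x, px n (fun s => (c * F s)%:E) x = (c%:E * px n (EFin \o F) x)%E.
Proof.
move=> c0; elim: n F => [//|n ih] F mF F0 x.
rewrite !pexp1S -ge0_integralZl_EFin//.
- by apply: eq_integral => y _; rewrite ih//; exact: smeas_cons.
- by move=> y _; apply: pexp_ge0 => // s; rewrite lee_fin.
- exact: measurable_pexp_cons.
Qed.

(** Inner expectations may be infinite at exceptional starting points, where no subtraction formula
    is available. The formula is therefore required only where both terms are finite, which is
    almost everywhere as their integrals are finite. *)
Lemma integral_sub_finite (mu : {measure set X -> \bar R}) (f a b : X -> \bar R) :
  measurable_fun setT f -> measurable_fun setT a -> measurable_fun setT b ->
  (forall x, 0 <= a x)%E -> (forall x, 0 <= b x)%E ->
  (\int[mu]_x a x < +oo)%E -> (\int[mu]_x b x < +oo)%E ->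
  (forall x, a x < +oo -> b x < +oo -> f x = a x - b x)%E ->
  (\int[mu]_x f x = \int[mu]_x a x - \int[mu]_x b x)%E.
Proof.
move=> mf ma mb a0 b0 fa fb fE.
have ia : mu.-integrable setT a.
  by apply/integrableP; split => //; under eq_integral do rewrite gee0_abs//.
have ib : mu.-integrable setT b.
  by apply/integrableP; split => //; under eq_integral do rewrite gee0_abs//.
rewrite -integralB//; apply: ae_eq_integral => //.
  exact: emeasurable_funB.
have := integrable_ae measurableT ia; have := integrable_ae measurableT ib.
apply: filterS2 => x hb ha _.
by apply: (fE x); [move: (ha I)|move: (hb I)]; rewrite ge0_fin_numE.
Qed.

Lemma pexp_sub n (A B : seq X -> R) : smeas n A -> smeas n B -> (forall s, 0 <= A s) ->
  (forall s, 0 <= B s) -> forall x, (px n (EFin \o A) x < +oo)%E ->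
  (px n (EFin \o B) x < +oo)%E ->
  px n (fun s => (A s - B s)%:E) x = (px n (EFin \o A) x - px n (EFin \o B) x)%E.
Proof.
elim: n A B => [//|n ih] A B mA mB A0 B0 x.
rewrite !pexp1S => fA fB; apply: integral_sub_finite => //.
- exact: (measurable_pexp_cons jw1 x (smeasB mA mB)).
- exact: measurable_pexp_cons.
- exact: measurable_pexp_cons.
- by move=> y; apply: pexp_ge0 => // s; rewrite lee_fin.
- by move=> y; apply: pexp_ge0 => // s; rewrite lee_fin.
- by move=> y ha hb; apply: ih => //; exact: smeas_cons.
Qed.

Definition sbound n (F : seq X -> R) (M : R) := forall p : space n, `|F (tolist p)| <= M.

Lemma sbound_cons n F M x : sbound n.+1 F M -> sbound n (fun s => F (x :: s)) M.
Proof. by move=> bF p; exact: (bF (x, p)). Qed.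

Lemma pexp_cst n (c : R) x : px n (fun=> c%:E) x = c%:E.
Proof.
elim: n x => [//|n ih] x; rewrite pexp1S; under eq_integral do rewrite ih.
by rewrite integral_cst// (prob_kernel (s := P)) mule1.
Qed.

Lemma pexp_norm_le n F M : smeas n F -> sbound n F M ->
  forall x, (px n (fun s => `|F s|%:E) x <= M%:E)%E.
Proof.
move=> mF bF x; rewrite -(pexp_cst n M x).
by have := pexp_le (smeas_norm mF) (smeas_cst M) (fun s => normr_ge0 (F s)) bF x.
Qed.

Lemma pexp_abs_le n F M : smeas n F -> sbound n F M ->
  forall x, (`|px n (EFin \o F) x| <= M%:E)%E.
Proof.
elim: n F => [|n ih] F mF bF x; first by rewrite /= lee_fin; exact: (bF x).
rewrite pexp1S; apply: (le_trans (le_abse_integral _ _ _)) => //.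
  exact: measurable_pexp_cons.
rewrite [leRHS](_ : _ = \int[P x]_y M%:E)%E.
  apply: ge0_le_integral => //.
  - by apply: measurableT_comp => //; exact: measurable_pexp_cons.
  - by move=> y _; apply: (ih _ (smeas_cons x mF)); exact: sbound_cons.
by rewrite integral_cst// (prob_kernel (s := P)) mule1.
Qed.

Lemma pexpZ n (c M : R) F : smeas n F -> sbound n F M ->
  forall x, px n (fun s => (c * F s)%:E) x = (c%:E * px n (EFin \o F) x)%E.
Proof.
elim: n F => [//|n ih] F mF bF x.
rewrite !pexp1S -integralZl//.
  apply: eq_integral => y _; rewrite ih//; [exact: smeas_cons|exact: sbound_cons].
have mp := measurable_pexp_cons jw1 x mF.
have iM := bm_integrable (prob_kernel (s := P) x) (bm_cst X M).
apply: (le_integrable measurableT mp _ iM) => y _ /=.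
apply: (le_trans (pexp_abs_le (smeas_cons x mF) (sbound_cons x bF) y)).
by rewrite lee_fin ler_norm.
Qed.

(** The likelihood ratio of the sample between the weighted and the original chain. Neither the
    first state, whose law [nu] is common, nor the end of the sample contributes a factor. *)
Fixpoint lik (w : X -> X -> R) (s : seq X) : R :=
  if s is x :: s' then (if s' is y :: _ then w x y else 1) * lik w s' else 1.

Lemma smeas_lik w n : jmeas w -> smeas n (lik w).
Proof.
move=> jw; elim: n => [|n ih].
  by rewrite /smeas /=; exact: measurable_cst.
(* The default [point] is never reached: [tolist] does not return the empty sequence. *)
rewrite /smeas; rewrite (_ : (fun _ => _) =
   (fun p : X * space n => w p.1 (head point (tolist p.2)) * lik w (tolist p.2))); last first.
  by apply/funext => -[x p] /=; case: n p {ih} => [|n] p /=.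
apply: measurable_funM; last exact: (measurableT_comp ih measurable_snd).
have h : measurable_fun setT (fun p : space n => head point (tolist p)).
  by case: n {ih} => [|n]; [exact: measurable_id|exact: measurable_fst].
have h2 : measurable_fun setT (fun p : X * space n => (p.1, head point (tolist p.2))).
  apply: measurable_fun_pair; first exact: measurable_fst.
  exact: (measurableT_comp h measurable_snd).
exact: (measurableT_comp jw h2).
Qed.

Lemma sbound_lik w n W : (forall x y, `|w x y| <= W) -> sbound n (lik w) (W ^+ n).
Proof.
move=> wW; elim: n => [|n ih] p.
  by rewrite /= mul1r normr1 expr0.
case: p => x p /=; rewrite normrM exprS ler_pM//.
by case: n p {ih} => [|n] p /=.
Qed.

Lemma pexp_lik w n (F : seq X -> R) (M : R) : jbm w -> smeas n F -> sbound n F M ->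
  forall x, pexp P w n (EFin \o F) x = px n (fun s => (lik w s * F s)%:E) x.
Proof.
move=> bw; have [jw [W wW]] := bw.
elim: n F => [|n ih] F mF bF x; first by rewrite /= !mul1r.
rewrite pexp1S /= /wint; apply: eq_integral => y _.
rewrite (ih (fun s => F (x :: s)) (smeas_cons x mF) (sbound_cons x bF)).
have bl := sbound_lik (n := n) (fun x y => wW (x, y)).
have mG : smeas n (fun s => lik w s * F (x :: s)).
  by apply: smeasM; [exact: smeas_lik|exact: smeas_cons].
have bG : sbound n (fun s => lik w s * F (x :: s)) (W ^+ n * M).
  by move=> p; rewrite normrM ler_pM//; exact: (sbound_cons x bF p).
by rewrite -(pexpZ _ mG bG); apply: pexp_ext => s /=; rewrite mulrA.
Qed.

End samples.

(** * Linearity of sample expectations and the second moment of the likelihood ratio *)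

Section chain_expectation.
Context (R : realType) dX (X : measurableType dX) (nu : probability X R) (P : R.-pker X ~> X).
Implicit Types (F G : seq X -> R).

Local Notation space n := (projT2 (pT X n)).
Local Notation cee n F := (chainE nu P (@w1 R dX X) n F).

Let jw1 : jmeas (@w1 R dX X). Proof. exact: measurable_cst. Qed.

Definition cE n F : R := fine (cee n (EFin \o F)).
(** The expectation is an iterated integral, not the integral of one measure on the samples, so its
    linearity has to be built: for nonnegative functionals first, then through positive and negative
    parts. *)
Definition cint n F := smeas n F /\ (cee n (fun s => `|F s|%:E) < +oo)%E.

Let cee_ge0 n F : (forall s, 0 <= F s) -> (0 <= cee n (EFin \o F))%E.
Proof.
by move=> F0; apply: integral_ge0 => x _; apply: pexp_ge0 => // s; rewrite lee_fin.
Qed.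

Let cee_le n F G : smeas n F -> smeas n G -> (forall s, 0 <= F s) ->
  (forall p : space n, F (tolist p) <= G (tolist p)) ->
  (cee n (EFin \o F) <= cee n (EFin \o G))%E.
Proof.
move=> mF mG F0 FG; apply: ge0_le_integral => //.
- by move=> x _; apply: pexp_ge0 => // s; rewrite lee_fin.
- exact: measurable_pexp1.
- exact: measurable_pexp1.
- by move=> x _; exact: pexp_le.
Qed.

Let ceeD n F G : smeas n F -> smeas n G -> (forall s, 0 <= F s) -> (forall s, 0 <= G s) ->
  (cee n (fun s => (F s + G s)%:E) = cee n (EFin \o F) + cee n (EFin \o G))%E.
Proof.
move=> mF mG F0 G0; rewrite /chainE -ge0_integralD//.
- by apply: eq_integral => x _; exact: pexpD_ge0.
- by move=> x _; apply: pexp_ge0 => // s; rewrite lee_fin.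
- exact: measurable_pexp1.
- by move=> x _; apply: pexp_ge0 => // s; rewrite lee_fin.
- exact: measurable_pexp1.
Qed.

Let ceeZ n c F : 0 <= c -> smeas n F -> (forall s, 0 <= F s) ->
  (cee n (fun s => (c * F s)%:E) = c%:E * cee n (EFin \o F))%E.
Proof.
move=> c0 mF F0; rewrite /chainE -ge0_integralZl_EFin//.
- by apply: eq_integral => x _; exact: pexpZ_ge0.
- by move=> x _; apply: pexp_ge0 => // s; rewrite lee_fin.
- exact: measurable_pexp1.
Qed.

Let ceeB n F G : smeas n F -> smeas n G -> (forall s, 0 <= F s) -> (forall s, 0 <= G s) ->
  (cee n (EFin \o F) < +oo)%E -> (cee n (EFin \o G) < +oo)%E ->
  (cee n (fun s => (F s - G s)%:E) = cee n (EFin \o F) - cee n (EFin \o G))%E.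
Proof.
move=> mF mG F0 G0 fF fG; apply: integral_sub_finite => //.
- exact: (measurable_pexp1 P jw1 (smeasB mF mG)).
- exact: measurable_pexp1.
- exact: measurable_pexp1.
- by move=> y; apply: pexp_ge0 => // s; rewrite lee_fin.
- by move=> y; apply: pexp_ge0 => // s; rewrite lee_fin.
- by move=> y ha hb; exact: pexp_sub.
Qed.

Lemma cint_dom n F G : smeas n F -> (forall p : space n, `|F (tolist p)| <= G (tolist p)) ->
  cint n G -> cint n F.
Proof.
move=> mF FG [mG fG]; split => //; apply: le_lt_trans fG.
apply: (cee_le (smeas_norm mF) (smeas_norm mG)) => // p.
by rewrite (le_trans (FG p))// ler_norm.
Qed.

Lemma cint_ge0 n F : smeas n F -> (forall s, 0 <= F s) ->
  (cee n (EFin \o F) < +oo)%E -> cint n F.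
Proof.
move=> mF F0 fF; split => //; apply: le_lt_trans fF.
by apply: (cee_le (smeas_norm mF) mF) => // p; rewrite ger0_norm.
Qed.

Let cint_fin n F : (forall s, 0 <= F s) -> cint n F -> (cee n (EFin \o F) < +oo)%E.
Proof.
move=> F0 [mF]; apply: le_lt_trans.
by apply: (cee_le mF (smeas_norm mF)) => // p; rewrite ler_norm.
Qed.

Lemma cint_sbound n F M : smeas n F -> sbound n F M -> cint n F.
Proof.
move=> mF bF; split => //; apply: (@le_lt_trans _ _ (\int[nu]_x M%:E)%E).
  apply: ge0_le_integral => //.
  - by move=> x _; apply: pexp_ge0 => // s; rewrite lee_fin.
  - exact: (measurable_pexp1 P jw1 (smeas_norm mF)).
  - by move=> x _; exact: pexp_norm_le.
by rewrite integral_cst// [X in (_ * X)%E]probability_setT mule1 ltry.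
Qed.

Lemma cintD n F G : cint n F -> cint n G -> cint n (fun s => F s + G s).
Proof.
move=> [mF fF] [mG fG].
have mFG : smeas n (fun s => `|F s| + `|G s|) by apply: smeasD; exact: smeas_norm.
apply: (@cint_dom _ _ (fun s => `|F s| + `|G s|)); first exact: smeasD.
- by move=> p; exact: ler_normD.
- apply: cint_ge0; [exact: mFG|by move=> s; rewrite addr_ge0|].
  have -> := ceeD (smeas_norm mF) (smeas_norm mG) (fun s => normr_ge0 _) (fun s => normr_ge0 _).
  exact: lte_add_pinfty.
Qed.

Lemma cintZ n c F : cint n F -> cint n (fun s => c * F s).
Proof.
move=> [mF fF].
have mcF : smeas n (fun s => `|c| * `|F s|).
  by apply: smeasM; [exact: smeas_cst|exact: smeas_norm].
apply: (@cint_dom _ _ (fun s => `|c| * `|F s|)); first by apply: smeasM => //; exact: smeas_cst.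
- by move=> p; rewrite normrM.
- apply: cint_ge0; [exact: mcF|by move=> s; rewrite mulr_ge0|].
  have -> := ceeZ (normr_ge0 c) (smeas_norm mF) (fun s => normr_ge0 _).
  exact: lte_mul_pinfty.
Qed.

Lemma cint_sum n (I : finType) (F : I -> seq X -> R) :
  (forall i, cint n (F i)) -> cint n (fun s => \sum_i F i s).
Proof.
move=> cF; elim: (index_enum I) => [|i r ih].
  under eq_fun do rewrite big_nil; apply: (@cint_sbound _ _ 0); first exact: smeas_cst.
  by move=> p; rewrite normr0.
by under eq_fun do rewrite big_cons; exact: cintD.
Qed.

Let fin_cee n F : (forall s, 0 <= F s) -> cint n F -> cee n (EFin \o F) = (cE n F)%:E.
Proof.
by move=> F0 cF; rewrite /cE fineK// ge0_fin_numE ?cint_fin//; exact: cee_ge0.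
Qed.

Lemma cE_ge0 n F : (forall s, 0 <= F s) -> 0 <= cE n F.
Proof. by move=> F0; rewrite /cE fine_ge0//; exact: cee_ge0. Qed.

Let cEB_ge0 n F G : (forall s, 0 <= F s) -> (forall s, 0 <= G s) -> cint n F -> cint n G ->
  cE n (fun s => F s - G s) = cE n F - cE n G.
Proof.
move=> F0 G0 cF cG; rewrite {1}/cE [X in fine X](ceeB (proj1 cF) (proj1 cG))//.
- by rewrite !fin_cee.
- exact: cint_fin.
- exact: cint_fin.
Qed.

Let cED_ge0 n F G : (forall s, 0 <= F s) -> (forall s, 0 <= G s) -> cint n F -> cint n G ->
  cE n (fun s => F s + G s) = cE n F + cE n G.
Proof.
by move=> F0 G0 cF cG; rewrite {1}/cE [X in fine X](ceeD (proj1 cF) (proj1 cG))// !fin_cee.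
Qed.

Let pos F s := Num.max (F s) 0.
Let neg F s := Num.max (- F s) 0.
Let pos_ge0 F s : 0 <= pos F s. Proof. by rewrite le_max lexx orbT. Qed.
Let neg_ge0 F s : 0 <= neg F s. Proof. by rewrite le_max lexx orbT. Qed.
Let posneg F s : F s = pos F s - neg F s.
Proof. by rewrite /pos /neg; case: (leP (F s) 0) => h; case: (leP (- F s) 0) => h'; lra. Qed.
Let cint_pos n F : cint n F -> cint n (pos F).
Proof.
move=> [mF fF]; apply: (@cint_dom _ _ (fun s => `|F s|)).
- by apply: measurable_maxr => //; exact: measurable_cst.
- by move=> p; rewrite ger0_norm// /pos; case: (leP (F _) 0) => // _; exact: ler_norm.
- by apply: cint_ge0 => //; exact: smeas_norm.
Qed.
Let cint_neg n F : cint n F -> cint n (neg F).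
Proof.
move=> [mF fF]; apply: (@cint_dom _ _ (fun s => `|F s|)).
- by apply: measurable_maxr; [exact: measurable_funN|exact: measurable_cst].
- by move=> p; rewrite ger0_norm// /neg -normrN; case: (leP (- F _) 0) => // _; exact: ler_norm.
- by apply: cint_ge0 => //; exact: smeas_norm.
Qed.

Let cEpn n F : cint n F -> cE n F = cE n (pos F) - cE n (neg F).
Proof.
move=> cF; rewrite -cEB_ge0//; [|exact: cint_pos|exact: cint_neg].
by congr cE; apply/funext => s; exact: posneg.
Qed.

Lemma cED n F G : cint n F -> cint n G -> cE n (fun s => F s + G s) = cE n F + cE n G.
Proof.
move=> cF cG; have pF := cint_pos cF; have pG := cint_pos cG.
have nF := cint_neg cF; have nG := cint_neg cG.
have -> : (fun s => F s + G s) = (fun s => (pos F s + pos G s) - (neg F s + neg G s)).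
  by apply/funext => s; rewrite [F s]posneg [G s]posneg; ring.
rewrite cEB_ge0; [|by move=> s; rewrite addr_ge0|by move=> s; rewrite addr_ge0|exact: cintD|exact: cintD].
by rewrite !cED_ge0// (cEpn cF) (cEpn cG); ring.
Qed.

Lemma cEZ n c F : cint n F -> cE n (fun s => c * F s) = c * cE n F.
Proof.
move=> cF; have pF := cint_pos cF; have nF := cint_neg cF.
have cEZ_ge0 b G : 0 <= b -> (forall s, 0 <= G s) -> cint n G ->
    cE n (fun s => b * G s) = b * cE n G.
  move=> b0 G0 cG; rewrite {1}/cE [X in fine X](ceeZ b0 (proj1 cG))//.
  by rewrite fin_cee.
rewrite (cEpn cF); have [c0|c0] := leP 0 c.
  have -> : (fun s => c * F s) = (fun s => c * pos F s - c * neg F s).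
    by apply/funext => s; rewrite [F s]posneg; ring.
  rewrite cEB_ge0; [|by move=> s; rewrite mulr_ge0|by move=> s; rewrite mulr_ge0|exact: cintZ|exact: cintZ].
  by rewrite !cEZ_ge0//; ring.
have c0' : 0 <= - c by rewrite oppr_ge0 ltW.
have -> : (fun s => c * F s) = (fun s => - c * neg F s - - c * pos F s).
  by apply/funext => s; rewrite [F s]posneg; ring.
rewrite cEB_ge0; [|by move=> s; rewrite mulr_ge0|by move=> s; rewrite mulr_ge0|exact: cintZ|exact: cintZ].
by rewrite !cEZ_ge0//; ring.
Qed.

Lemma cE_sum n (I : finType) (F : I -> seq X -> R) :
  (forall i, cint n (F i)) -> cE n (fun s => \sum_i F i s) = \sum_i cE n (F i).
Proof.
move=> cF; have c0 : cint n (fun=> 0).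
  by apply: (@cint_sbound _ _ 0); [exact: smeas_cst|move=> p; rewrite normr0].
have e (r : seq I) : cint n (fun s => \sum_(i <- r) F i s) /\
    cE n (fun s => \sum_(i <- r) F i s) = \sum_(i <- r) cE n (F i).
  elim: r => [|i r [ih1 ih2]].
    under eq_fun do rewrite big_nil; rewrite big_nil; split => //.
    under eq_fun do rewrite -(mul0r 0); rewrite cEZ// mul0r//.
  under eq_fun do rewrite big_cons; rewrite big_cons; split; first exact: cintD.
  by rewrite cED// ih2.
by have [] := e (index_enum I).
Qed.

Lemma cE_le n F G : cint n F -> cint n G -> (forall s, F s <= G s) -> cE n F <= cE n G.
Proof.
move=> cF cG FG; rewrite -subr_ge0 -mulN1r addrC -cEZ// -cED//; last exact: cintZ.
by apply: cE_ge0 => s; rewrite mulN1r addrC subr_ge0.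
Qed.

Lemma cE_cst n (c : R) : cE n (fun=> c) = c.
Proof.
rewrite /cE /chainE; under eq_integral do rewrite [pexp _ _ _ _ _]pexp_cst.
by rewrite integral_cst// [X in (_ * X)%E]probability_setT mule1.
Qed.

Lemma chainE_lik (w : X -> X -> R) n F M : jbm w -> smeas n F -> sbound n F M ->
  fine (chainE nu P w n (EFin \o F)) = cE n (fun s => lik w s * F s).
Proof.
move=> bw mF bF; congr fine; apply: eq_integral => x _.
exact: (pexp_lik P bw mF bF).
Qed.

Lemma cint_lik (w : X -> X -> R) n : jbm w -> cint n (lik w).
Proof.
move=> [jw [W wW]]; apply: (@cint_sbound _ _ (W ^+ n)); first exact: smeas_lik.
by apply: sbound_lik => x y; exact: (wW (x, y)).
Qed.

Lemma cE_lik1 (w : X -> X -> R) n : jbm w -> (forall x, kint P w x = 1) ->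
  cE n (lik w) = 1.
Proof.
move=> bw wm.
have h : @sbound R dX X n (fun=> 1) 1 by move=> p; rewrite normr1.
have := chainE_lik (n := n) bw (smeas_cst 1) h.
under [X in _ = cE _ X]eq_fun do rewrite mulr1.
move=> <-; have e m x : pexp P w m (fun=> 1%:E) x = 1%:E.
  elim: m x => //= m ih x; rewrite /wint; under eq_integral do rewrite ih mule1.
  by rewrite -(wm x) EFin_kint//; exact: jbm_kintegrable.
rewrite /chainE; under eq_integral do rewrite [pexp _ _ _ _ _]e.
by rewrite integral_cst// [X in (_ * X)%E]probability_setT mule1.
Qed.

(** The second moment of a likelihood ratio is thereby the total mass of the chain with weights
    [w^2]. *)
Lemma lik_sqr (w : X -> X -> R) s : lik w s ^+ 2 = lik (fun x y => w x y ^+ 2) s.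
Proof.
elim: s => [|x s ih] /=; first by rewrite expr1n.
by rewrite exprMn ih; case: s {ih} => [|y s]; rewrite ?expr1n.
Qed.

(** The function [psi] is a supersolution for the operator with weights [w^2]: it dominates the
    constant 1, and each step multiplies it by at most [lam]. Hence the mass after [n] steps is at
    most [lam^n psi]. *)
Lemma cE_lik_sqr_le (w : X -> X -> R) n (psi : X -> R) (lam K : R) : jbm w -> bm psi ->
  (forall x, 1 <= psi x) -> (forall x, psi x <= K) -> 0 <= lam ->
  (forall x, kint P (fun x y => w x y ^+ 2 * psi y) x <= lam * psi x) ->
  cE n (fun s => lik w s ^+ 2) <= lam ^+ n * K.
Proof.
move=> bw bpsi psi1 psiK lam0 hpsi.
pose w2 x y := w x y ^+ 2.
have bw2 : jbm w2 by exact: (bmM bw bw).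
have psi0 x : 0 <= psi x by exact: le_trans (psi1 x).
have h : @sbound R dX X n (fun=> 1) 1 by move=> p; rewrite normr1.
have w20 x y : 0 <= w2 x y by exact: sqr_ge0.
have e m x : (pexp P w2 m (fun=> 1%:E) x <= (lam ^+ m * psi x)%:E)%E.
  elim: m x => [|m ih] x /=; first by rewrite mul1r lee_fin.
  have bwp : jbm (fun x y => w2 x y * psi y) by apply: bmM => //; exact: jbm_snd.
  apply: (@le_trans _ _ ((lam ^+ m * kint P (fun x y => w2 x y * psi y) x)%:E)).
    rewrite EFinM EFin_kint; last exact: jbm_kintegrable.
    rewrite -ge0_integralZl_EFin//.
    - apply: ge0_le_integral => //.
      + by move=> y _; rewrite mule_ge0 ?lee_fin//; apply: pexp_ge0 => // s; rewrite lee_fin.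
      + apply: emeasurable_funM; first by apply/measurable_EFinP/jmeas_section; case: bw2.
        by apply: (measurable_pexp1 P (proj1 bw2) (F := fun=> 1)); exact: smeas_cst.
      + apply: measurable_funeM; apply/measurable_EFinP.
        by case: (jbm_section x bwp).
      + move=> y _; rewrite -EFinM mulrCA [leRHS]EFinM.
        by apply: lee_wpmul2l; [rewrite lee_fin|exact: ih].
    - by move=> y _; rewrite lee_fin mulr_ge0.
    - by apply/measurable_EFinP; case: (jbm_section x bwp).
    - by rewrite exprn_ge0.
  by rewrite lee_fin exprSr -mulrA ler_wpM2l ?exprn_ge0.
have := chainE_lik (n := n) bw2 (smeas_cst 1) h.
under [X in _ = cE _ X]eq_fun do rewrite mulr1 -lik_sqr.
move=> <-; rewrite -lee_fin.
have le1 : (chainE nu P w2 n (fun=> 1%:E) <= (lam ^+ n * K)%:E)%E.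
  apply: (@le_trans _ _ (\int[nu]_x (lam ^+ n * K)%:E)%E).
    apply: ge0_le_integral => //.
    - by move=> y _; apply: pexp_ge0 => // s; rewrite lee_fin.
    - by apply: (measurable_pexp1 P (proj1 bw2) (F := fun=> 1)); exact: smeas_cst.
    - move=> x _; apply: (le_trans (e _ _)).
      by rewrite lee_fin ler_wpM2l ?exprn_ge0.
  by rewrite integral_cst// [X in (_ * X)%E]probability_setT mule1.
have ge0 : (0 <= chainE nu P w2 n (fun=> 1%:E))%E.
  by apply: integral_ge0 => y _; apply: pexp_ge0 => // s; rewrite lee_fin.
rewrite fineK// ge0_fin_numE//; exact: le_lt_trans le1 (ltry _).
Qed.

End chain_expectation.

(** * The perturbed kernels *)

Lemma wpert0 (R : realType) dX (X : measurableType dX) n :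
  wpert (fun _ _ : X => 0) n = @w1 R dX X.
Proof. by apply/funext => x; apply/funext => y; rewrite /wpert /w1 mul0r addr0. Qed.

Section perturbed_chain.
Context (R : realType) dX (X : measurableType dX) (P : R.-pker X ~> X).
Variable h : X -> X -> R.
Hypothesis hB : classB P h.
Implicit Types n : nat.

Lemma classB_bound : exists2 M, 0 <= M & forall x y, `|h x y| <= M.
Proof.
have [_ [M hM] _] := hB; exists `|M| => // x y.
by rewrite (le_trans (hM x y))// ler_norm.
Qed.

Lemma classB_jbm : jbm h.
Proof. by have [mh [M hM] _] := hB; split => //; exists M => q. Qed.

Lemma kint_classB x : kint P h x = 0.
Proof. by have [_ _ h0] := hB; rewrite /kint /Rintegral h0. Qed.

Local Notation b n := (Num.sqrt (n%:R : R))^-1.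

Lemma jbm_wpert n : jbm (wpert h n).
Proof.
apply: bmD; first exact: bm_cst.
by apply: bmM; [exact: classB_jbm|exact: bm_cst].
Qed.

Lemma kint_wpert n x : kint P (wpert h n) x = 1.
Proof.
have := @kintD _ _ _ P (fun _ _ => 1) (fun x y => b n * h x y) x.
rewrite (kint_cst P (fun=> 1)) (kintZ (fun=> b n)); last exact/jbm_kintegrable/classB_jbm.
rewrite kint_classB mulr0 addr0 => <-.
- by apply: eq_Rintegral => y _; rewrite /wpert mulrC.
- exact/jbm_kintegrable/bm_cst.
- by apply: (kintegrableZ (fun=> b n)); exact/jbm_kintegrable/classB_jbm.
Qed.

Lemma wpert_near1 n M : 0 <= M -> (forall x y, `|h x y| <= M) ->
  forall x y, `|wpert h n x y - 1| <= M * b n.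
Proof.
move=> M0 hM x y; rewrite /wpert addrAC subrr add0r normrM.
rewrite (ger0_norm (_ : 0 <= b n)) ?invr_ge0 ?sqrtr_ge0//.
by rewrite ler_wpM2r ?invr_ge0 ?sqrtr_ge0.
Qed.

Lemma cvg_invsqrt : (fun n => b n) @ \oo --> (0 : R).
Proof.
apply/cvgrPdist_lt => e e0.
exists (Num.bound (e ^- 2)).+1 => // n /= hn.
rewrite sub0r normrN ger0_norm ?invr_ge0 ?sqrtr_ge0//.
have n0 : (0 : R) < n%:R by rewrite ltr0n (leq_trans _ hn).
rewrite invf_plt ?posrE ?sqrtr_gt0// -[ltLHS]ger0_norm ?invr_ge0 ?ltW//.
rewrite -sqrtr_sqr ltr_sqrt// exprVn.
apply: (lt_le_trans (archi_boundP _)); first by rewrite invr_ge0 sqr_ge0.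
by rewrite ler_nat ltnW.
Qed.

Lemma invsqrt_small (e : R) : 0 < e -> \forall n \near \oo, b n < e.
Proof.
move=> e0; have /cvgrPdist_lt /(_ e e0) := cvg_invsqrt.
apply: filterS => n; rewrite sub0r normrN; apply: le_lt_trans; exact: ler_norm.
Qed.

Lemma wpert_ge0_near : \forall n \near \oo, forall x y, 0 <= wpert h n x y.
Proof.
have [M M0 hM] := classB_bound.
have M1 : 0 < (M + 1)^-1 by rewrite invr_gt0 ltr_wpDl.
have := invsqrt_small M1; apply: filterS => n hn x y.
have := wpert_near1 n M0 hM x y; rewrite ler_norml => /andP[+ _].
have : M * b n <= 1.
  rewrite (le_trans (ler_wpM2l M0 (ltW hn)))// ler_pdivrMr ?mul1r ?lerDl//.
  by rewrite ltr_wpDl.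
lra.
Qed.

Variables (pi : probability X R) (kappa rho : R).
Hypothesis kappa_ge0 : 0 <= kappa.
Hypothesis rho01 : 0 <= rho < 1.
Hypothesis ergodic : forall xi t (A : set X), measurable A ->
  `|Pows P t (fun y => \1_A y) xi - fine (pi A)| <= kappa * rho ^+ t / 2.

Lemma geom_small (c e : R) : 0 < e -> exists N, c * rho ^+ N <= e.
Proof.
move=> e0; have [r0 r1] := andP rho01.
have := @cvg_geometric R c rho; rewrite ger0_norm// => /(_ r1) /cvgrPdist_le /(_ e e0) [N _ /(_ N (leqnn N))].
rewrite /= sub0r normrN => hN; exists N; apply: le_trans hN; exact: ler_norm.
Qed.

Lemma perturbed_stationary : \forall n \near \oo,
  exists mu : probability X R, stationary P (wpert h n) mu.
Proof.
have [M M0 hM] := classB_bound.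
have e4 : 0 < 4^-1 :> R by [].
have [N hN] := geom_small kappa e4.
(* The number [N] of steps is fixed first, by the mixing of [P]. Only then is [n] taken large, so
   that the perturbation accumulated over [N] steps costs at most 1/4; together with the mixing
   error this gives 1/2. *)
have e0 : 0 < (4 * (N%:R * M + 1))^-1 by rewrite invr_gt0 mulr_gt0// ltr_wpDl// mulr_ge0.
near=> n.
apply: (@tilted_stationary _ _ _ P pi kappa rho ergodic _ _ (jbm_wpert n).1 _ (wpert_near1 n M0 hM)
  (kint_wpert n) N).
  by near: n; exact: wpert_ge0_near.
have hb : b n < (4 * (N%:R * M + 1))^-1 by near: n; exact: invsqrt_small.
have : N%:R * (M * b n) <= 4^-1.
  rewrite mulrA (le_trans (ler_wpM2l _ (ltW hb))) ?mulr_ge0//.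
  rewrite invfM mulrCA ler_piMr// ler_pdivrMr ?mul1r ?lerDl//.
  by rewrite ltr_wpDl// mulr_ge0.
move: hN; lra.
Unshelve. all: by end_near. Qed.

Variable nu : probability X R.

Lemma cE_lik_perturbed_le : exists u : nat -> R,
  u @ \oo --> expR (\int[pi]_x kint P (fun x y => h x y ^+ 2) x) /\
  forall n, (0 < n)%N -> cE nu P n (fun s => lik (wpert h n) s ^+ 2) <= u n.
Proof.
(* With [u] solving the Poisson equation [u - Pu = k - kbar] and [b = n^(-1/2)], the
   function [1 + b^2 u] is an approximate eigenfunction of [P (1 + b h)^2] for the
   eigenvalue [1 + b^2 kbar + O(b^3)]. *)
have [M M0 hM] := classB_bound; have bh := classB_jbm.
have bh2 : jbm (fun x y => h x y ^+ 2) by exact: (bmM bh bh).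
pose k := kint P (fun x y => h x y ^+ 2); have bk : bm k by exact: bm_kint.
have k_le x : `|k x| <= M ^+ 2.
  apply: kint_le_bound; first by case: bh2.
  by move=> y z; rewrite normrX lerXn2r ?nnegrE.
set kbar := \int[pi]_x _.
pose u0 := poisson_sol P pi k.
have M20 : 0 <= M ^+ 2 by exact: sqr_ge0.
have bu0 : bm u0 by exact: (bm_poisson_sol kappa_ge0 rho01 ergodic M20 bk k_le).
have [K K0 u0K] : exists2 K, 0 <= K & forall x, `|u0 x| <= K.
  exists (M ^+ 2 * kappa / (1 - rho)).
    by have [? ?] := andP rho01; rewrite !mulr_ge0// invr_ge0; lra.
  exact: (poisson_sol_le kappa_ge0 rho01 ergodic M20 bk k_le).
(* The Poisson equation is unchanged by the addition of a constant; this one makes [u] nonnegative,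
   so that [psi] below is at least 1. *)
pose u x := u0 x + K.
have bu : bm u by apply: bmD => //; exact: bm_cst.
have u_ge0 x : 0 <= u x by have := u0K x; rewrite ler_norml /u => /andP[]; lra.
have u_le x : u x <= 2 * K by have := u0K x; rewrite ler_norml /u => /andP[_]; lra.
have Pu x : Pops P u x = u x - k x + kbar.
  rewrite /u PopsD//; last exact: bm_cst.
  rewrite Pops_cst (poisson_solP kappa_ge0 rho01 ergodic M20 bk k_le).
  by rewrite -[\int[pi]_y k y]/kbar -/u0 /=; ring.
(* As [0 <= u <= 2 K], the first term bounds the contribution of [2 b^3 P (h u)] and the second that
   of [b^4 P (h^2 u)], both relative to [b^3]; the latter uses [b <= 1]. *)
pose C := 4 * M * K + 2 * M ^+ 2 * K.
have C0 : 0 <= C by apply: addr_ge0; rewrite !mulr_ge0.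
exists (fun n => expR (kbar + C * b n) * (1 + 2 * K * (b n) ^+ 2)); split.
  rewrite -[X in _ --> X]mulr1; apply: cvgM.
    suff ce : (fun n => kbar + C * b n) @ \oo --> kbar.
      by apply: (cvg_comp _ _ ce); exact: continuous_expR.
    rewrite -[X in _ --> X]addr0; apply: cvgD; first exact: cvg_cst.
    by rewrite -[X in _ --> X](mulr0 C); apply: cvgMr; exact: cvg_invsqrt.
  rewrite -[X in _ --> X]addr0; apply: cvgD; first exact: cvg_cst.
  rewrite -[X in _ --> X](mulr0 (2 * K)); apply: cvgMr.
  by rewrite -[X in _ --> X](mul0r 0); apply: cvgM; exact: cvg_invsqrt.
move=> n n_gt0; have n0 : (0 : R) < n%:R by rewrite ltr0n.
have b0 : 0 <= b n by rewrite invr_ge0 sqrtr_ge0.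
have b1 : b n <= 1.
  by rewrite invf_le1 ?sqrtr_gt0// -[leLHS](sqrtr1 R) ler_sqrt// ler1n.
have bb : b n ^+ 2 = n%:R^-1 by rewrite exprVn sqr_sqrtr// ltW.
set d := b n ^+ 2; have d0 : 0 <= d by exact: sqr_ge0.
have kbar0 : 0 <= kbar.
  apply: Rintegral_ge0 => x _; apply: Rintegral_ge0 => y _; exact: sqr_ge0.
pose lam := 1 + d * (kbar + C * b n).
have lam0 : 0 <= lam by rewrite /lam addr_ge0// mulr_ge0// addr_ge0// mulr_ge0.
pose psi x := 1 + d * u x.
have bpsi : bm psi by apply: bmD; [exact: bm_cst|exact: bmZ].
have psi1 x : 1 <= psi x by rewrite lerDl mulr_ge0.
have psiK x : psi x <= 1 + 2 * K * d by rewrite lerD2l mulrC ler_wpM2r.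
have step x : kint P (fun x y => wpert h n x y ^+ 2 * psi y) x <= lam * psi x.
  have ki f : jbm f -> kintegrable P f by exact: jbm_kintegrable.
  have bhu : jbm (fun x y => h x y * u y) by apply: bmM => //; exact: jbm_snd.
  have bhhu : jbm (fun x y => h x y ^+ 2 * u y) by apply: bmM => //; exact: jbm_snd.
  have bc (c : R) : jbm (fun _ _ : X => c) by exact: bm_cst.
  have bz (c : R) (f : X -> X -> R) : jbm f -> jbm (fun x y => c * f x y) by move=> bf; exact: bmZ.
  have bd (f g : X -> X -> R) : jbm f -> jbm g -> jbm (fun x y => f x y + g x y) by move=> bf bg; exact: bmD.
  have E : kint P (fun x y => wpert h n x y ^+ 2 * psi y) x =
    1 + 2 * b n * kint P h x + d * k x + d * Pops P u x +
      2 * b n * d * kint P (fun x y => h x y * u y) x +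
      d ^+ 2 * kint P (fun x y => h x y ^+ 2 * u y) x.
    have j1 := bc 1; have j2 := bz (2 * b n) _ bh; have j3 := bz d _ bh2.
    have j4 := bz d _ (jbm_snd bu); have j5 := bz (2 * b n * d) _ bhu.
    have j6 := bz (d ^+ 2) _ bhhu.
    have j12 := bd _ _ j1 j2; have j123 := bd _ _ j12 j3.
    have j1234 := bd _ _ j123 j4; have j12345 := bd _ _ j1234 j5.
    rewrite -[X in _ = X + _ + _ + _ + _ + _](kint_cst P (fun=> 1) x) PopsE.
    rewrite -(kintZ (fun=> 2 * b n) (k := h)); last exact: ki.
    rewrite -kintD; [|exact: ki|exact: ki].
    rewrite -(kintZ (fun=> d)); last exact: ki.
    rewrite -kintD; [|exact: ki|exact: ki].
    rewrite -(kintZ (fun=> d)); last exact: kintegrable_bm.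
    rewrite -kintD; [|exact: ki|exact: ki].
    rewrite -(kintZ (fun=> 2 * b n * d)); last exact: ki.
    rewrite -kintD; [|exact: ki|exact: ki].
    rewrite -(kintZ (fun=> d ^+ 2)); last exact: ki.
    rewrite -kintD; [|exact: ki|exact: ki].
    by apply: eq_Rintegral => y _; rewrite /wpert /psi /d; ring.
  (* The term of order [b] vanishes because [h] has conditional mean zero, and the [k x] of order
     [b^2] cancels against the one in [P u], leaving the constant [kbar]. *)
  rewrite E kint_classB mulr0 addr0 Pu.
  have h1 : kint P (fun x y => h x y * u y) x <= M * (2 * K).
    apply: le_trans (ler_norm _) _; apply: kint_le_bound; first by case: bhu.
    by move=> y z; rewrite normrM ler_pM// ger0_norm.
  have h2 : kint P (fun x y => h x y ^+ 2 * u y) x <= M ^+ 2 * (2 * K).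
    apply: le_trans (ler_norm _) _; apply: kint_le_bound; first by case: bhhu.
    move=> y z; rewrite normrM ler_pM//; last by rewrite ger0_norm.
    by rewrite normrX lerXn2r ?nnegrE.
  have h3 : 2 * b n * d * kint P (fun x y => h x y * u y) x <= 2 * b n * d * (M * (2 * K)).
    by rewrite ler_wpM2l// !mulr_ge0.
  have h4 : d ^+ 2 * kint P (fun x y => h x y ^+ 2 * u y) x <= d * b n * (M ^+ 2 * (2 * K)).
    apply: (@le_trans _ _ (d ^+ 2 * (M ^+ 2 * (2 * K)))); first by rewrite ler_wpM2l// sqr_ge0.
    rewrite ler_wpM2r ?mulr_ge0// expr2 ler_wpM2l// /d expr2 ler_piMr//.
  have h5 : lam * psi x >= 1 + d * u x + d * (kbar + C * b n).
    have : 0 <= d * (kbar + C * b n) * (d * u x).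
      by rewrite !mulr_ge0// addr_ge0// mulr_ge0.
    by rewrite /lam /psi; lra.
  apply: le_trans h5; rewrite /C; lra.
apply: (le_trans (cE_lik_sqr_le nu n (jbm_wpert n) bpsi psi1 psiK lam0 step)).
apply: ler_wpM2r; first by rewrite addr_ge0// !mulr_ge0.
(* Since [n d = 1], the power [lam^n] is bounded through [1 + y <= exp y]. *)
have -> : kbar + C * b n = n%:R * (d * (kbar + C * b n)).
  by rewrite mulrA /d bb divff ?mul1r// gt_eqF.
rewrite expRM_natl.
by apply: lerXn2r; rewrite ?nnegrE ?expR_ge0//; exact: expR_ge1Dx.
Qed.

End perturbed_chain.

(** * Comparing the stationary laws *)

Section truncation.
Context d (T : measurableType d) (R : realType) (mu : {measure set T -> \bar R}).
Hypothesis mu1 : mu setT = 1%E.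

Lemma bm_min (f : T -> R) (n : nat) : measurable_fun setT f -> (forall x, 0 <= f x) ->
  bm (fun x => Num.min (f x) n%:R).
Proof.
move=> mf f0; split; first exact: measurable_minr.
by exists n%:R => x; rewrite ger0_norm ?ge_min ?lexx ?orbT// le_min f0 ler0n.
Qed.

Lemma integral_trunc_le (f : T -> R) (C : R) : measurable_fun setT f ->
  (forall x, 0 <= f x) -> (forall n, \int[mu]_x Num.min (f x) n%:R <= C) ->
  (\int[mu]_x (f x)%:E <= C%:E)%E.
Proof.
move=> mf f0 fC; pose fn (n : nat) x : R := Num.min (f x) n%:R.
have fn0 n x : 0 <= fn n x by rewrite le_min f0 ler0n.
have bfn n : bm (fn n) by exact: bm_min.
have cf x : (fun n => fn n x) @ \oo --> f x.
  apply: cvg_near_cst; exists (Num.bound (f x)) => // n /= hn.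
  apply/min_idPl; apply: (le_trans (ltW (archi_boundP (f0 x)))).
  by rewrite ler_nat.
have c1 : (fun n => \int[mu]_x (fn n x)%:E)%E @ \oo --> (\int[mu]_x (f x)%:E)%E.
  have -> : (\int[mu]_x (f x)%:E)%E = (\int[mu]_x limn (fun n => (fn n x)%:E))%E.
    apply: eq_integral => x _; apply/esym/cvg_lim => //.
    by apply: cvg_EFin; [exact: nearW|exact: cf].
  apply: cvg_monotone_convergence => //.
  - by move=> n; apply/measurable_EFinP; case: (bfn n).
  - by move=> n x _; rewrite lee_fin.
  - by move=> x _ n m nm; rewrite lee_fin /fn le_min ge_min lexx/= ge_min ler_nat nm orbT.
rewrite -(cvg_lim _ c1)//; apply: lime_le; first by apply/cvg_ex; eexists; exact: c1.
apply: nearW => n; have := fC n; rewrite -lee_fin; apply: le_trans.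
rewrite /Rintegral fineK//; apply: (integrable_fin_num measurableT).
exact: (bm_integrable mu1 (bfn n)).
Qed.

(** A dyadic layer-cake bound, which turns a truncated integral into a weighted sum of tails. When
    [y] exceeds [2^J] the right side is already at least [2^J] and gains another [2^J]. *)
Lemma dyadic_bound (y : R) (J : nat) : 0 <= y ->
  Num.min y (2 ^+ J) <= 1 + \sum_(j < J) 2 ^+ j * ((2 ^+ j < y)%R : nat)%:R.
Proof.
move=> y0; elim: J => [|J ih]; first by rewrite big_ord0 addr0 expr0 ge_min lexx orbT.
rewrite big_ord_recr /= addrA; move: ih.
case: (ltP (2 ^+ J) y) => h ih.
  by rewrite mulr1 (@le_trans _ _ (2 ^+ J.+1))// ?ge_min ?lexx ?orbT// exprS; lra.
rewrite mulr0 addr0 (le_trans _ ih)//.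
by rewrite ge_min lexx.
Qed.

End truncation.

(** * Tails and first-order shift of a tilted stationary law *)

Section tilted_stationary_measure.
Context (R : realType) dX (X : measurableType dX) (P : R.-pker X ~> X).
Variables (pi : probability X R) (kappa rho : R).
Hypothesis kappa_ge0 : 0 <= kappa.
Hypothesis rho01 : 0 <= rho < 1.
Hypothesis ergodic : forall xi t (A : set X), measurable A ->
  `|Pows P t (fun y => \1_A y) xi - fine (pi A)| <= kappa * rho ^+ t / 2.
Variables (w : X -> X -> R) (a : R).
Hypotheses (jw : jmeas w) (w_ge0 : forall x y, 0 <= w x y).
Hypothesis w_near1 : forall x y, `|w x y - 1| <= a.
Hypothesis a_ge0 : 0 <= a.
Variable mu : probability X R.
Hypothesis mu_stat : stationary P w mu.
Implicit Types (f g : X -> R).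

Let mu1 : mu setT = 1%E. Proof. exact: probability_setT. Qed.
Let pi1 : pi setT = 1%E. Proof. exact: probability_setT. Qed.
Let bw : jbm w. Proof. exact: (tilt_jbm jw w_near1). Qed.

Lemma tilt_iter_le_Pows t f : bm f -> (forall x, 0 <= f x) ->
  forall x, iter t (tilt P w) f x <= (1 + a) ^+ t * Pows P t f x.
Proof.
move=> bf f0; elim: t => [|t ih] x; first by rewrite mul1r.
have bt := bm_tilt_iter P jw w_near1 t bf; have bP := bm_Pows P t bf.
have bP' : bm (fun x => (1 + a) ^+ t * Pows P t f x) by exact: bmZ.
rewrite iterS; apply: (le_trans (tilt_le P jw w_ge0 w_near1 bt bP' ih x)).
rewrite (tiltZ P jw w_near1)// exprSr -mulrA ler_wpM2l ?exprn_ge0 ?addr_ge0//.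
rewrite PowsS -(kintZ (fun=> 1 + a)); last exact: kintegrable_bm.
apply: kint_le.
- exact/jbm_kintegrable/(tilt_jbmM jw w_near1).
- by apply: (kintegrableZ (fun=> 1 + a)); exact: kintegrable_bm.
move=> y; apply: ler_wpM2r.
  elim: (t) y => [|s ihs] y; first exact: f0.
  by apply: Rintegral_ge0 => z _; exact: ihs.
by have := w_near1 x y; rewrite ler_norml => /andP[_]; rewrite lerBlDl.
Qed.

Lemma stationary_tilt_iter t f : bm f -> \int[mu]_x f x = \int[mu]_x iter t (tilt P w) f x.
Proof.
move=> bf; elim: t => [//|t ->]; rewrite (stationary_bm bw mu_stat)//.
exact: (bm_tilt_iter P jw w_near1).
Qed.

(** By stationarity the tilted chain may be run for [t] steps from [mu]. Domination by
    [(1 + a)^t P^t] then replaces it by the original chain, which has forgotten its starting point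
    up to [kappa rho^t]. *)
Lemma stationary_tail t (A : set X) : measurable A ->
  fine (mu A) <= (1 + a) ^+ t * (fine (pi A) + kappa * rho ^+ t).
Proof.
move=> mA; have bA : bm (\1_A : X -> R) by exact: bm_indic.
have -> : fine (mu A) = \int[mu]_x \1_A x by rewrite /Rintegral integral_indic// setIT.
rewrite (stationary_tilt_iter t bA).
have ii f : bm f -> mu.-integrable setT (EFin \o f) by exact: bm_integrable.
apply: (@le_trans _ _ (\int[mu]_x ((1 + a) ^+ t * (fine (pi A) + kappa * rho ^+ t)))); last by rewrite Rint_cst.
apply: le_Rintegral => //; [exact/ii/(bm_tilt_iter P jw w_near1)|exact/ii/bm_cst|].
move=> x _; apply: (le_trans (tilt_iter_le_Pows t bA _ x)).
  by move=> y; rewrite indicE.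
rewrite ler_wpM2l ?exprn_ge0 ?addr_ge0//.
have := ergodic x t mA; rewrite ler_norml => /andP[_].
have : 0 <= kappa * rho ^+ t by rewrite mulr_ge0// exprn_ge0//; case/andP: rho01.
rewrite /=; lra.
Qed.

(* [mu] need not be absolutely continuous with respect to [pi]: the tails
   [mu (|f| > 2^j)] are compared with those of [pi] by running the chain for [N j] steps,
   at a cost [(1 + a)^(N j)] which the decay [4^-j] of the tails of [pi] absorbs. *)
Lemma stationary_integrable_of_sqr f N : measurable_fun setT f ->
  pi.-integrable setT (EFin \o (fun x => f x ^+ 2)) ->
  rho ^+ N <= 4^-1 -> (1 + a) ^+ N <= 4 / 3 ->
  mu.-integrable setT (EFin \o f).
Proof.
move=> mf f2 hN aN.
pose C := \int[pi]_x f x ^+ 2.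
have C0 : 0 <= C by apply: Rintegral_ge0 => x _; exact: sqr_ge0.
have mnf : measurable_fun setT (fun x => `|f x|) by exact: measurableT_comp.
pose A j := [set x | 2 ^+ j < `|f x|].
have mA j : measurable (A j).
  have := mnf measurableT _ (measurable_itv `](2 ^+ j : R), +oo[).
  rewrite setTI; congr measurable; apply/seteqP; split => y /=;
    by rewrite in_itv/= andbT.
have ipi g : bm g -> pi.-integrable setT (EFin \o g) by exact: bm_integrable.
have imu g : bm g -> mu.-integrable setT (EFin \o g) by exact: bm_integrable.
(* Chebyshev's inequality with the second moment. *)
have piA j : fine (pi (A j)) <= C * 4^-1 ^+ j.
  have -> : fine (pi (A j)) = \int[pi]_x \1_(A j) x by rewrite /Rintegral integral_indic// setIT.
  rewrite exprVn ler_pdivlMr ?exprn_gt0// mulrC -RintegralZl//; last exact/ipi/bm_indic.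
  apply: le_Rintegral => //; first exact/ipi/bmZ/bm_indic.
  move=> x _; rewrite indicE; case: (boolP (x \in A j)) => hx; last by rewrite mulr0 sqr_ge0.
  move: hx; rewrite inE /A /= mulr1 => hx.
  rewrite -(real_normK (num_real (f x))) (_ : 4 = 2 ^+ 2 :> R); last by rewrite -natrX.
  by rewrite -exprM mulnC exprM lerXn2r ?nnegrE ?exprn_ge0// ltW.
(* With [t = N j] the tilt costs [(4/3)^j] against [4^-j], which leaves [3^-j]. Against the dyadic
   weights [2^j] this is the series of [(2/3)^j], of sum 3. *)
have muA j : fine (mu (A j)) <= (C + kappa) * 3^-1 ^+ j.
  apply: (le_trans (stationary_tail (N * j) (mA j))).
  have h1 : fine (pi (A j)) + kappa * rho ^+ (N * j) <= (C + kappa) * 4^-1 ^+ j.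
    rewrite mulrDl lerD// ler_wpM2l// exprM lerXn2r ?nnegrE ?exprn_ge0//.
    by case/andP: rho01.
  have h2 : (1 + a) ^+ (N * j) <= (4 / 3) ^+ j.
    by rewrite exprM lerXn2r ?nnegrE ?exprn_ge0 ?addr_ge0.
  apply: (@le_trans _ _ ((4 / 3) ^+ j * ((C + kappa) * 4^-1 ^+ j))).
    apply: ler_pM => //; first by rewrite exprn_ge0 ?addr_ge0.
    apply: addr_ge0; first by rewrite fine_ge0.
    by rewrite mulr_ge0// exprn_ge0//; case/andP: rho01.
  rewrite mulrCA -exprMn.
  by have -> : 4 / 3 / 4 = 3^-1 :> R by field.
apply/integrableP; split; first exact/measurable_EFinP.
apply: (@le_lt_trans _ _ (1 + 3 * (C + kappa))%:E); last by rewrite ltry.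
have := @integral_trunc_le _ _ _ mu mu1 (fun x => `|f x|) (1 + 3 * (C + kappa)) mnf.
apply=> // n.
pose g x : R := 1 + \sum_(j < n) 2 ^+ j * \1_(A j) x.
have bterm j : bm (fun x => 2 ^+ j * \1_(A j) x : R) by exact/bmZ/bm_indic.
have bs m : bm (fun x => \sum_(j < m) 2 ^+ j * \1_(A j) x : R).
  exact: (bm_sum (f := fun (j : 'I_m) x => 2 ^+ j * \1_(A j) x)).
apply: (@le_trans _ _ (\int[mu]_x g x)).
  apply: le_Rintegral => //; [exact/imu/bm_min|by apply: imu; apply: bmD => //; exact: bm_cst|].
  move=> x _; apply: (@le_trans _ _ (Num.min `|f x| (2 ^+ n))).
    rewrite le_min ge_min lexx/= ge_min -natrX ler_nat.
    by rewrite (ltnW (ltn_expl n _))// orbT.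
  apply: (le_trans (dyadic_bound n (normr_ge0 (f x)))).
  rewrite lerD2l; apply: ler_sum => j _; rewrite indicE /A mem_setE//.
rewrite /g RintegralD//; [|exact/imu/bm_cst|exact: (imu _ (bs n))].
rewrite Rint_cst// lerD2l.
have e m : \int[mu]_x \sum_(j < m) 2 ^+ j * \1_(A j) x = \sum_(j < m) 2 ^+ j * fine (mu (A j)).
  elim: m => [|m ih].
    by under eq_Rintegral do rewrite big_ord0; rewrite Rint_cst// big_ord0.
  under eq_Rintegral do rewrite big_ord_recr /=.
  rewrite RintegralD//; [|exact: (imu _ (bs m))|exact: (imu _ (bterm m))].
  rewrite ih big_ord_recr /= RintegralZl//; last exact/imu/bm_indic.
  by rewrite /Rintegral integral_indic// setIT.
rewrite e; apply: (@le_trans _ _ (\sum_(j < n) (C + kappa) * (2 / 3) ^+ j)).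
  apply: ler_sum => j _; apply: (le_trans (ler_wpM2l _ (muA j))); first by rewrite exprn_ge0.
  by rewrite mulrCA -exprMn.
rewrite -mulr_sumr mulrC ler_wpM2r ?addr_ge0//.
have := subrX1 (2 / 3 : R) n; have : 0 <= (2 / 3 : R) ^+ n by rewrite exprn_ge0// divr_ge0.
lra.
Qed.

Hypothesis pi_stat : stationary P (@w1 R dX X) pi.

Lemma pi_Pops f : kintegrable P (fun _ => f) -> pi.-integrable setT (EFin \o f) ->
  \int[pi]_x Pops P f x = \int[pi]_x f x.
Proof.
move=> kf fi; have bw1 : jbm (@w1 R dX X) by exact: bm_cst.
rewrite (stationary_int bw1 (fun _ _ => ler01) pi_stat kf fi).
by apply: eq_Rintegral => x _; apply: eq_Rintegral => y _; rewrite /w1 mul1r.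
Qed.

(** Integrate the Poisson equation [u - P u = f - pi f] against [mu] and write [mu u] as
    [mu (P (w u))] by stationarity: only the difference [w - 1] remains. *)
Lemma stationary_shift_bm f : bm f ->
  \int[mu]_x f x - \int[pi]_x f x =
  \int[mu]_x kint P (fun x y => (w x y - 1) * poisson_sol P pi f y) x.
Proof.
move=> bf; have [mf [M0 fM0]] := bf.
have fM x : `|f x| <= `|M0| by rewrite (le_trans (fM0 x))// ler_norm.
pose u := poisson_sol P pi f.
have bu : bm u by exact: (bm_poisson_sol kappa_ge0 rho01 ergodic (normr_ge0 M0) bf fM).
have imu g : bm g -> mu.-integrable setT (EFin \o g) by exact: bm_integrable.
have bt := bm_tilt P jw w_near1 bu; have bP := bm_Pops P bu.
have -> : \int[mu]_x kint P (fun x y => (w x y - 1) * u y) x =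
    \int[mu]_x (tilt P w u x - Pops P u x).
  apply: eq_Rintegral => x _; rewrite -kintB; [|exact/jbm_kintegrable/(tilt_jbmM jw w_near1)|exact: kintegrable_bm].
  by apply: eq_Rintegral => y _; rewrite mulrBl mul1r.
rewrite RintegralB//; [|exact: imu|exact: imu].
rewrite -(stationary_bm bw mu_stat bu).
under [X in _ = _ - X]eq_Rintegral do
  rewrite (poisson_solP kappa_ge0 rho01 ergodic (normr_ge0 M0) bf fM).
rewrite RintegralD//; [|by apply: imu; exact: bmB|exact/imu/bm_cst].
rewrite RintegralB//; [|exact: imu|exact: imu].
by rewrite Rint_cst// /u; ring.
Qed.

(** For an unbounded [f] with bounded [P f], one step is taken by hand: [mu f = mu (P (w f))] and
    [pi f = pi (P f)]. What is left is the shift of the bounded function [P f]. *)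
Lemma stationary_shift f : kintegrable P (fun _ => f) -> bm (Pops P f) ->
  mu.-integrable setT (EFin \o f) -> pi.-integrable setT (EFin \o f) ->
  \int[mu]_x f x - \int[pi]_x f x =
  \int[mu]_x (kint P (fun x y => (w x y - 1) * f y) x +
    kint P (fun x y => (w x y - 1) * poisson_sol P pi (Pops P f) y) x).
Proof.
move=> kf bPf imuf ipif.
have imu g : bm g -> mu.-integrable setT (EFin \o g) by exact: bm_integrable.
have mf : measurable_fun setT f by have /measurable_EFinP := measurable_int mu imuf.
have [_ [M0 fM0]] := bPf.
have fM x : `|Pops P f x| <= `|M0| by rewrite (le_trans (fM0 x))// ler_norm.
have bu := bm_poisson_sol kappa_ge0 rho01 ergodic (normr_ge0 M0) bPf fM.
have bw1 : jbm (fun x y => w x y - 1) by apply: bmB => //; exact: bm_cst.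
have kwf := kintegrable_bounded_mul bw (jmeas_snd mf) kf.
have e : kint P (fun x y => (w x y - 1) * f y) =
   (fun x => kint P (fun x y => w x y * f y) x - Pops P f x).
  apply/funext => x; rewrite PopsE -kintB//; apply: eq_Rintegral => y _.
  by rewrite mulrBl mul1r.
have iwf := stationary_integrable bw w_ge0 mu_stat kf imuf.
rewrite RintegralD//; last first.
- by apply/imu/bm_kint/bmM => //; exact: jbm_snd.
- rewrite [X in EFin \o X]e; exact: (integrableB measurableT iwf (imu _ bPf)).
rewrite -stationary_shift_bm//.
rewrite e.
rewrite RintegralB//; last exact: imu.
by rewrite -(stationary_int bw w_ge0 mu_stat kf imuf) pi_Pops//; ring.
Qed.

(** The 1 accounts for [f] itself and [kappa / (1 - rho)] for the Poisson solution of [P f]. *)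
Definition mix_const : R := 1 + kappa / (1 - rho).

Lemma stationary_shift_le f B : 0 <= B -> kintegrable P (fun _ => f) ->
  (forall x, kint P (fun _ y => `|f y|) x <= B) ->
  mu.-integrable setT (EFin \o f) -> pi.-integrable setT (EFin \o f) ->
  `|\int[mu]_x f x - \int[pi]_x f x| <= a * B * mix_const.
Proof.
move=> B0 kf fB imuf ipif.
have mf : measurable_fun setT f by have /measurable_EFinP := measurable_int mu imuf.
have knf : kintegrable P (fun _ y => `|f y|) by move=> x; exact: (integrable_norm (kf x)).
have PfB x : `|Pops P f x| <= B.
  by apply: (le_trans (le_normr_Rintegral measurableT (kf x))); exact: fB.
have bPf : bm (Pops P f).
  by split; [exact: (measurable_kint P (jmeas_snd mf))|exists B].
rewrite stationary_shift//; apply: Rint_norm_le => //.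
  have bu := bm_poisson_sol kappa_ge0 rho01 ergodic B0 bPf PfB.
  have mw1 : jmeas (fun x y => w x y - 1) by apply: measurable_funB => //; exact: measurable_cst.
  apply: measurable_funD; apply: measurable_kint; apply: measurable_funM => //; apply: jmeas_snd => //.
  by case: bu.
move=> x; rewrite (le_trans (ler_normD _ _))// /mix_const mulrDr mulr1 lerD//.
  have bw1 : jbm (fun x y => w x y - 1) by apply: bmB => //; exact: bm_cst.
  have k1 := kintegrable_bounded_mul bw1 (jmeas_snd mf) kf.
  apply: (le_trans (le_normr_Rintegral measurableT (k1 x))).
  apply: (@le_trans _ _ (a * kint P (fun _ y => `|f y|) x)); last exact: ler_wpM2l.
  rewrite -(kintZ (fun=> a))//; apply: le_Rintegral => //.
  - exact: (integrable_norm (k1 x)).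
  - exact: (kintegrableZ (fun=> a)).
  - by move=> y _; rewrite normrM ler_wpM2r.
have bu := bm_poisson_sol kappa_ge0 rho01 ergodic B0 bPf PfB.
apply: kint_le_bound.
  apply: measurable_funM; last by apply: jmeas_snd; case: bu.
  by apply: measurable_funB => //; exact: measurable_cst.
move=> y z; rewrite normrM -!mulrA ler_pM// mulrA.
exact: (poisson_sol_le kappa_ge0 rho01 ergodic B0 bPf PfB).
Qed.

End tilted_stationary_measure.

(** * Norms on column vectors *)

Section norm_equivalence.
Context (R : realType) (d : nat) (nrm : 'cV[R]_d -> R) (nrm_norm : is_norm nrm).
Implicit Types x y : 'cV[R]_d.

Let nrm_eq0 x : nrm x = 0 -> x = 0. Proof. by case: nrm_norm => h _ _; exact: h. Qed.
Lemma nrmZ (a : R) x : nrm (a *: x) = `|a| * nrm x. Proof. by case: nrm_norm. Qed.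
Lemma nrmD x y : nrm (x + y) <= nrm x + nrm y. Proof. by case: nrm_norm. Qed.
Lemma nrm0 : nrm 0 = 0. Proof. by rewrite -(scale0r 0) nrmZ normr0 mul0r. Qed.
Lemma nrmN x : nrm (- x) = nrm x. Proof. by rewrite -scaleN1r nrmZ normrN1 mul1r. Qed.
Lemma nrmB x y : nrm (x - y) <= nrm x + nrm y. Proof. by rewrite -(nrmN y) nrmD. Qed.
Lemma nrm_ge0 x : 0 <= nrm x.
Proof. by have := nrmB x x; rewrite subrr nrm0 -mulr2n pmulrn_lge0. Qed.
Lemma nrm_sum (I : finType) (F : I -> 'cV[R]_d) : nrm (\sum_i F i) <= \sum_i nrm (F i).
Proof.
elim/big_rec2 : _ => [|i a b _ h]; first by rewrite nrm0.
by rewrite (le_trans (nrmD _ _))// lerD2l.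
Qed.

Definition nrm_cst : R := \sum_i nrm (delta_mx i 0).

Lemma nrm_cst_ge0 : 0 <= nrm_cst.
Proof. by apply: sumr_ge0 => i _; exact: nrm_ge0. Qed.

Lemma nrm_le_coord x (e : R) : (forall i, `|x i 0| <= e) -> nrm x <= nrm_cst * e.
Proof.
move=> xe; have -> : x = \sum_i (x i 0) *: delta_mx i 0.
  rewrite [LHS]matrix_sum_delta; apply: eq_bigr => i _.
  by rewrite big_ord_recl big_ord0 addr0.
apply: (le_trans (nrm_sum _)); rewrite mulr_suml; apply: ler_sum => i _.
by rewrite nrmZ mulrC ler_wpM2l// nrm_ge0.
Qed.

(** On the unit sphere of the sup norm, which is compact, the continuous function [nrm] is positive
    and attains its minimum. Vectors are transposed into rows, the form to which
    [bounded_closed_compact] applies. *)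
Lemma coord_le_nrm : exists2 c, 0 <= c & forall x i, `|x i 0| <= c * nrm x.
Proof.
pose S := [set v : 'rV[R]_d | `|v| = 1].
have clS : closed S.
  apply: (@preimage_closed _ _ (fun v : 'rV[R]_d => `|v|) [set 1 : R]).
    by move=> v _; exact: norm_continuous.
  exact: closed_eq.
have bS : bounded_set S.
  exists 1; split => // M M1 v; rewrite /S /= => ->; exact: ltW.
have cS := bounded_closed_compact bS clS.
pose N (v : 'rV[R]_d) := nrm v^T.
have coordT (v : 'rV[R]_d) i : `|v^T i 0| <= `|v|.
  rewrite mxE [leRHS]/Num.norm /= mx_normrE.
  exact: (le_bigmax _ (fun ij : 'I_1 * 'I_d => `|v ij.1 ij.2|) (0, i)).
have NL v v' : `|N v - N v'| <= nrm_cst * `|v - v'|.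
  have h (u u' : 'rV[R]_d) : N u - N u' <= nrm_cst * `|u - u'|.
    have : nrm u^T <= nrm (u - u')^T + nrm u'^T.
      by apply: le_trans (nrmD _ _); rewrite -linearD /= subrK.
    have : nrm (u - u')^T <= nrm_cst * `|u - u'| by apply: nrm_le_coord => i; exact: coordT.
    by rewrite /N; lra.
  rewrite ler_norml h andbT lerNl opprB distrC; exact: h.
have cN : continuous N.
  move=> v; apply/(@cvgrPdist_le _ _ _ (nbhs v) (nbhs_filter v) N (N v)) => e e0.
  have K0 : 0 < nrm_cst + 1 by rewrite ltr_wpDl// nrm_cst_ge0.
  have e1 : 0 < e / (nrm_cst + 1) by rewrite divr_gt0.
  have := nbhsx_ballx v _ e1; apply: filterS => u; rewrite -ball_normE /= => /ltW h.
  apply: (le_trans (NL _ _)).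
  apply: (le_trans (ler_wpM2l nrm_cst_ge0 h)).
  rewrite mulrCA ler_piMr ?(ltW e0)// ler_pdivrMr// mul1r lerDl//.
(* The sphere is empty in dimension 0 only: as soon as there is a coordinate [i], it contains the
   vector of ones. *)
have [[v0 Sv0]|S0] := pselect (S !=set0); last first.
  exists 0 => // x i; exfalso; apply: S0.
  exists (const_mx 1); rewrite /S /= /Num.norm /= mx_normrE.
  apply/eqP; rewrite eq_le; apply/andP; split.
    by apply/bigmax_leP; split => // -[a b] _ /=; rewrite mxE normr1.
  have := le_bigmax 0 (fun ij : 'I_1 * 'I_d => `|(const_mx 1 : 'rV[R]_d) ij.1 ij.2|) (0, i).
  by rewrite /= mxE normr1.
have [m Sm mmin] : exists2 m, m \in S & forall t, t \in S -> N m <= N t.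
  apply: compact_EVT_min => //; first by exists v0.
  exact: continuous_subspaceT.
have Nm : 0 < N m.
  rewrite lt_def nrm_ge0 andbT; apply/eqP => /nrm_eq0 m0.
  have m00 : m = 0 by rewrite -(trmxK m) m0 trmx0.
  by move: Sm; rewrite inE /S /= m00 normr0 => /esym/eqP; rewrite oner_eq0.
exists (N m)^-1; first by rewrite invr_ge0 ltW.
move=> x i; rewrite mulrC ler_pdivlMr//.
have [x0|x0] := eqVneq x^T 0.
  have -> : x = 0 by rewrite -(trmxK x) x0 trmx0.
  by rewrite mxE normr0 mul0r nrm_ge0.
have t0 : 0 < `|x^T| by rewrite normr_gt0.
have : N m <= N (`|x^T|^-1 *: x^T).
  apply: mmin; rewrite inE /S /= normrZ normfV normr_id mulVf//.
  by rewrite gt_eqF.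
rewrite /N linearZ /= trmxK nrmZ normfV normr_id ler_pdivlMl// => h.
apply: le_trans h; rewrite ler_pM2r//.
by have := coordT x^T i; rewrite trmxK.
Qed.

(** Banach's theorem for the norm [nrm], which is not the one that defines the topology of the
    space: the iterates converge coordinate by coordinate, and [nrm_le_coord] brings the limit back
    to [nrm]. *)
Lemma nrm_contraction_fixpoint (T : 'cV[R]_d -> 'cV[R]_d) (q : R) : 0 <= q < 1 ->
  (forall x y, nrm (T x - T y) <= q * nrm (x - y)) -> exists x, T x = x.
Proof.
move=> /andP[q0 q1] Tq; have [c c0 hc] := coord_le_nrm.
pose x k := iter k T 0; pose D := nrm (x 1%N - x 0%N).
have stp k : nrm (x k.+1 - x k) <= D * q ^+ k.
  elim: k => [|k ih]; first by rewrite mulr1.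
  rewrite exprS mulrCA; apply: le_trans (Tq _ _) _.
  by rewrite ler_wpM2l.
have cv i : cvgn (fun k => x k i 0).
  have : cvgn (series (fun k => x k.+1 i 0 - x k i 0)).
    apply: normed_cvg.
    apply: (@series_le_cvg _ _ (geometric (c * D) q)).
    - by move=> n /=.
    - by move=> n /=; rewrite mulr_ge0 ?exprn_ge0// mulr_ge0// nrm_ge0.
    - move=> n /=; have := hc (x n.+1 - x n) i; rewrite !mxE => /le_trans; apply.
      by rewrite -mulrA ler_wpM2l.
    - by apply: is_cvg_geometric_series; rewrite ger0_norm.
  move=> /cvg_ex [l hl]; apply/cvg_ex; exists (l + x 0%N i 0).
  rewrite (_ : (fun k => _) = (fun k => series (fun k => x k.+1 i 0 - x k i 0) k + x 0%N i 0)).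
    by apply: cvgD => //; exact: cvg_cst.
  by apply/funext => k; rewrite /series /= telescope_sumr// subrK.
pose l : 'cV[R]_d := \col_i limn (fun k => x k i 0).
exists l.
have e_small (e : R) : 0 < e -> \forall k \near \oo, nrm (l - x k) <= e.
  move=> e0; have K0 : 0 < nrm_cst + 1 by rewrite ltr_wpDl// nrm_cst_ge0.
  have e1 : 0 < e / (nrm_cst + 1) by rewrite divr_gt0.
  have h i : \forall k \near \oo, `|l i 0 - x k i 0| <= e / (nrm_cst + 1).
    by rewrite mxE; move/cvgrPdist_le : (cv i); apply.
  have : \forall k \near \oo, forall i, `|l i 0 - x k i 0| <= e / (nrm_cst + 1).
    by apply: filter_forall => i; exact: h.
  apply: filterS => k hk; apply: (le_trans (nrm_le_coord (e := e / (nrm_cst + 1)) _)).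
    by move=> i; have := hk i; rewrite !mxE.
  rewrite mulrCA ler_piMr ?(ltW e0)// ler_pdivrMr// mul1r lerDl//.
apply/eqP; rewrite -subr_eq0; apply/eqP/nrm_eq0/eqP; rewrite eq_le nrm_ge0 andbT.
apply/ler_addgt0Pr => e e0; rewrite add0r.
have e2 : 0 < e / 2 by rewrite divr_gt0.
near \oo => k.
have h1 : nrm (l - x k) <= e / 2 by near: k; exact: e_small.
have h2 : nrm (l - x k.+1) <= e / 2.
  near: k; have [N _ hN] := e_small _ e2; exists N => // j /= Nj.
  exact: (hN j.+1 (leqW Nj)).
have -> : T l - l = (T l - T (x k)) - (l - x k.+1) by rewrite opprB addrA subrK.
apply: (le_trans (nrmB _ _)); rewrite (splitr e) lerD//.
apply: (le_trans (Tq _ _)); apply: le_trans h1.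
by rewrite ler_piMl ?nrm_ge0 ?ltW.
Unshelve. all: by end_near. Qed.

End norm_equivalence.

(** * Jensen's inequality for an arbitrary norm *)

Section vector_mean.
Context (R : realType) (d : nat) (nrm : 'cV[R]_d -> R) (nrm_norm : is_norm nrm).
Context dT (T : measurableType dT) (mu : {measure set T -> \bar R}).
Hypothesis mu1 : mu setT = 1%E.
Variables (F : T -> 'cV[R]_d) (C : R).
Hypothesis bF : forall i, bm (fun x => F x i 0).
Hypothesis FC : forall x, nrm (F x) <= C.

Let ii f : bm f -> mu.-integrable setT (EFin \o f).
Proof. exact: bm_integrable. Qed.

Let bm_prod (I : finType) (f : I -> T -> R) : (forall i, bm (f i)) ->
  bm (fun x => \prod_i f i x).
Proof.
move=> bf; elim: (index_enum I) => [|i r ih].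
  by under eq_fun do rewrite big_nil; exact: bm_cst.
by under eq_fun do rewrite big_cons; exact: bmM.
Qed.

Let Rint_sum (I : finType) (f : I -> T -> R) : (forall i, bm (f i)) ->
  \int[mu]_x (\sum_i f i x) = \sum_i \int[mu]_x f i x.
Proof. by move=> bf; have [_] := integrable_sum (fun i => ii (bf i)). Qed.

(* The cells of a grid of mesh [eta] partition the range of [F]; replacing [F] by a
   corner of its cell turns the mean into a convex combination, up to [eta]. *)
Let mean_le_grid (eta : R) : 0 < eta ->
  nrm (\col_i \int[mu]_x F x i 0) <= C + 2 * nrm_cst nrm * eta.
Proof.
move=> e0; have [c c0 hc] := coord_le_nrm nrm_norm.
pose M := c * C; have FM x i : `|F x i 0| <= M.
  by rewrite (le_trans (hc _ _))// ler_wpM2l.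
pose K := Num.bound (2 * `|M| / eta).
have hK : 2 * `|M| < K%:R * eta.
  by rewrite -ltr_pdivrMr//; apply: archi_boundP; rewrite divr_ge0 ?mulr_ge0// ltW.
pose ind (i : 'I_d) (k : nat) x : R := \1_[set y | k%:R * eta - M <= F y i 0] x.
have bind i k : bm (ind i k).
  apply: bm_indic; have := (bF i).1 measurableT _ (measurable_itv `[(k%:R * eta - M), +oo[).
  rewrite setTI; congr measurable; apply/seteqP; split => y /=;
    by rewrite in_itv/= andbT.
have indE i k x : ind i k x = ((k%:R * eta - M <= F x i 0)%R : nat)%:R.
  by rewrite /ind indicE mem_setE.
pose a i k x := ind i k x - ind i k.+1 x.
have aP i k x : (a i k x = 0) \/ (a i k x = 1 /\ `|F x i 0 - (k%:R * eta - M)| <= eta).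
  rewrite /a !indE -natr1 mulrDl mul1r.
  case: (leP (k%:R * eta - M) (F x i 0)) => h1; case: (leP (k%:R * eta + eta - M) (F x i 0)) => h2 /=.
  - by left; rewrite subrr.
  - by right; rewrite subr0; split => //; rewrite ler_norml; apply/andP; split; lra.
  - by exfalso; lra.
  - by left; rewrite subrr.
have a_ge0 i k x : 0 <= a i k x by case: (aP i k x) => [->|[-> _]].
have asum i x : \sum_(k < K) a i k x = 1.
  have -> : \sum_(k < K) a i k x = ind i 0%N x - ind i K x.
    elim: (K) => [|k ih]; first by rewrite big_ord0 subrr.
    by rewrite big_ord_recr /= ih /a addrA subrK.
  rewrite !indE mul0r add0r.
  have := FM x i; rewrite ler_norml => /andP[h1 h2].
  rewrite h1 (_ : (K%:R * eta - M <= F x i 0) = false) ?subr0//.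
  by apply/negbTE; rewrite -ltNge; have := ler_norm M; lra.
(* A cell is a choice of one level per coordinate. Distributing the product over coordinates of the
   sums [asum] shows that the functions [chi f] form a partition of unity. *)
pose chi (f : {ffun 'I_d -> 'I_K}) x := \prod_i a i (f i) x.
have bchi f : bm (chi f) by apply: bm_prod => i; exact: bmB.
have chi_ge0 f x : 0 <= chi f x by apply: prodr_ge0 => i _; exact: a_ge0.
have chi_sum x : \sum_f chi f x = 1.
  rewrite -(bigA_distr_bigA (fun i (k : 'I_K) => a i k x)) /=.
  by rewrite big1// => i _; exact: asum.
pose g (f : {ffun 'I_d -> 'I_K}) : 'cV[R]_d := \col_i ((f i)%:R * eta - M).
have chiP f x : chi f x = 0 \/ forall i, `|F x i 0 - g f i 0| <= eta.
  have [h|/existsNP[i /contrapT h]] := pselect (forall i, a i (f i) x <> 0).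
    right => i; rewrite mxE; case: (aP i (f i) x) => [h0|[_ //]].
    by case: (h i).
  by left; rewrite /chi (bigD1 i)//= h mul0r.
pose m f := \int[mu]_x chi f x.
have m_ge0 f : 0 <= m f by apply: Rintegral_ge0 => x _.
have m_sum : \sum_f m f = 1.
  by rewrite -Rint_sum//; under eq_Rintegral do rewrite chi_sum; rewrite Rint_cst.
(* The corner of a cell inherits the bound [C] only if the range of [F] meets the cell; the other
   cells have mass zero. *)
have gC f : m f * nrm (g f) <= m f * (C + nrm_cst nrm * eta).
  have [[x hx]|nx] := pselect (exists x, chi f x != 0).
    apply: ler_wpM2l => //; case: (chiP f x) => [h|h]; first by rewrite h eqxx in hx.
    have -> : g f = F x - (F x - g f) by rewrite opprB addrC subrK.
    apply: (le_trans (nrmB nrm_norm _ _)); rewrite lerD//.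
    by apply: (nrm_le_coord nrm_norm) => i; have := h i; rewrite !mxE.
  have -> : m f = 0.
    rewrite /m -[RHS](Rint_cst mu1); apply: eq_Rintegral => x _.
    by apply: contrapT => h; apply: nx; exists x; apply/eqP.
  by rewrite !mul0r.
pose r : 'cV[R]_d := \col_i \int[mu]_x (\sum_f chi f x * (F x i 0 - g f i 0)).
have bt f i : bm (fun x => chi f x * (F x i 0 - g f i 0)).
  by apply: bmM => //; apply: bmB => //; exact: bm_cst.
have r_le i : `|r i 0| <= eta.
  rewrite mxE; apply: Rint_norm_le => //; first by case: (bm_sum (bt ^~ i)).
  move=> x; apply: (le_trans (ler_norm_sum _ _ _)).
  rewrite -[leRHS]mul1r -(chi_sum x) mulr_suml; apply: ler_sum => f _.
  rewrite normrM (ger0_norm (chi_ge0 f x)).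
  by case: (chiP f x) => [->|h]; [rewrite !mul0r|rewrite ler_wpM2l].
have -> : \col_i \int[mu]_x F x i 0 = \sum_f m f *: g f + r.
  apply/matrixP => i j; rewrite ord1 !mxE summxE.
  under [X in _ = X + _]eq_bigr do rewrite mxE.
  have -> : \sum_f m f * g f i 0 = \int[mu]_x (\sum_f g f i 0 * chi f x).
    rewrite Rint_sum; last by move=> f; exact: bmZ.
    by apply: eq_bigr => f _; rewrite RintegralZl ?ii// mulrC.
  rewrite -RintegralD//; [|by apply: ii; apply: bm_sum => f; exact: bmZ|by apply: ii; apply: bm_sum => f; exact: bt].
  apply: eq_Rintegral => x _; rewrite -big_split /=.
  under [RHS]eq_bigr do rewrite mulrC -mulrDr addrC subrK.
  by rewrite -mulr_suml chi_sum mul1r.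
apply: (le_trans (nrmD nrm_norm _ _)).
have h1 : nrm (\sum_f m f *: g f) <= C + nrm_cst nrm * eta.
  apply: (le_trans (nrm_sum nrm_norm _)).
  rewrite -[leRHS]mul1r -m_sum mulr_suml; apply: ler_sum => f _.
  by rewrite (nrmZ nrm_norm) ger0_norm.
have h2 : nrm r <= nrm_cst nrm * eta by exact: (nrm_le_coord nrm_norm).
lra.
Qed.

(** The constant is one, which matters: estimating the mean through its coordinates would cost a
    factor from the equivalence of norms and spoil the contraction factor of the mean field. *)
Lemma nrm_mean_le : nrm (\col_i \int[mu]_x F x i 0) <= C.
Proof.
apply/ler_addgt0Pr => e e0.
have K0 : 0 < 2 * nrm_cst nrm + 1 by rewrite ltr_wpDl// mulr_ge0// nrm_cst_ge0.
have e1 : 0 < e / (2 * nrm_cst nrm + 1) by rewrite divr_gt0.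
apply: (le_trans (mean_le_grid e1)); rewrite lerD2l mulrCA ler_piMr ?(ltW e0)//.
by rewrite ler_pdivrMr// mul1r lerDl.
Qed.

End vector_mean.

(** * Moment bounds *)

Section integral_domination.
Local Open Scope ereal_scope.
Context d (T : measurableType d) (R : realType) (mu : {measure set T -> \bar R}).

(* No measurability is assumed: both sides are suprema over simple functions below. *)
Lemma le_integral_ge0 (f g : T -> \bar R) : (forall x, 0 <= f x) -> (forall x, f x <= g x) ->
  \int[mu]_x f x <= \int[mu]_x g x.
Proof.
move=> f0 fg; have g0 x : 0 <= g x by exact: le_trans (fg x).
rewrite !ge0_integralTE//; apply: le_ereal_sup => _ [h hf <-].
by exists h => // x; exact: le_trans (hf x) (fg x).
Qed.

End integral_domination.

Section pexp_domination.
Context (R : realType) dX (X : measurableType dX) (P : R.-pker X ~> X).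

Lemma pexp_le_ge0 n (F G : seq X -> \bar R) : (forall s, 0 <= F s)%E ->
  (forall s, F s <= G s)%E ->
  forall x, (pexp P (@w1 R dX X) n F x <= pexp P (@w1 R dX X) n G x)%E.
Proof.
elim: n F G => [|n ih] F G F0 FG x; first exact: FG.
rewrite !pexp1S; apply: le_integral_ge0 => y; last exact: ih.
by apply: pexp_ge0 => // ? ?; exact: ler01.
Qed.

Lemma pexp_last n (f : X -> R) : bm f ->
  forall x, pexp P (@w1 R dX X) n (fun s => (f (last point s))%:E) x = (Pows P n f x)%:E.
Proof.
move=> bf; elim: n => [//|n ih] x; rewrite pexp1S PowsS.
rewrite /Pops -[in RHS]/(\int[P x]_y Pows P n f y) (EFin_kint (k := fun _ => Pows P n f)).
  apply: eq_integral => y _; rewrite -ih.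
  exact: (pexp_ext P (@w1 R dX X)).
exact/kintegrable_bm/bm_Pows.
Qed.

End pexp_domination.

(** * From moments of order p to first and second moments *)

Section moments.
Context (R : realType) dX (X : measurableType dX) (P : R.-pker X ~> X).
Context (d : nat) (nrm : 'cV[R]_d -> R) (nrm_norm : is_norm nrm).
Variables (cc : R) (p : R).
Hypotheses (cc_gt0 : 0 < cc) (cc_nrm : forall (x : 'cV[R]_d) i, `|x i 0| <= cc * nrm x).
Hypothesis p_gt2 : 2 < p.

Let p_ge0 : 0 <= p. Proof. by rewrite ltW// (lt_trans _ p_gt2). Qed.

Lemma powR_ge_lin (v : R) : 0 <= v -> v <= 1 + v `^ p.
Proof.
move=> v0; have [v1|v1] := leP v 1; first by rewrite (le_trans v1)// lerDl powR_ge0.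
apply: (@le_trans _ _ (v `^ p)); last by rewrite lerDr.
rewrite -[leLHS](powRr1 v0); apply: ler_powR; first exact: ltW.
by have := p_gt2; lra.
Qed.

Lemma powR_ge_sqr (v : R) : 0 <= v -> v ^+ 2 <= 1 + v `^ p.
Proof.
move=> v0; have [v1|v1] := leP v 1.
  by rewrite (@le_trans _ _ 1)// ?lerDl ?powR_ge0// expr_le1.
apply: (@le_trans _ _ (v `^ p)); last by rewrite lerDr.
by rewrite -powR_mulrn//; apply: ler_powR; exact: ltW.
Qed.

Lemma coord_powR_le (x : 'cV[R]_d) i : (`|x i 0| / cc) `^ p <= nrm x `^ p.
Proof.
apply: ge0_ler_powR => //; rewrite ?nnegrE ?divr_ge0 ?(ltW cc_gt0) ?(nrm_ge0 nrm_norm)//.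
by rewrite ler_pdivrMr// mulrC.
Qed.

(** The inequality [v <= 1 + v^p] is applied to the coordinate divided by [cc tau], a normalization
    under which the moment of order [p] is at most 1; hence the factor 2. The powers of [t] and
    [tau] are compared, not [t] and [tau], so that a negative [t] is covered. *)
Lemma kint_abs_le (F : X -> 'cV[R]_d) (i : 'I_d) (t tau : R) x :
  measurable_fun setT (fun z => F z i 0) ->
  (\int[P x]_z ((nrm (F z)) `^ p)%:E <= (t `^ p)%:E)%E -> t `^ p <= tau `^ p -> 0 < tau ->
  (P x).-integrable setT (fun z => (F z i 0)%:E) /\
  \int[P x]_z `|F z i 0| <= 2 * cc * tau.
Proof.
move=> mF hF ttau tau0; pose u z := `|F z i 0| / cc.
have u0 z : 0 <= u z by rewrite divr_ge0// ltW.
have mu : measurable_fun setT u by apply: measurable_funM => //; exact: measurableT_comp.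
have mup : measurable_fun setT (fun z => u z `^ p).
  exact: (measurableT_comp (measurable_powR p) mu).
have h1 : (\int[P x]_z (u z `^ p)%:E <= (tau `^ p)%:E)%E.
  apply: (@le_trans _ _ (t `^ p)%:E); last by rewrite lee_fin.
  apply: le_trans hF; apply: le_integral_ge0 => z; rewrite lee_fin ?powR_ge0//.
  exact: coord_powR_le.
have iup : (P x).-integrable setT (EFin \o (fun z => u z `^ p)).
  apply/integrableP; split; first exact/measurable_EFinP.
  under eq_integral do rewrite /= ger0_norm ?powR_ge0//.
  exact: le_lt_trans h1 (ltry _).
have h2 : \int[P x]_z (u z `^ p) <= tau `^ p.
  by rewrite -lee_fin /Rintegral fineK//; exact: integrable_fin_num.
have P1 : P x setT = 1%E by exact: prob_kernel.
pose k := cc * tau; have k0 : 0 < k by rewrite mulr_gt0.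
have dom z : `|F z i 0| <= k + k * (tau^-1 `^ p * u z `^ p).
  have := powR_ge_lin (divr_ge0 (u0 z) (ltW tau0)).
  rewrite powRM ?invr_ge0 ?(ltW tau0)// => h.
  have -> : `|F z i 0| = k * (u z / tau).
    by rewrite /k /u; field; rewrite !gt_eqF.
  rewrite -[X in _ <= X + _]mulr1 -mulrDr ler_wpM2l ?(ltW k0)// mulrC//.
  by rewrite mulrC [X in _ + X]mulrC.
have ig : (P x).-integrable setT (EFin \o (fun z => k + k * (tau^-1 `^ p * u z `^ p))).
  exact: (integrableD measurableT (bm_integrable P1 (bm_cst X k))
    (integrableZl measurableT k (integrableZl measurableT (tau^-1 `^ p) iup))).
have iF : (P x).-integrable setT (fun z => (F z i 0)%:E).
  apply: (le_integrable measurableT _ _ ig); first exact/measurable_EFinP.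
  by move=> z _ /=; rewrite lee_fin (le_trans (dom z))// ler_norm.
split => //; apply: (@le_trans _ _ (\int[P x]_z (k + k * (tau^-1 `^ p * u z `^ p)))).
  apply: le_Rintegral => //; first exact: (integrable_norm iF).
have ip2 := integrableZl measurableT (tau^-1 `^ p) iup.
rewrite RintegralD//; [|exact: (bm_integrable P1 (bm_cst X k))|exact: (integrableZl measurableT k ip2)].
rewrite Rint_cst// RintegralZl//.
rewrite RintegralZl//.
have : tau^-1 `^ p * \int[P x]_z u z `^ p <= 1.
  apply: (le_trans (ler_wpM2l (powR_ge0 _ _) h2)).
  by rewrite -powRM ?invr_ge0 ?(ltW tau0)// mulVf ?powR1// gt_eqF.
move=> h; rewrite -/k -mulrA -/k; have := ler_wpM2l (ltW k0) h; lra.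
Qed.

Variables (pi nu : probability X R) (kappa rho : R).
Hypothesis rho01 : 0 <= rho < 1.
Hypothesis ergodic : forall xi t (A : set X), measurable A ->
  `|Pows P t (fun y => \1_A y) xi - fine (pi A)| <= kappa * rho ^+ t / 2.

(** The moment bound holds along the chain from [nu], uniformly in time. Ergodicity carries it to
    [pi] for bounded truncations, with a constant independent of the truncation, and a monotone
    limit removes the truncation. *)
Lemma stationary_sqr_integrable (F : X -> 'cV[R]_d) (i : 'I_d) (C : R) :
  measurable_fun setT (fun z => F z i 0) ->
  (forall t, (chainE nu P (@w1 _ _ _) t (fun s => ((nrm (F (last point s))) `^ p)%:E) <= C%:E)%E) ->
  pi.-integrable setT (EFin \o (fun z => F z i 0 ^+ 2)).
Proof.
move=> mF hC; pose u z := `|F z i 0| / cc.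
have u0 z : 0 <= u z by rewrite divr_ge0// ltW.
have mu : measurable_fun setT u by apply: measurable_funM => //; exact: measurableT_comp.
(* As [u^2 <= 1 + u^p], subtracting 1 makes [q] at most the p-th power of the norm, so that [C]
   itself bounds its mean. *)
pose q z : R := Num.max (u z ^+ 2 - 1) 0.
have q0 z : 0 <= q z by rewrite le_max lexx orbT.
have mq : measurable_fun setT q.
  apply: measurable_maxr => //; apply: measurable_funB => //; exact: measurable_funX.
have pi1 : pi setT = 1%E by exact: probability_setT.
have nu1 : nu setT = 1%E by exact: probability_setT.
have q_le : (\int[pi]_z (q z)%:E <= C%:E)%E.
  apply: integral_trunc_le => // k; set f := (fun z => _).
  have bf : bm f by exact: bm_min.
  have f0 z : 0 <= f z by rewrite le_min q0 ler0n.
  have fk z : `|f z| <= k%:R by rewrite ger0_norm// ge_min lexx orbT.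
  apply/ler_addgt0Pr => e e0.
  have [t ht] := geom_small rho01 (k%:R * kappa) e0.
  have h1 : \int[nu]_x Pows P t f x <= C.
    rewrite -lee_fin (EFin_Rint (bm_integrable nu1 (bm_Pows P t bf))).
    apply: le_trans (hC t); apply: le_integral_ge0 => x.
      rewrite lee_fin; elim: (t) x => [|j ih] x; first exact: f0.
      by apply: Rintegral_ge0 => y _; exact: ih.
    rewrite -pexp_last//; apply: pexp_le_ge0 => s; rewrite lee_fin// /f.
    rewrite ge_min; apply/orP; left; rewrite /q ge_max powR_ge0 andbT lerBlDl.
    apply: (le_trans (powR_ge_sqr (u0 _))); rewrite lerD2l; exact: coord_powR_le.
  rewrite -[leLHS](Rint_cst nu1).
  apply: (@le_trans _ _ (\int[nu]_x (Pows P t f x + e))); last first.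
    rewrite RintegralD//; [|exact/(bm_integrable nu1)/bm_Pows|exact/(bm_integrable nu1)/bm_cst].
    by rewrite Rint_cst// lerD2r.
  apply: le_Rintegral => //.
  - exact/(bm_integrable nu1)/bm_cst.
  - by apply: (bm_integrable nu1); apply: bmD; [exact: bm_Pows|exact: bm_cst].
  - move=> x _; have := Pows_ergodic ergodic t x (ler0n R k) bf fk.
    rewrite ler_norml => /andP[h _]; move: h ht; lra.
have iq : pi.-integrable setT (EFin \o q).
  apply/integrableP; split; first exact/measurable_EFinP.
  under eq_integral do rewrite /= ger0_norm//.
  exact: le_lt_trans q_le (ltry _).
have ig : pi.-integrable setT (EFin \o (fun z => cc ^+ 2 + cc ^+ 2 * q z)).
  exact: (integrableD measurableT (bm_integrable pi1 (bm_cst X (cc ^+ 2)))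
    (integrableZl measurableT (cc ^+ 2) iq)).
apply: (le_integrable measurableT _ _ ig).
  by apply/measurable_EFinP; exact: measurable_funX.
move=> z _ /=; rewrite lee_fin ger0_norm ?sqr_ge0//.
rewrite (@le_trans _ _ (cc ^+ 2 + cc ^+ 2 * q z))//; last exact: ler_norm.
have -> : F z i 0 ^+ 2 = cc ^+ 2 * u z ^+ 2.
  rewrite /u -(real_normK (num_real (F z i 0))) expr_div_n mulrC divfK//.
  by rewrite expf_neq0// gt_eqF.
rewrite -[X in _ <= X + _]mulr1 -mulrDr ler_wpM2l ?sqr_ge0// /q.
by case: (leP (u z ^+ 2 - 1) 0) => ?; lra.
Qed.

End moments.

(** * The perturbed mean field and its root *)

Section tilted_mean_field.
Context (R : realType) dX (X : measurableType dX) (P : R.-pker X ~> X).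
Context (d : nat) (nrm : 'cV[R]_d -> R) (nrm_norm : is_norm nrm).
Variables (H : 'cV[R]_d -> X -> 'cV[R]_d) (xs : 'cV[R]_d).
Hypothesis mH : forall x i, measurable_fun setT (fun z => H x z i 0).
Variable L : R.
Hypothesis L_ge0 : 0 <= L.
Hypothesis H_lip : forall x y xi i,
  (P xi).-integrable setT (fun z => ((H x z - H y z) i 0)%:E) /\
  \int[P xi]_z `|(H x z - H y z) i 0| <= L * nrm (x - y).
Variables gamma c : R.
Hypotheses (gamma01 : 0 <= gamma < 1) (c_gt0 : 0 < c).
Hypothesis H_contr : forall x y xi,
  nrm (Pop P (fun z => H x z - H y z) xi - c *: (x - y)) <= gamma * c * nrm (x - y).

Variables (w : X -> X -> R) (a : R).
Hypotheses (jw : jmeas w) (w_ge0 : forall x y, 0 <= w x y).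
Hypothesis w_near1 : forall x y, `|w x y - 1| <= a.
Hypothesis a_ge0 : 0 <= a.
Variable mu : probability X R.
Hypothesis mu_stat : stationary P w mu.
Hypothesis imuHs : forall i, mu.-integrable setT (fun z => (H xs z i 0)%:E).

Let mu1 : mu setT = 1%E. Proof. exact: probability_setT. Qed.
Let bw : jbm w. Proof. exact: (tilt_jbm jw w_near1). Qed.

Let kiw1 f : measurable_fun setT f -> kintegrable P (fun _ => f) ->
  kintegrable P (fun x y => (w x y - 1) * f y).
Proof.
move=> mf kf; apply: (kintegrable_bounded_mul _ (jmeas_snd mf) kf).
by apply: bmB => //; exact: bm_cst.
Qed.

Lemma kint_tilt_sub f x : measurable_fun setT f -> kintegrable P (fun _ => f) ->
  kint P (fun x y => w x y * f y) x = Pops P f x + kint P (fun x y => (w x y - 1) * f y) x.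
Proof.
move=> mf kf; rewrite PopsE -kintD//; last exact: kiw1.
by apply: eq_Rintegral => y _; rewrite mulrBl mul1r addrC subrK.
Qed.

Lemma kint_sub1_le f B x : measurable_fun setT f -> kintegrable P (fun _ => f) ->
  \int[P x]_z `|f z| <= B -> `|kint P (fun x y => (w x y - 1) * f y) x| <= a * B.
Proof.
move=> mf kf fB; have k1 := kiw1 mf kf.
have kn : kintegrable P (fun _ z => `|f z|) by move=> y; exact: (integrable_norm (kf y)).
apply: (le_trans (le_normr_Rintegral measurableT (k1 x))).
apply: (@le_trans _ _ (a * \int[P x]_z `|f z|)); last exact: ler_wpM2l.
rewrite -RintegralZl//.
apply: le_Rintegral => //.
- exact: (integrable_norm (k1 x)).
- exact: (kintegrableZ (fun=> a) kn x).
- by move=> y _; rewrite normrM ler_wpM2r.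
Qed.

Lemma stationary_integrable_bounded f B : measurable_fun setT f -> kintegrable P (fun _ => f) ->
  (forall x, \int[P x]_z `|f z| <= B) -> mu.-integrable setT (EFin \o f).
Proof.
move=> mf kf fB; apply/integrableP; split; first exact/measurable_EFinP.
have mnf : measurable_fun setT (fun x => `|f x|) by exact: measurableT_comp.
have kn : kintegrable P (fun _ z => `|f z|) by move=> y; exact: (integrable_norm (kf y)).
rewrite [X in (X < _)%E](stationary_ge0 bw w_ge0 mu_stat mnf)//.
apply: (@le_lt_trans _ _ (\int[mu]_x (B + a * B)%:E)%E); last first.
  by rewrite integral_cst// [X in (_ * X)%E]mu1 mule1 ltry.
apply: le_integral_ge0 => x; first by apply: integral_ge0 => y _; rewrite lee_fin mulr_ge0.
have kw := kintegrable_bounded_mul bw (jmeas_snd mnf) kn.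
rewrite -[leLHS](EFin_kint x kw) lee_fin (kint_tilt_sub x mnf kn) lerD//; first exact: fB.
apply: (le_trans (ler_norm _)); apply: (kint_sub1_le mnf kn).
by under eq_Rintegral do rewrite normr_id.
Qed.

Section difference.
Variables (x y : 'cV[R]_d) (i : 'I_d).

Lemma measurable_Hdiff : measurable_fun setT (fun z => (H x z - H y z) i 0).
Proof.
by under eq_fun do rewrite !mxE; exact: measurable_funB.
Qed.

Lemma kintegrable_Hdiff : kintegrable P (fun _ z => (H x z - H y z) i 0).
Proof. by move=> xi; case: (H_lip x y xi i). Qed.

Lemma integrable_Hdiff : mu.-integrable setT (EFin \o (fun z => (H x z - H y z) i 0)).
Proof.
apply: (stationary_integrable_bounded measurable_Hdiff kintegrable_Hdiff
  (B := L * nrm (x - y))).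
by move=> xi; case: (H_lip x y xi i).
Qed.

End difference.

Lemma integrable_H x i : mu.-integrable setT (fun z => (H x z i 0)%:E).
Proof.
have := integrableD measurableT (integrable_Hdiff x xs i) (imuHs i).
apply: eq_integrable => // z _ /=.
by rewrite -EFinD !mxE subrK.
Qed.

Lemma gfunB x y i : (gfun mu H x - gfun mu H y) i 0 = \int[mu]_z (H x z - H y z) i 0.
Proof.
rewrite !mxE -RintegralB//; [|exact: integrable_H|exact: integrable_H].
by apply: eq_Rintegral => z _; rewrite !mxE.
Qed.

(** By stationarity the increment of the mean field is the [mu]-mean of its conditional increments.
    For each of these (A7) bounds the untilted part and the tilt adds at most [nrm_cst a L];
    [nrm_mean_le] averages the bound without loss. *)
Lemma gfun_near_linear x y :
  nrm (gfun mu H x - gfun mu H y - c *: (x - y)) <=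
    (gamma * c + nrm_cst nrm * (a * L)) * nrm (x - y).
Proof.
pose f i z := (H x z - H y z) i 0.
have mf i : measurable_fun setT (f i) by exact: measurable_Hdiff.
have kf i : kintegrable P (fun _ => f i) by exact: kintegrable_Hdiff.
pose psi xi : 'cV[R]_d := \col_i (kint P (fun x y => w x y * f i y) xi - c * (x - y) i 0).
set C := _ * nrm (x - y).
have psiC xi : nrm (psi xi) <= C.
  have -> : psi xi = (Pop P (fun z => H x z - H y z) xi - c *: (x - y)) +
      \col_i kint P (fun x y => (w x y - 1) * f i y) xi.
    apply/matrixP => i j; rewrite ord1 !mxE kint_tilt_sub//.
    by rewrite addrAC.
  apply: (le_trans (nrmD nrm_norm _ _)); rewrite /C mulrDl lerD//.
  rewrite -mulrA; apply: (nrm_le_coord nrm_norm) => i.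
  rewrite mxE -mulrA; apply: kint_sub1_le => //.
  by case: (H_lip x y xi i).
have [cc cc0 hcc] := coord_le_nrm nrm_norm.
have bpsi i : bm (fun xi => psi xi i 0).
  split; last first.
    by exists (cc * C) => xi; rewrite (le_trans (hcc _ _))// ler_wpM2l.
  under eq_fun do rewrite mxE; apply: measurable_funB => //.
  apply: measurable_kint; apply: measurable_funM => //; exact: jmeas_snd.
have := nrm_mean_le nrm_norm mu1 bpsi psiC.
congr (nrm _ <= _); apply/matrixP => i j; rewrite ord1 mxE.
have -> : (gfun mu H x - gfun mu H y - c *: (x - y)) i 0 =
   (gfun mu H x - gfun mu H y) i 0 - c * (x - y) i 0 by rewrite !mxE.
rewrite gfunB (stationary_int bw w_ge0 mu_stat (kf i) (integrable_Hdiff x y i)).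
under eq_Rintegral do rewrite mxE.
rewrite RintegralB//; first by rewrite Rint_cst.
- exact: (stationary_integrable bw w_ge0 mu_stat (kf i) (integrable_Hdiff x y i)).
- exact/bm_integrable/bm_cst.
Qed.

Hypothesis a_small : gamma * c + nrm_cst nrm * (a * L) < c.

Let q := (gamma * c + nrm_cst nrm * (a * L)) / c.

Let qc : q * c = gamma * c + nrm_cst nrm * (a * L).
Proof. by rewrite /q divfK// gt_eqF. Qed.

Lemma tilted_root_exists : exists x, is_root_of mu H x.
Proof.
have q01 : 0 <= q < 1.
  have [g0 g1] := andP gamma01.
  rewrite /q ltr_pdivrMr// mul1r a_small andbT divr_ge0 ?(ltW c_gt0)//.
  by rewrite addr_ge0// ?mulr_ge0 ?nrm_cst_ge0 ?(ltW c_gt0).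
have Tq x y : nrm (x - c^-1 *: gfun mu H x - (y - c^-1 *: gfun mu H y)) <= q * nrm (x - y).
  have -> : x - c^-1 *: gfun mu H x - (y - c^-1 *: gfun mu H y) =
      - (c^-1 *: (gfun mu H x - gfun mu H y - c *: (x - y))).
    by apply/matrixP => i j; rewrite !mxE; field; rewrite gt_eqF.
  rewrite (nrmN nrm_norm) (nrmZ nrm_norm) ger0_norm ?invr_ge0 ?(ltW c_gt0)//.
  rewrite ler_pdivrMl// mulrA (mulrC c) qc; exact: gfun_near_linear.
have [x hx] := nrm_contraction_fixpoint nrm_norm q01 Tq.
exists x => i; split; first exact: integrable_H.
have : gfun mu H x = 0.
  have : c^-1 *: gfun mu H x = 0 by rewrite -[LHS](subKr x) hx subrr.
  by move=> /eqP; rewrite scaler_eq0 invr_eq0 gt_eqF// => /eqP.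
move=> /matrixP /(_ i 0); rewrite !mxE => h.
have fi := integrable_fin_num measurableT (integrable_H x i).
by rewrite -(fineK fi); congr EFin; exact: h.
Qed.

Lemma root_gfun x : is_root_of mu H x -> gfun mu H x = 0.
Proof. by move=> h; apply/matrixP => i j; rewrite !mxE; have [_ ->] := h i. Qed.

(** At a root, [gfun_near_linear] compares [c (x - xs)] with the residual of the mean field at [xs],
    so the residual controls the distance. *)
Lemma tilted_root_dist x : is_root_of mu H x ->
  (c - (gamma * c + nrm_cst nrm * (a * L))) * nrm (x - xs) <= nrm (gfun mu H xs).
Proof.
move=> /root_gfun hx; have := gfun_near_linear x xs; rewrite hx sub0r => h.
have : c * nrm (x - xs) = nrm (c *: (x - xs)).
  by rewrite (nrmZ nrm_norm) ger0_norm// ltW.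
have e : c *: (x - xs) = - (- gfun mu H xs - c *: (x - xs)) - gfun mu H xs.
  by rewrite opprB opprK addrK.
have : nrm (c *: (x - xs)) <= nrm (- gfun mu H xs - c *: (x - xs)) + nrm (gfun mu H xs).
  rewrite {1}e -(nrmN nrm_norm (- gfun mu H xs - _)); exact: nrmB.
rewrite mulrBl; lra.
Qed.

End tilted_mean_field.

(** * First-order expansion of the perturbed roots *)

Section perturbed_roots.
Context (R : realType) dX (X : measurableType dX) (P : R.-pker X ~> X).
Context (d : nat) (nrm : 'cV[R]_d -> R) (nrm_norm : is_norm nrm).
Variables (H : 'cV[R]_d -> X -> 'cV[R]_d) (xs : 'cV[R]_d).
Hypothesis mH : forall x i, measurable_fun setT (fun z => H x z i 0).
Hypothesis iHs : forall xi i, (P xi).-integrable setT (fun z => (H xs z i 0)%:E).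
Variable L : R.
Hypothesis L_ge0 : 0 <= L.
Hypothesis H_lip : forall x y xi i,
  (P xi).-integrable setT (fun z => ((H x z - H y z) i 0)%:E) /\
  \int[P xi]_z `|(H x z - H y z) i 0| <= L * nrm (x - y).
Variables gamma c : R.
Hypotheses (gamma01 : 0 <= gamma < 1) (c_gt0 : 0 < c).
Hypothesis H_contr : forall x y xi,
  nrm (Pop P (fun z => H x z - H y z) xi - c *: (x - y)) <= gamma * c * nrm (x - y).
Variables (pi : probability X R) (kappa rho : R).
Hypothesis kappa_ge0 : 0 <= kappa.
Hypothesis rho01 : 0 <= rho < 1.
Hypothesis ergodic : forall xi t (A : set X), measurable A ->
  `|Pows P t (fun y => \1_A y) xi - fine (pi A)| <= kappa * rho ^+ t / 2.
Hypothesis pi_stat : stationary P (@w1 R dX X) pi.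
Hypothesis H_sqr : forall i, pi.-integrable setT (EFin \o (fun z => H xs z i 0 ^+ 2)).
Hypothesis bPH : forall i, bm (Pops P (fun z => H xs z i 0)).
Hypothesis g_xs : gfun pi H xs = 0.
Variables (G : 'M[R]_d) (LG deltaG : R).
Hypotheses (LG_gt0 : 0 < LG) (deltaG_gt0 : 0 < deltaG) (G_unit : G \in unitmx).
Hypothesis g_diff : forall x, nrm (x - xs) <= deltaG ->
  nrm (gfun pi H x - G *m (x - xs)) <= LG * nrm (x - xs) ^+ 2.

(** The coordinates of [U] at [xs], with the term of time 0 set apart: the rest of the series is the
    Poisson solution of the bounded function [P H]. *)
Definition Usol i z := H xs z i 0 + poisson_sol P pi (Pops P (fun y => H xs y i 0)) z.

Variable h : X -> X -> R.
Hypothesis hB : classB P h.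
(** Its [pi]-mean is the derivative at [xs] of the mean field along the perturbation [h]. *)
Definition score i := kint P (fun x y => h x y * Usol i y).
Hypothesis bscore : forall i, bm (score i).

Local Notation b n := (Num.sqrt (n%:R : R))^-1.

Let pi1 : pi setT = 1%E. Proof. exact: probability_setT. Qed.

Lemma pi_integrable_Hs i : pi.-integrable setT (fun z => (H xs z i 0)%:E).
Proof.
have i1 := integrableD measurableT (bm_integrable pi1 (bm_cst X 1)) (H_sqr i).
apply: (le_integrable measurableT _ _ i1); first exact/measurable_EFinP.
move=> z _ /=; rewrite lee_fin; apply: le_trans (ler_norm _).
rewrite -(real_normK (num_real (H xs z i 0))); set t := `| _ |.
by have := sqr_ge0 (t - 1); have := normr_ge0 (H xs z i 0); rewrite -/t; lra.
Qed.

(** The constant weight is a tilt with [a = 0], so the results on tilted mean fields apply to [pi]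
    itself. *)
Let jw1 : jmeas (@w1 R dX X). Proof. exact: measurable_cst. Qed.
Let w1_ge0 (x y : X) : 0 <= @w1 R dX X x y. Proof. exact: ler01. Qed.
Let w1_near1 (x y : X) : `|@w1 R dX X x y - 1| <= 0. Proof. by rewrite subrr normr0. Qed.

Lemma kintegrable_Usol i : kintegrable P (fun _ => Usol i).
Proof.
have [_ [M0 fM0]] := bPH i.
have fM x : `|Pops P (fun z => H xs z i 0) x| <= `|M0| by rewrite (le_trans (fM0 x))// ler_norm.
apply: kintegrableD; first by move=> x; exact: iHs.
exact/kintegrable_bm/(bm_poisson_sol kappa_ge0 rho01 ergodic (normr_ge0 M0) (bPH i) fM).
Qed.

Section fixed_time.
Variables (M : R) (n : nat).
Hypotheses (M_ge0 : 0 <= M) (hM : forall x y, `|h x y| <= M).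
Hypothesis n_gt0 : (0 < n)%N.
Hypothesis w_ge0 : forall x y, 0 <= wpert h n x y.
Variable N : nat.
Hypotheses (hN : rho ^+ N <= 4^-1) (aN : (1 + M * b n) ^+ N <= 4 / 3).
Hypothesis a_small : gamma * c + nrm_cst nrm * (M * b n * L) <= (1 + gamma) / 2 * c.
Variable mu : probability X R.
Hypothesis mu_stat : stationary P (wpert h n) mu.

Let n0 : (0 : R) < n%:R. Proof. by rewrite ltr0n. Qed.
Let b_gt0 : 0 < b n. Proof. by rewrite invr_gt0 sqrtr_gt0. Qed.
Let a_ge0 : 0 <= M * b n. Proof. by rewrite mulr_ge0// ltW. Qed.
Let jw : jmeas (wpert h n). Proof. by case: (jbm_wpert hB n). Qed.
Let w_near1 := wpert_near1 n M_ge0 hM.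
Let w_mean1 := kint_wpert hB n.

Let mu_integrable_Hs i : mu.-integrable setT (fun z => (H xs z i 0)%:E).
Proof.
exact: (stationary_integrable_of_sqr kappa_ge0 rho01 ergodic jw w_ge0 w_near1 a_ge0 mu_stat
  (mH xs i) (H_sqr i) hN aN).
Qed.

Let q_lt1 : (1 + gamma) / 2 * c < c.
Proof. by rewrite -[X in _ < X]mul1r ltr_pM2r//; case/andP: gamma01 => _ ?; lra. Qed.

Lemma perturbed_root_exists : exists x, is_root_of mu H x.
Proof.
apply: (tilted_root_exists nrm_norm mH L_ge0 H_lip gamma01 c_gt0 H_contr jw w_ge0 w_near1 a_ge0
  mu_stat mu_integrable_Hs).
exact: le_lt_trans a_small q_lt1.
Qed.

(** This is [stationary_shift] for [H xs], which has [pi]-mean zero, with [w - 1 = b h]. The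
    identity is exact; only [mu] will have to be replaced by [pi]. *)
Lemma gfun_perturbed i : gfun mu H xs i 0 = b n * \int[mu]_x score i x.
Proof.
have kf : kintegrable P (fun _ z => H xs z i 0) by move=> x; exact: iHs.
have := stationary_shift kappa_ge0 rho01 ergodic jw w_ge0 w_near1 mu_stat
  pi_stat kf (bPH i) (mu_integrable_Hs i) (pi_integrable_Hs i).
have -> : \int[pi]_x H xs x i 0 = 0 by have /matrixP/(_ i 0) := g_xs; rewrite !mxE.
rewrite subr0 mxE => e; rewrite -[LHS]/(\int[mu]_x H xs x i 0) e -RintegralZl//; last exact: (bm_integrable (probability_setT mu) (bscore i)).
apply: eq_Rintegral => x _; rewrite /score.
have [_ [M0 fM0]] := bPH i.
have fM y : `|Pops P (fun z => H xs z i 0) y| <= `|M0| by rewrite (le_trans (fM0 y))// ler_norm.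
have bu := bm_poisson_sol kappa_ge0 rho01 ergodic (normr_ge0 M0) (bPH i) fM.
have bh := classB_jbm hB.
have bw1 : jbm (fun x y => wpert h n x y - 1) by apply: bmB; [exact: (jbm_wpert hB n)|exact: bm_cst].
have k1 := kintegrable_bounded_mul bw1 (jmeas_snd (mH xs i)) kf.
have k2 := kintegrable_bounded_mul bw1 (jmeas_snd bu.1) (kintegrable_bm P bu).
rewrite -kintD//.
have mU : measurable_fun setT (Usol i) by apply: measurable_funD => //; case: bu.
rewrite -(kintZ (fun=> b n)).
  by apply: eq_Rintegral => y _; rewrite /wpert /Usol; ring.
exact: (kintegrable_bounded_mul bh (jmeas_snd mU) (kintegrable_Usol i)).
Qed.

Variables (D : R) (x : 'cV[R]_d).
Hypotheses (scoreD : forall i y, `|score i y| <= D) (x_root : is_root_of mu H x).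

(** The denominator is the gap that [a_small] leaves: the contraction factor is kept below the
    midpoint of [gamma] and 1, so the rate does not depend on [n]. *)
Definition root_rate : R := nrm_cst nrm * D / ((1 - gamma) / 2 * c).

Let gap : 0 < (1 - gamma) / 2 * c.
Proof. by rewrite mulr_gt0//; case/andP: gamma01 => _ ?; lra. Qed.

Lemma perturbed_root_dist : nrm (x - xs) <= root_rate * b n.
Proof.
have h1 : nrm (gfun mu H xs) <= nrm_cst nrm * (D * b n).
  apply: (nrm_le_coord nrm_norm) => i; rewrite gfun_perturbed normrM mulrC.
  rewrite (ger0_norm (ltW b_gt0)) ler_wpM2r ?(ltW b_gt0)//.
  by apply: Rint_norm_le => //; [exact: probability_setT|case: (bscore i)].
have h2 := tilted_root_dist nrm_norm mH H_lip c_gt0 H_contr jw w_ge0 w_near1 a_ge0 mu_stat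
  mu_integrable_Hs x_root.
rewrite /root_rate mulrAC ler_pdivlMr// mulrC -[leRHS]mulrA.
apply: le_trans (le_trans h2 h1); rewrite ler_wpM2r ?nrm_ge0//.
by move: a_small; lra.
Qed.

Hypothesis x_near : nrm (x - xs) <= deltaG.
Variable cc : R.
Hypotheses (cc_ge0 : 0 <= cc) (cc_nrm : forall (y : 'cV[R]_d) i, `|y i 0| <= cc * nrm y).

(** The first term is the cost of replacing [mu] by [pi] in the mean of [H x - H xs], the second
    that of the linearization in (A1). *)
Definition root_rem : R :=
  M * L * root_rate * mix_const kappa rho + cc * (LG * root_rate ^+ 2).

(** At the root the mean field at [xs], which is [b] times the mean score, and the [mu]-mean of
    [H x - H xs] cancel. The latter is replaced by its [pi]-mean, then by [G (x - xs)]; since the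
    root is within [O(b)] of [xs], each replacement costs [O(b^2)]. *)
Lemma perturbed_root_expansion i :
  `|(G *m (x - xs)) i 0 + b n * \int[mu]_y score i y| <= root_rem * b n ^+ 2.
Proof.
have D0 : 0 <= D.
  by have := scoreD i point; apply: le_trans.
have rr0 : 0 <= root_rate.
  by apply: divr_ge0; [rewrite mulr_ge0// (nrm_cst_ge0 nrm_norm)|exact: ltW].
have e0 := nrm_ge0 nrm_norm (x - xs).
have e1 := perturbed_root_dist.
pose f z := (H x z - H xs z) i 0.
have kf : kintegrable P (fun _ => f) by exact: (kintegrable_Hdiff H_lip x xs i).
have imuf : mu.-integrable setT (EFin \o f).
  exact: (integrable_Hdiff mH H_lip jw w_ge0 w_near1 a_ge0 mu_stat).
have ipif : pi.-integrable setT (EFin \o f).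
  exact: (integrable_Hdiff mH H_lip jw1 w1_ge0 w1_near1 (lexx 0) pi_stat).
have B0 : 0 <= L * nrm (x - xs) by rewrite mulr_ge0.
have hd : `|\int[mu]_z f z - \int[pi]_z f z| <= M * b n * (L * nrm (x - xs)) * mix_const kappa rho.
  apply: (stationary_shift_le kappa_ge0 rho01 ergodic jw w_ge0 w_near1 a_ge0 mu_stat pi_stat B0 kf) => //.
  by move=> xi; case: (H_lip x xs xi i).
have g1 : \int[mu]_z f z = - (b n * \int[mu]_y score i y).
  have := gfunB mH H_lip jw w_ge0 w_near1 a_ge0 mu_stat mu_integrable_Hs x xs i.
  by rewrite (root_gfun x_root) sub0r mxE gfun_perturbed => <-.
have g2 : \int[pi]_z f z = gfun pi H x i 0.
  have := gfunB mH H_lip jw1 w1_ge0 w1_near1 (lexx 0) pi_stat pi_integrable_Hs x xs i.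
  by rewrite g_xs subr0 => ->.
have hr : `|gfun pi H x i 0 - (G *m (x - xs)) i 0| <= cc * (LG * nrm (x - xs) ^+ 2).
  have -> : gfun pi H x i 0 - (G *m (x - xs)) i 0 = (gfun pi H x - G *m (x - xs)) i 0.
    by rewrite !mxE.
  by rewrite (le_trans (cc_nrm _ _))// ler_wpM2l// g_diff.
have -> : (G *m (x - xs)) i 0 + b n * \int[mu]_y score i y =
   - (\int[mu]_z f z - \int[pi]_z f z) - (gfun pi H x i 0 - (G *m (x - xs)) i 0).
  by rewrite g1 g2; ring.
rewrite (le_trans (ler_normB _ _))// normrN /root_rem mulrDl lerD//.
- apply: (le_trans hd).
  have m0 : 0 <= mix_const kappa rho.
    by rewrite /mix_const addr_ge0// divr_ge0//; case/andP: rho01 => _ ?; lra.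
  have : M * b n * L * mix_const kappa rho * nrm (x - xs) <= M * b n * L * mix_const kappa rho * (root_rate * b n).
    by rewrite ler_wpM2l// !mulr_ge0.
  by lra.
- apply: (le_trans hr); rewrite -(mulrA cc) -(mulrA LG) ler_wpM2l// ler_wpM2l ?(ltW LG_gt0)//.
  by rewrite -exprMn lerXn2r ?nnegrE// mulr_ge0// ltW.
Qed.

End fixed_time.

Lemma perturbed_roots_cvg : exists (pin : nat -> probability X R) (xn : nat -> 'cV[R]_d),
  (\forall n \near \oo, stationary P (wpert h n) (pin n) /\ is_root_of (pin n) H (xn n)) /\
  forall v : 'cV[R]_d,
    (fun n => Num.sqrt (n%:R) * (v^T *m (xn n - xs)) 0 0) @ \oo -->
      - \sum_i (v^T *m invmx G) 0 i * \int[pi]_x score i x.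
Proof.
have [M M0 hM] := classB_bound hB.
have [cc cc0 hcc] := coord_le_nrm nrm_norm.
have [D D0 hD] : exists2 D, 0 <= D & forall i y, `|score i y| <= D.
  have /choice[Di hDi] : forall i, exists Di, forall y, `|score i y| <= Di.
    by move=> i; case: (bscore i) => _.
  exists (\sum_i `|Di i|); first by apply: sumr_ge0.
  move=> i y; rewrite (le_trans (hDi i y))// (le_trans (ler_norm _))//.
  by rewrite (bigD1 i)//= lerDl sumr_ge0.
have [g0 g1] := andP gamma01.
have e4 : 0 < 4^-1 :> R by [].
have [N] := geom_small rho01 1 e4; rewrite mul1r => hN.
have bs (K e : R) : 0 <= K -> 0 < e -> \forall n \near \oo, K * b n <= e.
  move=> K0 e0; have K1 : 0 < K + 1 by rewrite ltr_wpDl.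
  have := invsqrt_small (divr_gt0 e0 K1); apply: filterS => n hn.
  rewrite (le_trans (ler_wpM2l K0 (ltW hn)))// mulrCA ler_piMr ?(ltW e0)//.
  by rewrite ler_pdivrMr// mul1r lerDl.
have nc0 := nrm_cst_ge0 nrm_norm.
have gap : 0 < (1 - gamma) / 2 * c by rewrite mulr_gt0//; lra.
have rr0 : 0 <= root_rate D by apply: divr_ge0; [rewrite mulr_ge0|exact: ltW].
pose good n := [/\ (0 < n)%N, forall x y, 0 <= wpert h n x y, (1 + M * b n) ^+ N <= 4 / 3,
  gamma * c + nrm_cst nrm * (M * b n * L) <= (1 + gamma) / 2 * c &
  root_rate D * b n <= deltaG /\ exists mu : probability X R, stationary P (wpert h n) mu].
have goodP : \forall n \near \oo, good n.
  near=> n; split.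
  - by near: n; exists 1%N.
  - by near: n; exact: (wpert_ge0_near hB).
  - have hb : N%:R * M * b n <= ln (4 / 3).
      by near: n; apply: bs; [rewrite mulr_ge0|rewrite ln_gt0//; lra].
    apply: (@le_trans _ _ (expR (M * b n) ^+ N)).
      apply: lerXn2r; rewrite ?nnegrE ?expR_ge0 ?expR_ge1Dx//.
      by rewrite addr_ge0// mulr_ge0// invr_ge0 sqrtr_ge0.
    rewrite -expRM_natl mulrA -[leRHS](@lnK R) ?posrE; last by lra.
    by rewrite ler_expR.
  - have hb : nrm_cst nrm * M * L * b n <= (1 - gamma) / 2 * c.
      by near: n; apply: bs => //; rewrite !mulr_ge0.
    lra.
  - split; first by near: n; exact: bs.
    by near: n; exact: (perturbed_stationary hB rho01 ergodic).
(* For the finitely many other [n] the pair [(pi, xs)] is a default, harmless since only large [n]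
   count. *)
have /choice[mx hmx] : forall n, exists mx : probability X R * 'cV[R]_d, good n ->
    stationary P (wpert h n) mx.1 /\ is_root_of mx.1 H mx.2.
  move=> n; have [gn|] := pselect (good n); last by exists (pi, xs).
  have [n1 w0 aN asm [_ [mu mus]]] := gn.
  have [x xr] := perturbed_root_exists M0 hM w0 hN aN asm mus.
  by exists (mu, x).
exists (fun n => (mx n).1), (fun n => (mx n).2); split.
  by apply: filterS goodP => n /hmx.
move=> v; pose l i := (v^T *m invmx G) 0 i.
(* Multiplied by [sqrt n], the remainder [root_rem b^2] becomes [root_rem b]; the second term is the
   cost, also of order [b], of replacing [mu] by [pi] in the mean score. *)
pose C := \sum_i `|l i| * (root_rem M D cc + M * D * mix_const kappa rho).
apply/cvgrPdist_le => e e0.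
have m0 : 0 <= mix_const kappa rho.
  by rewrite /mix_const addr_ge0// divr_ge0//; case/andP: rho01 => _ ?; lra.
have C0 : 0 <= C.
  apply: sumr_ge0 => i _; apply: mulr_ge0 => //; apply: addr_ge0; last first.
    exact: mulr_ge0 (mulr_ge0 M0 D0) m0.
  apply: addr_ge0; first exact: mulr_ge0 (mulr_ge0 (mulr_ge0 M0 L_ge0) rr0) m0.
  exact: mulr_ge0 cc0 (mulr_ge0 (ltW LG_gt0) (sqr_ge0 _)).
near=> n; have gn : good n by near: n.
have [n1 w0 aN asm [rd _]] := gn; have [mus xr] := hmx n gn.
apply: (@le_trans _ _ (C * b n)); last by near: n; exact: bs.
set x := (mx n).2 in xr *; set mu := (mx n).1 in mus xr.
have n0 : (0 : R) < n%:R by rewrite ltr0n.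
have s0 : 0 < Num.sqrt (n%:R : R) by rewrite sqrtr_gt0.
have dst := perturbed_root_dist M0 hM n1 w0 hN aN asm mus hD xr.
have xd : nrm (x - xs) <= deltaG by exact: le_trans dst rd.
have expn := perturbed_root_expansion M0 hM n1 w0 hN aN asm mus hD xr xd cc0 hcc.
have vE : (v^T *m (x - xs)) 0 0 = \sum_i l i * (G *m (x - xs)) i 0.
  have -> : v^T *m (x - xs) = v^T *m invmx G *m (G *m (x - xs)).
    by rewrite mulmxA mulmxKV.
  by rewrite mxE.
have -> : - \sum_i (v^T *m invmx G) 0 i * \int[pi]_x0 score i x0 -
    Num.sqrt n%:R * (v^T *m (x - xs)) 0 0 =
  - \sum_i l i * (Num.sqrt n%:R * ((G *m (x - xs)) i 0 + b n * \int[mu]_y score i y) -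
      (\int[mu]_y score i y - \int[pi]_y score i y)).
  rewrite vE mulr_sumr -opprD -big_split /=; congr (- _); apply: eq_bigr => i _.
  have -> : Num.sqrt n%:R * ((G *m (x - xs)) i 0 + b n * \int[mu]_y score i y) =
      Num.sqrt n%:R * (G *m (x - xs)) i 0 + \int[mu]_y score i y.
    by rewrite mulrDr mulVKf// gt_eqF.
  rewrite -/(l i); ring.
rewrite normrN; apply: (le_trans (ler_norm_sum _ _ _)).
rewrite /C mulr_suml; apply: ler_sum => i _.
rewrite normrM -mulrA ler_wpM2l// (le_trans (ler_normB _ _))// mulrDl lerD//.
  rewrite normrM (ger0_norm (ltW s0)) -ler_pdivlMl// mulrCA -expr2.
  exact: expn.
have ks : kintegrable P (fun _ => score i) by exact: kintegrable_bm.
have imu : mu.-integrable setT (EFin \o score i) by exact: (bm_integrable (probability_setT mu)).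
have a0 : 0 <= M * b n by rewrite mulr_ge0// invr_ge0 sqrtr_ge0.
have := stationary_shift_le kappa_ge0 rho01 ergodic (jbm_wpert hB n).1 w0 (wpert_near1 n M0 hM) a0
  mus pi_stat D0 ks _ imu (bm_integrable pi1 (bscore i)).
move=> H0; apply: le_trans (H0 _) _; last by rewrite le_eqVlt; apply/orP; left; apply/eqP; ring.
move=> y; apply: (le_trans (ler_norm _)); apply: kint_le_bound.
  by apply: jmeas_snd; apply: measurableT_comp => //; case: (bscore i).
by move=> ? z; rewrite normr_id.
Unshelve. all: by end_near. Qed.

End perturbed_roots.

(** * The Chapman-Robbins bound for regular estimators *)

Section clamp.
Context (R : realType).
Implicit Types K s t : R.

Definition clamp K t : R := Num.max (- K) (Num.min K t).

Lemma clampP K t : 0 <= K ->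
  [\/ t <= - K /\ clamp K t = - K, `|t| <= K /\ clamp K t = t | K <= t /\ clamp K t = K].
Proof.
move=> K0; rewrite /clamp; have [h1|h1] := leP K t.
  by apply: Or33; split => //; apply/max_idPr; lra.
have [h2|h2] := leP (- K) t; last by apply: Or31; split => //; exact: ltW.
by apply: Or32; split => //; rewrite ler_norml h2 ltW.
Qed.

Lemma clamp_lip K s t : 0 <= K -> `|clamp K s - clamp K t| <= `|s - t|.
Proof.
move=> K0; have h1 := ler_norm (s - t); have h2 := ler_norm (- (s - t)); rewrite normrN in h2.
have h3 := normr_ge0 (s - t); rewrite ler_norml.
case: (clampP s K0) => -[+ ->]; case: (clampP t K0) => -[+ ->];
  rewrite ?ler_norml; do ?[move=> /andP[? ?]|move=> ?]; apply/andP; split; lra.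
Qed.

Lemma clamp_norm_le K t : 0 <= K -> `|clamp K t| <= K.
Proof.
by move=> K0; case: (clampP t K0) => -[h ->] //; rewrite ?normrN ger0_norm.
Qed.

Lemma clamp_sqr_le K t : 0 <= K -> clamp K t ^+ 2 <= t ^+ 2.
Proof.
move=> K0; case: (clampP t K0) => -[h ->] //; last by rewrite lerXn2r ?nnegrE// (le_trans K0).
by rewrite [X in X <= _]sqrrN -[X in _ <= X]sqrrN lerXn2r ?nnegrE//; lra.
Qed.

Lemma clamp_id K t : `|t| <= K -> clamp K t = t.
Proof.
move=> tK; have K0 : 0 <= K by exact: le_trans (normr_ge0 t) tK.
by move: tK; rewrite ler_norml; case: (clampP t K0) => -[h ->] // /andP[? ?]; lra.
Qed.

End clamp.

Lemma cvg_finsum (R : realType) (T : Type) (F : set_system T) (FF : Filter F) (I : finType)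
    (f : I -> T -> R) (l : I -> R) : (forall i, f i @ F --> l i) ->
  (fun x => \sum_i f i x) @ F --> \sum_i l i.
Proof.
move=> fl; elim: (index_enum I) => [|i r ih].
  by under eq_fun do rewrite big_nil; rewrite big_nil; exact: cvg_cst.
by under eq_fun do rewrite big_cons; rewrite big_cons; exact: cvgD.
Qed.

Section chapman_robbins.
Context (R : realType) dX (X : measurableType dX) (nu : probability X R) (P : R.-pker X ~> X).

Lemma lik_ge0 (w : X -> X -> R) s : (forall x y, 0 <= w x y) -> 0 <= lik w s.
Proof.
by move=> w0; elim: s => [//|x s ih] /=; rewrite mulr_ge0//; case: s {ih}.
Qed.

(* This is [2 a F (lik - 1) <= F^2 + a^2 (lik - 1)^2], integrated. *)
Lemma chapman_robbins (w : X -> X -> R) n (F : seq X -> R) (K a : R) : jbm w ->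
  (forall x, kint P w x = 1) -> smeas n F -> (forall s, `|F s| <= K) ->
  2 * a * (fine (chainE nu P w n (EFin \o F)) - cE nu P n F) <=
    cE nu P n (fun s => F s ^+ 2) + a ^+ 2 * (cE nu P n (fun s => lik w s ^+ 2) - 1).
Proof.
move=> bw wm mF FK; have sF : sbound n F K by move=> p.
have sb G B : smeas n G -> (forall s, `|G s| <= B) -> cint nu P n G.
  by move=> mG GB; apply: (cint_sbound nu P mG (M := B)) => p.
have cl := cint_lik nu P n bw.
have ml : smeas n (lik w) by case: cl.
have cF := cint_sbound nu P mF sF.
have cF2 : cint nu P n (fun s => F s ^+ 2).
  apply: (sb _ (K ^+ 2)); first exact: smeasM.
  by move=> s; rewrite normrX lerXn2r ?nnegrE// (le_trans _ (FK s)).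
have [jw [W wW]] := bw.
have bl := sbound_lik (n := n) (fun x y => wW (x, y)).
have clF : cint nu P n (fun s => lik w s * F s).
  apply: (cint_sbound nu P (smeasM ml mF) (M := W ^+ n * K)) => p.
  by rewrite normrM ler_pM// bl.
have cl2 : cint nu P n (fun s => lik w s ^+ 2).
  apply: (cint_sbound nu P (smeasM ml ml) (M := W ^+ n * W ^+ n)) => p.
  by rewrite normrM ler_pM//; exact: bl.
have c1 : cint nu P n (fun=> 1) by apply: (sb _ 1); [exact: smeas_cst|move=> s; rewrite normr1].
rewrite (chainE_lik nu P bw mF sF).
have <- : cE nu P n (fun s => 2 * a * (lik w s * F s + (- 1) * F s)) =
    2 * a * (cE nu P n (fun s => lik w s * F s) - cE nu P n F).
  rewrite cEZ; last by apply: cintD => //; exact: cintZ.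
  by rewrite cED ?cEZ ?mulN1r//; exact: cintZ.
have <- : cE nu P n (fun s => F s ^+ 2 + (a ^+ 2 * (lik w s ^+ 2) +
     ((- (2 * a ^+ 2)) * lik w s + a ^+ 2 * 1))) =
   cE nu P n (fun s => F s ^+ 2) + a ^+ 2 * (cE nu P n (fun s => lik w s ^+ 2) - 1).
  have i1 := cintZ (- (2 * a ^+ 2)) cl; have i2 := cintZ (a ^+ 2) c1.
  have i3 := cintZ (a ^+ 2) cl2; have i4 := cintD i1 i2.
  rewrite cED//; last exact: cintD.
  rewrite cED// cED// !cEZ// (cE_lik1 nu n bw wm) cE_cst; ring.
apply: cE_le.
- by apply: cintZ; apply: cintD => //; exact: cintZ.
- by apply: cintD => //; apply: cintD; [exact: cintZ|apply: cintD; exact: cintZ].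
- by move=> s; have := sqr_ge0 (F s - a * (lik w s - 1)); lra.
Qed.

End chapman_robbins.

(** * Passage to the limit for a regular estimator *)

Section regular_lower_bound.
Context (R : realType) dX (X : measurableType dX) (nu : probability X R) (P : R.-pker X ~> X).
Variables (d : nat) (T : nat -> seq X -> 'cV[R]_d) (xs : 'cV[R]_d).
Hypothesis T_meas : estimator_measurable T.
Variable Lim : probability (borelT 'cV[R]_d) R.
Hypothesis conv0 : conv_dist nu P (wpert (fun _ _ => 0))
  (fun n s => Num.sqrt (n%:R) *: (T n s - xs)) Lim.
Variable M : 'M[R]_d.
Hypothesis M_finite : forall i, \forall n \near \oo,
  (chainE nu P (@w1 _ _ _) n (fun s => (((T n s - xs) i 0) ^+ 2)%:E) < +oo)%E.
Hypothesis M_lim : forall i j,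
  (fun n => n%:R * fine (chainE nu P (@w1 _ _ _) n
     (fun s => ((T n s - xs) i 0 * (T n s - xs) j 0)%:E))) @ \oo --> M i j.

Variable v : 'cV[R]_d.

Local Notation dot y := ((v^T *m y) 0 0).

Let dotE (y : 'cV[R]_d) : dot y = \sum_i v i 0 * y i 0.
Proof. by rewrite mxE; apply: eq_bigr => i _; rewrite mxE. Qed.

Let dotD (y z : 'cV[R]_d) : dot (y + z) = dot y + dot z.
Proof. by rewrite mulmxDr mxE. Qed.

Let dotZ k (y : 'cV[R]_d) : dot (k *: y) = k * dot y.
Proof. by rewrite -scalemxAr mxE. Qed.

Let smeas_coord n i y : smeas n (fun s => (T n s - y) i 0).
Proof.
have -> : (fun s => (T n s - y) i 0) = (fun s => T n s i 0 - y i 0).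
  by apply/funext => s; rewrite !mxE.
by apply: smeasB; [exact: T_meas|exact: smeas_cst].
Qed.

Let smeas_dot n y : smeas n (fun s => dot (T n s - y)).
Proof.
have -> : (fun s => dot (T n s - y)) = (fun s => \sum_i v i 0 * (T n s - y) i 0).
  by apply/funext => s; rewrite dotE.
by apply: smeas_sum => i; apply: smeasM; [exact: smeas_cst|exact: smeas_coord].
Qed.

Definition quad_form : R := (v^T *m M *m v) 0 0.

(** Finite second moments of the coordinates make all their products integrable, through
    [|x y| <= x^2 + y^2]. Only then does the quadratic form expand into the expectations whose
    limits are the entries of [M]. *)
Lemma second_moment_cvg : exists u : nat -> R, u @ \oo --> quad_form /\
  \forall n \near \oo, cint nu P n (fun s => dot (T n s - xs) ^+ 2) /\
    n%:R * cE nu P n (fun s => dot (T n s - xs) ^+ 2) = u n.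
Proof.
pose m i j n := cE nu P n (fun s => (T n s - xs) i 0 * (T n s - xs) j 0).
exists (fun n => \sum_i \sum_j v i 0 * v j 0 * (n%:R * m i j n)); split.
  have -> : quad_form = \sum_i \sum_j v i 0 * v j 0 * M i j.
    rewrite /quad_form mxE exchange_big /=; apply: eq_bigr => j _.
    rewrite mxE mulr_suml; apply: eq_bigr => i _.
    by rewrite mxE; ring.
  apply: cvg_finsum => i; apply: cvg_finsum => j; apply: cvgMr; exact: M_lim.
have : \forall n \near \oo, forall i,
    (chainE nu P (@w1 _ _ _) n (fun s => (((T n s - xs) i 0) ^+ 2)%:E) < +oo)%E.
  exact: filter_forall.
apply: filterS => n fin.
have c2 i : cint nu P n (fun s => (T n s - xs) i 0 ^+ 2).
  apply: cint_ge0; [|by move=> s; exact: sqr_ge0|exact: fin].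
  have mc := @smeas_coord n i xs; exact: (smeasM mc mc).
have cij i j : cint nu P n (fun s => (T n s - xs) i 0 * (T n s - xs) j 0).
  apply: (cint_dom _ _ (cintD (c2 i) (c2 j))).
    exact: (smeasM (@smeas_coord n i xs) (@smeas_coord n j xs)).
  move=> p; set s := tolist p; rewrite normrM.
  rewrite -(real_normK (num_real ((T n s - xs) i 0))) -(real_normK (num_real ((T n s - xs) j 0))).
  set x := `| _ |; set y := `|(T n s - xs) j 0|.
  have := sqr_ge0 (x - y); have := sqr_ge0 x; have := sqr_ge0 y; lra.
have e : (fun s => dot (T n s - xs) ^+ 2) = (fun s => \sum_i \sum_j
    (v i 0 * v j 0) * ((T n s - xs) i 0 * (T n s - xs) j 0)).
  apply/funext => s; rewrite dotE expr2 mulr_suml; apply: eq_bigr => i _.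
  by rewrite mulr_sumr; apply: eq_bigr => j _; ring.
rewrite e; split.
  by apply: cint_sum => i; apply: cint_sum => j; exact: cintZ.
rewrite cE_sum; last by move=> i; apply: cint_sum => j; exact: cintZ.
rewrite mulr_sumr; apply: eq_bigr => i _; rewrite cE_sum; last by move=> j; exact: cintZ.
by rewrite mulr_sumr; apply: eq_bigr => j _; rewrite cEZ// mulrCA.
Qed.

Let continuous_clamp_dot K b : 0 <= K -> continuous (fun y : 'cV[R]_d => clamp K (dot y + b)).
Proof.
move=> K0; have cd : continuous (fun y : 'cV[R]_d => dot y).
  have -> : (fun y : 'cV[R]_d => dot y) = (fun y => \sum_i v i 0 * y i 0).
    by apply/funext => y; rewrite dotE.
  move=> y.
  apply: (cvg_finsum (nbhs_filter y)) => i; apply: (@cvgMr _ _ (nbhs y)); exact: coord_continuous.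
have cc : continuous (clamp K).
  move=> t; apply/cvgrPdist_lt => e e0.
  have := nbhsx_ballx t _ e0; apply: filterS => s; rewrite -ball_normE /=.
  by apply: le_lt_trans; exact: clamp_lip.
have cdb : continuous (fun y : 'cV[R]_d => dot y + b).
  by move=> y; apply: (@continuousD _ _ _ (fun y : 'cV[R]_d => dot y) (fun=> b) y);
    [exact: cd|exact: cst_continuous].
by move=> y; apply: (@continuous_comp _ _ _ (fun y : 'cV[R]_d => dot y + b) (clamp K) y);
  [exact: cdb|exact: cc].
Qed.

Let measurable_clamp_dot K b : 0 <= K ->
  measurable_fun (setT : set (borelT 'cV[R]_d)) (fun y => clamp K (dot y + b)).
Proof.
move=> K0; apply: (measurability _ (RGenOpens.measurableE R)).
move=> _ [_ [x [y ->]] <-]; rewrite setTI; apply: sub_sigma_algebra.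
by move/continuousP : (@continuous_clamp_dot K b K0); apply; exact: interval_open.
Qed.

Variable h : X -> X -> R.
Hypothesis hB : classB P h.
Variables (xn : nat -> 'cV[R]_d) (beta : R).
Hypothesis convh : conv_dist nu P (wpert h)
  (fun n s => Num.sqrt (n%:R) *: (T n s - xn n)) Lim.
Hypothesis xn_rate : (fun n => Num.sqrt (n%:R) * dot (xn n - xs)) @ \oo --> - beta.

Variables (kbar : R) (u : nat -> R).
Hypothesis u_cvg : u @ \oo --> expR kbar.
Hypothesis lik_le : forall n, (0 < n)%N -> cE nu P n (fun s => lik (wpert h n) s ^+ 2) <= u n.

(* The same law [Lim] appears on both sides of the inequality, shifted by [beta] under
   the perturbed chain; the clamp makes the functional bounded, as [conv_dist] requires,
   and is removed at the end by letting [K] tend to infinity. *)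
Lemma clamped_lower_bound K a : 0 <= K ->
  2 * a * (\int[Lim]_y clamp K (dot y - beta) - \int[Lim]_y clamp K (dot y + 0)) <=
    quad_form + a ^+ 2 * (expR kbar - 1).
Proof.
move=> K0.
pose F n s := clamp K (Num.sqrt n%:R * dot (T n s - xs)).
have FK n s : `|F n s| <= K by exact: clamp_norm_le.
have mclamp : measurable_fun setT (clamp K).
  by apply: measurable_maxr => //; exact: measurable_minr.
have mF n : smeas n (F n).
  apply: (measurableT_comp mclamp); apply: measurable_funM => //; exact: smeas_dot.
have bd b : exists B, forall y : 'cV[R]_d, `|clamp K (dot y + b)| <= B.
  by exists K => y; exact: clamp_norm_le.
have lim0 : (fun n => cE nu P n (F n)) @ \oo --> \int[Lim]_y clamp K (dot y + 0).
  have c0 := conv0 (@continuous_clamp_dot K 0 K0) (bd 0).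
  suff e : (fun n => cE nu P n (F n)) = (fun n => fine (chainE nu P (wpert (fun _ _ : X => 0) n) n
      (fun s => (clamp K (dot (Num.sqrt n%:R *: (T n s - xs)) + 0))%:E))).
    by rewrite e; exact: c0.
  apply/funext => n; rewrite /cE.
  by rewrite wpert0; congr (fine (chainE _ _ _ _ _)); apply/funext => s /=; rewrite dotZ addr0.
(* Regularity centers at [xn n], the functional [F n] at [xs]. The two centerings differ by a
   deterministic amount tending to [- beta], and the clamp is 1-Lipschitz, so the functionals differ
   by at most [e] uniformly over the samples. *)
have limh : (fun n => fine (chainE nu P (wpert h n) n (EFin \o F n))) @ \oo -->
    \int[Lim]_y clamp K (dot y - beta).
  have c1 := convh (@continuous_clamp_dot K (- beta) K0) (bd (- beta)).
  rewrite -[X in _ --> X]addr0; pose G n s := clamp K (dot (Num.sqrt (n%:R) *: (T n s - xn n)) - beta).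
  have -> : (fun n => fine (chainE nu P (wpert h n) n (EFin \o F n))) =
      (fun n => fine (chainE nu P (wpert h n) n (EFin \o G n)) +
       (fine (chainE nu P (wpert h n) n (EFin \o F n)) - fine (chainE nu P (wpert h n) n (EFin \o G n)))).
    by apply/funext => n; rewrite addrC subrK.
  apply: cvgD; first exact: c1.
  apply/cvgr0Pnorm_le => e e0; near=> n.
  have bw := jbm_wpert hB n; have w0 : forall x y, 0 <= wpert h n x y by near: n; exact: (wpert_ge0_near hB).
  have te : `|- beta - Num.sqrt n%:R * dot (xn n - xs)| <= e.
    by near: n; move/cvgrPdist_le : xn_rate; apply.
  have mG : smeas n (G n).
    have -> : G n = (fun s => clamp K (Num.sqrt n%:R * dot (T n s - xn n) - beta)).
      by apply/funext => s; rewrite /G dotZ.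
    apply: (measurableT_comp mclamp); apply: measurable_funB => //.
    by apply: measurable_funM => //; exact: smeas_dot.
  have sG : sbound n (G n) K by move=> p; exact: clamp_norm_le.
  have sF : sbound n (F n) K by move=> p; exact: FK.
  rewrite (chainE_lik nu P bw (mF n) sF) (chainE_lik nu P bw mG sG).
  have cl := cint_lik nu P n bw; have ml : smeas n (lik (wpert h n)) by case: cl.
  have [_ [W wW]] := bw; have bl := sbound_lik (n := n) (fun x y => wW (x, y)).
  have clb Z : smeas n Z -> sbound n Z K -> cint nu P n (fun s => lik (wpert h n) s * Z s).
    move=> mZ sZ; apply: (cint_sbound nu P (smeasM ml mZ) (M := W ^+ n * K)) => p.
    by rewrite normrM ler_pM//; exact: bl.
  have cF := clb _ (mF n) sF; have cG := clb _ mG sG.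
  have FG s : `|F n s - G n s| <= e.
    apply: (le_trans (clamp_lip _ _ K0)); apply: le_trans te.
    have -> : T n s - xs = (T n s - xn n) + (xn n - xs) by rewrite addrA subrK.
    by rewrite dotD dotZ -normrN; rewrite le_eqVlt; apply/orP; left; apply/eqP; congr (`| _ |); ring.
  have dle (Z1 Z2 : seq X -> R) : (forall s, Z1 s - Z2 s <= e) ->
      cint nu P n (fun s => lik (wpert h n) s * Z1 s) ->
      cint nu P n (fun s => lik (wpert h n) s * Z2 s) ->
      cE nu P n (fun s => lik (wpert h n) s * Z1 s) <= cE nu P n (fun s => lik (wpert h n) s * Z2 s) + e.
    move=> hZ c1' c2'; rewrite -[X in _ + X]mulr1 -(cE_lik1 nu n bw (kint_wpert hB n)) -cEZ// -cED//; last exact: cintZ.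
    apply: cE_le => //; first by apply: cintD => //; exact: cintZ.
    move=> s; rewrite (mulrC e) -mulrDr ler_wpM2l ?lik_ge0//.
    by have := hZ s; lra.
  have h1 : cE nu P n (fun s => lik (wpert h n) s * F n s) <= cE nu P n (fun s => lik (wpert h n) s * G n s) + e.
    by apply: dle => // s; have := FG s; rewrite ler_norml => /andP[].
  have h2 : cE nu P n (fun s => lik (wpert h n) s * G n s) <= cE nu P n (fun s => lik (wpert h n) s * F n s) + e.
    by apply: dle => // s; have := FG s; rewrite ler_norml => /andP[? ?]; lra.
  by rewrite ler_norml; apply/andP; split; lra.
have [m [mcv mn]] := second_moment_cvg.
have limL : (fun n => 2 * a * (fine (chainE nu P (wpert h n) n (EFin \o F n)) - cE nu P n (F n))) @ \oo -->
   2 * a * (\int[Lim]_y clamp K (dot y - beta) - \int[Lim]_y clamp K (dot y + 0)).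
  by apply: cvgMr; exact: cvgB.
have limR : (fun n => m n + a ^+ 2 * (u n - 1)) @ \oo --> quad_form + a ^+ 2 * (expR kbar - 1).
  by apply: cvgD => //; apply: cvgMr; apply: cvgB => //; exact: cvg_cst.
apply: (ler_cvg_to limL limR); near=> n.
have n_gt0 : (0 < n)%N by near: n; exists 1%N.
have [cd ecd] : cint nu P n (fun s => dot (T n s - xs) ^+ 2) /\
    n%:R * cE nu P n (fun s => dot (T n s - xs) ^+ 2) = m n by near: n.
apply: (le_trans (chapman_robbins nu a (jbm_wpert hB n) (kint_wpert hB n) (mF n) (FK n))).
apply: lerD; last by rewrite ler_wpM2l ?sqr_ge0// lerD2r lik_le.
rewrite -ecd -cEZ//; apply: cE_le; last first.
- move=> s; apply: (le_trans (clamp_sqr_le _ K0)).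
  by rewrite exprMn sqr_sqrtr.
- exact: cintZ.
- apply: (cint_sbound nu P (smeasM (mF n) (mF n)) (M := K * K)) => p.
  by rewrite normrM ler_pM//; exact: FK.
Unshelve. all: by end_near. Qed.

(** Neither clamped mean is known to converge as [K] grows, but the difference of the clamped
    functions is bounded by [|beta|] for every [K], so dominated convergence yields the full shift
    [- beta]. *)
Lemma regular_lower_bound a : - (2 * a * beta) <= quad_form + a ^+ 2 * (expR kbar - 1).
Proof.
have L1 : Lim setT = 1%E by exact: probability_setT.
have bc K b : 0 <= K -> bm (fun y : borelT 'cV[R]_d => clamp K (dot y + b)).
  by move=> K0; split; [exact: measurable_clamp_dot|exists K => y; exact: clamp_norm_le].
have c1 : (fun k : nat => \int[Lim]_y (clamp k%:R (dot y - beta) - clamp k%:R (dot y + 0))) @ \oo -->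
    \int[Lim]_y (fun=> - beta) y.
  apply: (@Rint_dct _ _ _ Lim (fun (k : nat) y => clamp k%:R (dot y - beta) - clamp k%:R (dot y + 0)) _ (fun=> `|beta|)).
  - by move=> k; apply: measurable_funB; exact: measurable_clamp_dot.
  - exact: measurable_cst.
  - move=> y; apply: cvg_near_cst; exists (Num.bound (`|dot y| + `|beta|)) => // k /= hk.
    have hk' : `|dot y| + `|beta| <= k%:R.
      by rewrite (le_trans (ltW (archi_boundP _)))// ?addr_ge0// ler_nat.
    rewrite !clamp_id; first ring.
    + by rewrite addr0 (le_trans _ hk')// lerDl.
    + by rewrite (le_trans (ler_normB _ _)).
  - exact/(bm_integrable L1)/bm_cst.
  - move=> k y; apply: (le_trans (clamp_lip _ _ (ler0n _ _))).
    by rewrite addr0 addrAC subrr sub0r normrN.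
rewrite Rint_cst// in c1.
have c2 : (fun k : nat => 2 * a * (\int[Lim]_y (clamp k%:R (dot y - beta) - clamp k%:R (dot y + 0)))) @ \oo -->
    2 * a * - beta by apply: cvgMr.
rewrite -mulrN -(cvg_lim _ c2)//; apply: limr_le; first by apply/cvg_ex; eexists; exact: c2.
apply: nearW => k; rewrite RintegralB//; last first.
- exact/(bm_integrable L1)/bc.
- exact/(bm_integrable L1)/bc.
exact: clamped_lower_bound.
Qed.

End regular_lower_bound.

(** * The least favorable perturbation *)

Section finite_combinations.
Context (R : realType) dX (X : measurableType dX) (d : nat) (l : 'I_d -> R).

Lemma integrable_lin (mu : {measure set X -> \bar R}) (F : 'I_d -> X -> R) :
  (forall i, mu.-integrable setT (EFin \o F i)) ->
  mu.-integrable setT (EFin \o (fun z => \sum_i l i * F i z)) /\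
  \int[mu]_z (\sum_i l i * F i z) = \sum_i l i * \int[mu]_z F i z.
Proof.
move=> iF; have h i := integrableZl measurableT (l i) (iF i).
have [iS ->] := integrable_sum h; split=> //.
by apply: eq_bigr => i _; rewrite RintegralZl.
Qed.

Lemma bm_lin (F : 'I_d -> X -> R) : (forall i, bm (F i)) -> bm (fun z => \sum_i l i * F i z).
Proof. by move=> bF; apply: bm_sum => i; exact: bmZ. Qed.

Lemma sqr_sum_le (a : 'I_d -> R) : (\sum_i a i) ^+ 2 <= d%:R * \sum_i a i ^+ 2.
Proof.
have -> : (\sum_i a i) ^+ 2 = \sum_i \sum_j a i * a j.
  by rewrite expr2 mulr_suml; apply: eq_bigr => i _; rewrite mulr_sumr.
have e : d%:R * \sum_i a i ^+ 2 = \sum_i \sum_j (a i ^+ 2 + a j ^+ 2) / 2.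
  transitivity (\sum_i (d%:R * (a i ^+ 2 / 2) + \sum_j a j ^+ 2 / 2)).
    rewrite big_split /= sumr_const card_ord -mulr_sumr -mulr_suml -[X in _ + X]mulr_natl.
    lra.
  apply: eq_bigr => i _; transitivity (\sum_j (a i ^+ 2 / 2 + a j ^+ 2 / 2)).
    by rewrite big_split /= sumr_const card_ord mulr_natl.
  by apply: eq_bigr => j _; rewrite mulrDl.
rewrite e; apply: ler_sum => i _; apply: ler_sum => j _.
by have := sqr_ge0 (a i - a j); lra.
Qed.

End finite_combinations.

Section optimal_direction.
Context (R : realType) dX (X : measurableType dX) (P : R.-pker X ~> X).
Variables (pi : probability X R) (d : nat) (U : 'I_d -> X -> R) (l : 'I_d -> R).
Hypothesis pi_stat : stationary P (@w1 R dX X) pi.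
Hypothesis mU : forall i, measurable_fun setT (U i).
Hypothesis kU : forall i, kintegrable P (fun _ => U i).
Hypothesis bPU : forall i, bm (Pops P (U i)).
Hypothesis U_sqr : forall i, pi.-integrable setT (EFin \o (fun z => U i z ^+ 2)).

Let pi1 : pi setT = 1%E. Proof. exact: probability_setT. Qed.
Let ipi f : bm f -> pi.-integrable setT (EFin \o f). Proof. exact: bm_integrable. Qed.

Let m z : R := \sum_i l i * U i z.

Let mm : measurable_fun setT m.
Proof.
by apply: measurable_sum => i; apply: measurable_funM => //; exact: measurable_cst.
Qed.

Let km : kintegrable P (fun _ => m).
Proof. by move=> x; have [] := integrable_lin l (fun i => kU i x). Qed.

Let PmE x : Pops P m x = \sum_i l i * Pops P (U i) x.
Proof. by have [_] := integrable_lin l (fun i => kU i x). Qed.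

Let bPm : bm (Pops P m).
Proof. by rewrite (funext PmE); exact: bm_lin. Qed.

Lemma sqr_lin_integrable : pi.-integrable setT (EFin \o (fun z => m z ^+ 2)).
Proof.
have [iS _] := integrable_lin (fun i => l i ^+ 2) U_sqr.
have iS2 := integrableZl measurableT d%:R iS.
apply: (le_integrable measurableT _ _ iS2).
  by apply/measurable_EFinP; exact: measurable_funX.
move=> z _ /=; rewrite lee_fin ger0_norm ?sqr_ge0//; apply: le_trans (ler_norm _).
apply: le_trans (sqr_sum_le _) _; apply: ler_wpM2l => //.
by apply: ler_sum => i _; rewrite exprMn.
Qed.

(** The truncation set depends on the whole vector [U], so that [mK U_i] is bounded for every [i],
    as needed for the score. Truncating [m] alone would leave [mK U_i] unbounded, and the bound on
    [P U_i] says nothing of [P |U_i|]. *)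
Let V z := \sum_i U i z ^+ 2.
Let A n := [set z | V z <= n%:R].
Let w n z : R := \1_(A n) z.

Let mV : measurable_fun setT V.
Proof. by apply: measurable_sum => i; exact: measurable_funX. Qed.

Let mA n : measurable (A n).
Proof.
have -> : A n = setT `&` V @^-1` `]-oo, n%:R]%classic.
  by rewrite setTI; apply/seteqP; split => z /=; rewrite in_itv.
by apply: mV.
Qed.

Let wE n z : w n z = (V z <= n%:R)%R%:R.
Proof. by rewrite /w indicE; congr (nat_of_bool _)%:R; apply/idP/idP => [/set_mem|/mem_set]. Qed.

Let bwU n i : bm (fun z => w n z * U i z).
Proof.
split; first by apply: measurable_funM => //; exact: measurable_indic.
exists (n%:R + 1) => z; rewrite wE; case: (leP (V z) n%:R) => h /=; last by rewrite mul0r normr0 addr_ge0.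
have : U i z ^+ 2 <= V z.
  by rewrite /V (bigD1 i)//= lerDl; apply: sumr_ge0 => j _; exact: sqr_ge0.
rewrite mul1r => h'; have h2 : U i z ^+ 2 <= n%:R := le_trans h' h.
rewrite ler_norml; apply/andP; split.
  by have := sqr_ge0 (U i z + 1); have := sqr_ge0 (U i z); nra.
by have := sqr_ge0 (U i z - 1); have := sqr_ge0 (U i z); nra.
Qed.

Let mK n z := w n z * m z.

Let mKE n : mK n = (fun z => \sum_i l i * (w n z * U i z)).
Proof. by apply/funext => z; rewrite /mK /m mulr_sumr; apply: eq_bigr => i _; rewrite mulrCA. Qed.

Let bmK n : bm (mK n). Proof. by rewrite mKE; exact: bm_lin. Qed.

Let w_idem n z : w n z * w n z = w n z.
Proof. by rewrite wE; case: leP => _ /=; rewrite ?mul0r ?mul1r. Qed.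

Let bmKU n i : bm (fun z => mK n z * U i z).
Proof.
rewrite (_ : (fun _ => _) = (fun z => mK n z * (w n z * U i z))); first exact: bmM.
by apply/funext => z; rewrite /mK -[in LHS]w_idem; ring.
Qed.

Let h n x y := mK n y - Pops P (mK n) x.

Let jbh n : jbm (h n).
Proof. by apply: bmB; [exact: (jbm_snd (bmK n))|exact: (jbm_fst (bm_Pops P (bmK n)))]. Qed.

Let kbm f : bm f -> kintegrable P (fun _ => f). Proof. exact: kintegrable_bm. Qed.
Let kbf f : bm f -> kintegrable P (fun x _ => f x).
Proof. by move=> bf; apply: jbm_kintegrable; exact: jbm_fst. Qed.

Let hB n : classB P (h n).
Proof.
have [mh bh] := jbh n; split => //.
  by have [B hB] := bh; exists B => x y; exact: (hB (x, y)).
move=> x; rewrite -EFin_kint; last exact: jbm_kintegrable.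
rewrite kintB ?kint_cst; [|exact: kbm|by apply: kbf; exact: bm_Pops].
by rewrite subrr.
Qed.

Let scoreE n i x :
  kint P (fun x y => h n x y * U i y) x = Pops P (fun z => mK n z * U i z) x - Pops P (mK n) x * Pops P (U i) x.
Proof.
have -> : (fun x y => h n x y * U i y) = (fun x y => mK n y * U i y - Pops P (mK n) x * U i y).
  by apply/funext => a; apply/funext => b; rewrite mulrBl.
rewrite kintB; first by rewrite kintZ.
  exact: kbm.
by apply: kintegrable_bounded_mul => //; [apply: jbm_fst; exact: bm_Pops|exact: jmeas_snd].
Qed.

Let bscore n i : bm (kint P (fun x y => h n x y * U i y)).
Proof.
rewrite (funext (scoreE n i)).
by apply: bmB; [exact: bm_Pops|apply: bmM => //; exact: bm_Pops].
Qed.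

(** As [w n] is an indicator, [mK m = mK^2]: the derivative of the root in this direction is a
    second moment of [mK] itself. *)
Let betaE n : \sum_i l i * \int[pi]_x kint P (fun x y => h n x y * U i y) x =
  \int[pi]_x (Pops P (fun z => mK n z ^+ 2) x - Pops P (mK n) x * Pops P m x).
Proof.
have [_ <-] := integrable_lin l (fun i => ipi (bscore n i)).
apply: eq_Rintegral => x _.
under eq_bigr do rewrite scoreE mulrBr.
rewrite sumrB; congr (_ - _).
  have [_ <-] := integrable_lin l (fun i => kbm (bmKU n i) x).
  apply: eq_Rintegral => z _; transitivity (mK n z * m z).
    by rewrite /m mulr_sumr; apply: eq_bigr => i _; ring.
  by rewrite /mK -[in LHS]w_idem; ring.
by rewrite PmE mulr_sumr; apply: eq_bigr => i _; ring.
Qed.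

Let kbarE n x : kint P (fun x y => h n x y ^+ 2) x = Pops P (fun z => mK n z ^+ 2) x - Pops P (mK n) x ^+ 2.
Proof.
have b2 : bm (fun z => mK n z ^+ 2) by exact: (bmM (bmK n) (bmK n)).
have bP := bm_Pops P (bmK n).
have -> : (fun x y => h n x y ^+ 2) =
    (fun x y => mK n y ^+ 2 - (2 * Pops P (mK n) x * mK n y - Pops P (mK n) x ^+ 2)).
  by apply/funext => a; apply/funext => b; rewrite /h; ring.
have k1 : kintegrable P (fun x y => 2 * Pops P (mK n) x * mK n y).
  apply: kintegrable_bounded_mul; [|exact: jmeas_snd (proj1 (bmK n))|exact: kbm].
  by apply: jbm_fst; exact: bmZ.
have k2 : kintegrable P (fun x _ => Pops P (mK n) x ^+ 2) by apply: kbf; exact: (bmM bP bP).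
rewrite kintB; [|exact: kbm|exact: kintegrableB].
rewrite kintB// kint_cst (kintZ (fun x => 2 * Pops P (mK n) x)); last exact: kbm.
pose p := Pops P (mK n) x; pose p2 := Pops P (fun z => mK n z ^+ 2) x.
change (p2 - (2 * p * p - p ^+ 2) = p2 - p ^+ 2); ring.
Qed.

Variable q : R.
Hypothesis lower : forall g, classB P g -> (forall i, bm (kint P (fun x y => g x y * U i y))) ->
  forall a, - (2 * a * \sum_i l i * \int[pi]_x kint P (fun x y => g x y * U i y) x) <=
    q + a ^+ 2 * (expR (\int[pi]_x kint P (fun x y => g x y ^+ 2) x) - 1).

Let lower_quad g : classB P g -> (forall i, bm (kint P (fun x y => g x y * U i y))) ->
  2 * (\sum_i l i * \int[pi]_x kint P (fun x y => g x y * U i y) x) <=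
    q + \int[pi]_x kint P (fun x y => g x y ^+ 2) x.
Proof.
move=> gB bs; set b := \sum_i _; set k : R := \int[pi]_x _.
have kg := classB_jbm gB.
(* Use [e g] instead of [g], with [a = - 1 / e], and let [e] tend to [0]. *)
have scale (e : R) : 0 < e -> 2 * b <= q + k * expR (k * e ^+ 2).
  move=> e0; pose g' x y := e * g x y.
  have g'B : classB P g'.
    have [mg [B gBd] ig] := gB; split.
    - by apply: measurable_funM => //; exact: measurable_cst.
    - by exists (`|e| * B) => x y; rewrite normrM ler_wpM2l.
    - move=> x; under eq_integral do rewrite EFinM.
      by rewrite integralZl//; [rewrite ig mule0|exact: jbm_kintegrable].
  have kgU i : kintegrable P (fun x y => g x y * U i y).
    by apply: kintegrable_bounded_mul => //; exact: jmeas_snd.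
  have sE i : kint P (fun x y => g' x y * U i y) = (fun x => e * kint P (fun x y => g x y * U i y) x).
    apply/funext => x; rewrite -(kintZ (fun=> e))//; congr (kint P _ x).
    by apply/funext => u; apply/funext => v; rewrite /g' mulrA.
  have bs' i : bm (kint P (fun x y => g' x y * U i y)) by rewrite sE; exact: bmZ.
  have := lower g'B bs' (- e^-1).
  have -> : \sum_i l i * \int[pi]_x kint P (fun x y => g' x y * U i y) x = e * b.
    rewrite /b mulr_sumr; apply: eq_bigr => i _.
    by rewrite sE RintegralZl//; [ring|exact: ipi].
  have bg2 : bm (kint P (fun x y => g x y ^+ 2)) by apply: bm_kint; exact: (bmM kg kg).
  have -> : \int[pi]_x kint P (fun x y => g' x y ^+ 2) x = k * e ^+ 2.
    rewrite /k mulrC -RintegralZl//; last exact: ipi.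
    apply: eq_Rintegral => x _; rewrite -(kintZ (fun=> e ^+ 2)); last first.
      by apply: jbm_kintegrable; exact: (bmM kg kg).
    by congr (kint P _ x); apply/funext => u; apply/funext => v; rewrite /g' exprMn.
  have -> : - (2 * - e^-1 * (e * b)) = 2 * b by field; rewrite gt_eqF.
  move=> /le_trans; apply; rewrite lerD2l sqrrN exprVn mulrC ler_pdivrMr ?exprn_gt0//.
  (* From [1 - y <= exp (- y)] comes [exp y - 1 <= y exp y], with [y = k e^2]; the factor [e^2]
     cancels the one of [a^2]. *)
  have h1 := expR_ge1Dx (- (k * e ^+ 2)).
  have h2 := expR_gt0 (k * e ^+ 2).
  have h3 : expR (k * e ^+ 2) * expR (- (k * e ^+ 2)) = 1 by rewrite -expRD subrr expR0.
  have := ler_wpM2l (ltW h2) h1; rewrite h3; lra.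
have lim : (fun n => q + k * expR (k * (harmonic n : R) ^+ 2)) @ \oo --> q + k * expR (k * 0 ^+ 2).
  apply: cvgD; first exact: cvg_cst.
  apply: cvgM; first exact: cvg_cst.
  have ce : (fun n => k * (harmonic n : R) ^+ 2) @ \oo --> k * 0 ^+ 2.
    apply: cvgM; first exact: cvg_cst.
    by rewrite expr2; apply: cvgM; exact: cvg_harmonic.
  by apply: (cvg_comp _ _ ce); exact: continuous_expR.
have -> : q + k = q + k * expR (k * 0 ^+ 2) by rewrite expr0n mulr0 expR0 mulr1.
apply: (cvgr_to_ge lim); apply: nearW => n; apply: scale.
by rewrite /harmonic invr_gt0.
Qed.

(* For the truncation [mK] of [m], [2 beta - kbar] is
   [pi (mK^2) - pi ((Pm)^2) + pi ((P mK - Pm)^2)]: no cross term survives. *)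
Lemma direction_variance_le : \int[pi]_x (m x ^+ 2 - Pops P m x ^+ 2) <= q.
Proof.
have bPm2 : bm (fun x => Pops P m x ^+ 2) by exact: (bmM bPm bPm).
rewrite RintegralB//; [|exact: sqr_lin_integrable|exact: ipi].
rewrite lerBlDr.
have lim : (fun n => \int[pi]_x (mK n x ^+ 2)) @ \oo --> \int[pi]_x (m x ^+ 2).
  apply: (@Rint_dct _ _ _ pi _ _ (fun x => m x ^+ 2)).
  - by move=> n; apply: measurable_funX; case: (bmK n).
  - exact: measurable_funX.
  - move=> x; apply: cvg_near_cst; near=> n; rewrite /mK wE.
    suff -> : V x <= n%:R by rewrite mul1r.
    near: n; exact: nbhs_infty_ger.
  - exact: sqr_lin_integrable.
  - move=> n x; rewrite ger0_norm ?sqr_ge0// /mK wE; case: (leP (V x) n%:R) => _ /=; rewrite ?mul1r// mul0r expr0n.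
    by rewrite sqr_ge0.
apply: (cvgr_to_le lim); apply: nearW => n.
have b2 : bm (fun z => mK n z ^+ 2) by exact: (bmM (bmK n) (bmK n)).
have bP := bm_Pops P (bmK n); have bP2 := bm_Pops P b2.
have := lower_quad (hB n) (bscore n); rewrite betaE.
rewrite (funext (kbarE n)).
have bPP : bm (fun x => Pops P (mK n) x ^+ 2) by exact: (bmM bP bP).
have bPc : bm (fun x => Pops P (mK n) x * Pops P m x) by exact: bmM.
rewrite !RintegralB//; try exact: ipi.
rewrite (pi_Pops pi_stat); [|exact: kbm|exact: ipi].
(* The third term of the identity above is a mean square and is dropped; in what remains only the
   mean of [mK^2] depends on the truncation. *)
have : 0 <= \int[pi]_x (Pops P (mK n) x - Pops P m x) ^+ 2.
  by apply: Rintegral_ge0 => // x _; exact: sqr_ge0.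
have -> : \int[pi]_x (Pops P (mK n) x - Pops P m x) ^+ 2 =
   \int[pi]_x (Pops P (mK n) x ^+ 2 + Pops P m x ^+ 2 - 2 * (Pops P (mK n) x * Pops P m x)).
  by apply: eq_Rintegral => x _; ring.
rewrite RintegralB//; [|by apply: ipi; exact: bmD|by apply: ipi; exact: bmZ].
rewrite RintegralD//; [|exact: ipi|exact: ipi].
rewrite RintegralZl//; last exact: ipi.
lra.
Unshelve. all: by end_near.
Qed.

End optimal_direction.

(** * The matrices G and S *)

(** Up to sign the determinant is the value at 0 of the characteristic polynomial, and 0 has no
    positive real part. *)
Lemma eig_pos_re_unit (R : realType) d (G : 'M[R]_d) : eig_pos_re G -> G \in unitmx.
Proof.
move=> hG; rewrite unitmxE unitfE; apply/negP => /eqP G0.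
suff r0 : root (map_poly (fun r : R => Complex r 0) (char_poly G)) 0.
  by have := hG _ r0; rewrite /= ltxx.
by rewrite rootE horner_coef0 coef_map_id0// char_poly_det G0 mulr0.
Qed.

Section lipschitz_constant.
Context (R : realType) dX (X : measurableType dX) (P : R.-pker X ~> X).
Context (d : nat) (nrm : 'cV[R]_d -> R) (nrm_norm : is_norm nrm).
Context (H : 'cV[R]_d -> X -> 'cV[R]_d) (p LH gamma c cc : R).
Hypothesis mH : forall x i, measurable_fun setT (fun z => H x z i 0).
Hypothesis p_gt2 : 2 < p.
Hypothesis cc_gt0 : 0 < cc.
Hypothesis cc_nrm : forall (x : 'cV[R]_d) i, `|x i 0| <= cc * nrm x.
Hypothesis H_lip : forall x y xi,
  (\int[P xi]_z ((nrm (H x z - H y z)) `^ p)%:E <= ((LH * nrm (x - y)) `^ p)%:E)%E.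
Hypothesis gamma01 : 0 <= gamma < 1.
Hypothesis c_gt0 : 0 < c.
Hypothesis H_contr : forall x y xi,
  nrm (Pop P (fun z => H x z - H y z) xi - c *: (x - y)) <= gamma * c * nrm (x - y).

Let mHB x y i : measurable_fun setT (fun z => (H x z - H y z) i 0).
Proof.
rewrite (_ : (fun _ => _) = (fun z => H x z i 0 - H y z i 0)); first exact: measurable_funB.
by apply/funext => z; rewrite !mxE.
Qed.

Let p_ge0 : 0 <= p. Proof. exact: ltW (lt_trans _ p_gt2). Qed.

(* [powR] of a negative base is [1], so a negative [LH] would bound all the
   increments of the mean field by a constant. *)
Lemma lipschitz_cst_ge0 : (0 < d)%N -> 0 <= LH.
Proof.
move=> d0; rewrite leNgt; apply/negP => LH0.
pose i0 := Ordinal d0; pose e : 'cV[R]_d := delta_mx i0 0.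
have e0 : e != 0.
  by apply/eqP => /matrixP /(_ i0 0); rewrite !mxE !eqxx; apply/eqP; rewrite oner_eq0.
have [nrm0 nZ nD] := nrm_norm.
have ne : 0 < nrm e.
  by rewrite lt_neqAle nrm_ge0// andbT eq_sym; apply: contra e0 => /eqP /nrm0 ->.
pose B := nrm_cst nrm * (2 * cc * 1).
(* Along the ray [r e], (A7) forces the increment of [P H] to be at least [(1 - gamma) c r nrm e],
   while a negative [LH] caps it by [B]; a large [r] is contradictory. *)
have h (r : R) : 0 < r -> (1 - gamma) * c * (r * nrm e) <= B.
  move=> r0; have xi : X := point.
  have nre : nrm (r *: e - 0) = r * nrm e by rewrite subr0 nZ gtr0_norm.
  have rne0 : 0 < r * nrm e by rewrite mulr_gt0.
  have le1 : (LH * nrm (r *: e - 0)) `^ p <= 1 `^ p.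
    rewrite nre powR1 /powR lt_eqF ?nmulr_rlt0//= ln0 ?mulr0 ?expR0//.
    by rewrite ltW// nmulr_rlt0.
  have bnd i : `|Pop P (fun z => H (r *: e) z - H 0 z) xi i 0| <= 2 * cc * 1.
    have [iB lB] := kint_abs_le nrm_norm cc_gt0 cc_nrm p_gt2 (mHB _ _ i) (H_lip (r *: e) 0 xi) le1 ltr01.
    rewrite mxE; apply: le_trans lB; exact: le_normr_Rintegral.
  have h1 := nrm_le_coord nrm_norm bnd.
  have h2 := H_contr (r *: e) 0 xi.
  set Q := Pop P _ xi in h1 h2.
  have h3 : nrm (c *: (r *: e - 0)) <= nrm Q + nrm (Q - c *: (r *: e - 0)).
    by rewrite -[X in nrm X <= _](subKr Q); exact: nrmB.
  rewrite nZ gtr0_norm// nre in h3; rewrite nre in h2; rewrite /B; lra.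
have k0 : 0 < (1 - gamma) * c by rewrite mulr_gt0// subr_gt0; case/andP: gamma01.
have B0 : 0 <= B by apply: mulr_ge0; [exact: nrm_cst_ge0|rewrite mulr1 mulr_ge0// ltW].
have r0 : 0 < (B + 1) / ((1 - gamma) * c * nrm e) by apply: divr_gt0; [lra|exact: mulr_gt0].
have := h _ r0; set k := (1 - gamma) * c; rewrite -/k in k0.
have -> : k * ((B + 1) / (k * nrm e) * nrm e) = B + 1 by field; rewrite ?gt_eqF.
lra.
Qed.

(** The constant [LH + 1] keeps the scale of [kint_abs_le] positive even if [LH = 0]. The case
    [x = y], where that scale vanishes, is set apart, and the index [i] witnesses that the dimension
    is positive. *)
Lemma mean_lipschitz x y xi i :
  (P xi).-integrable setT (fun z => ((H x z - H y z) i 0)%:E) /\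
  \int[P xi]_z `|(H x z - H y z) i 0| <= 2 * cc * (LH + 1) * nrm (x - y).
Proof.
have [->|xy] := eqVneq x y.
  have e : (fun z => ((H y z - H y z) i 0)) = (fun=> 0 : R) by apply/funext => z; rewrite subrr mxE.
  split.
    rewrite (_ : (fun _ => _) = (fun=> 0%E)); first exact: integrable0.
    by apply/funext => z; rewrite subrr mxE.
  rewrite subrr nrm0// mulr0 /Rintegral (eq_integral (fun=> 0%E)) ?integral0//.
  by move=> z _; rewrite subrr mxE normr0.
have LH0 : 0 <= LH by apply: lipschitz_cst_ge0; case: i => j; exact: leq_trans.
have n0 : 0 < nrm (x - y).
  rewrite lt_neqAle nrm_ge0// andbT eq_sym; apply: contra xy => /eqP.
  by case: nrm_norm => z _ _ /z /eqP; rewrite subr_eq0.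
have tau0 : 0 < (LH + 1) * nrm (x - y) by rewrite mulr_gt0// ltr_wpDl.
rewrite -(mulrA (2 * cc)).
apply: (kint_abs_le nrm_norm cc_gt0 cc_nrm p_gt2 (mHB x y i) (H_lip x y xi)) => //.
apply: ge0_ler_powR => //; rewrite ?nnegrE ?(ltW tau0) ?mulr_ge0 ?nrm_ge0//.
by rewrite ler_wpM2r ?nrm_ge0// lerDl.
Qed.

End lipschitz_constant.

Lemma sqr_sum_sub (R : realType) d (l a b : 'I_d -> R) :
  \sum_i l i * (\sum_j l j * (a i * a j - b i * b j)) =
  (\sum_i l i * a i) ^+ 2 - (\sum_i l i * b i) ^+ 2.
Proof.
rewrite !expr2 !mulr_suml -sumrB; apply: eq_bigr => i _; rewrite !mulr_sumr -sumrB.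
by apply: eq_bigr => j _; ring.
Qed.

(** * The series U and the quadratic form of S *)

Section poisson_solution.
Context (R : realType) dX (X : measurableType dX) (P : R.-pker X ~> X).
Variables (d : nat) (H : 'cV[R]_d -> X -> 'cV[R]_d) (xs : 'cV[R]_d).
Hypothesis mH : forall x i, measurable_fun setT (fun z => H x z i 0).
Hypothesis iHs : forall xi i, (P xi).-integrable setT (fun z => (H xs z i 0)%:E).
Variables (pi : probability X R) (kappa rho : R).
Hypothesis kappa_ge0 : 0 <= kappa.
Hypothesis rho01 : 0 <= rho < 1.
Hypothesis ergodic : forall xi t (A : set X), measurable A ->
  `|Pows P t (fun y => \1_A y) xi - fine (pi A)| <= kappa * rho ^+ t / 2.
Hypothesis pi_stat : stationary P (@w1 R dX X) pi.
Hypothesis H_sqr : forall i, pi.-integrable setT (EFin \o (fun z => H xs z i 0 ^+ 2)).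
Hypothesis bPH : forall i, bm (Pops P (fun z => H xs z i 0)).
Hypothesis g_xs : gfun pi H xs = 0.

Let pi1 : pi setT = 1%E. Proof. exact: probability_setT. Qed.
Let ipi f : bm f -> pi.-integrable setT (EFin \o f). Proof. exact: bm_integrable. Qed.

Local Notation U := (Usol P H xs pi).

Let u i := poisson_sol P pi (Pops P (fun y => H xs y i 0)).

Let fM i : exists2 M : R, 0 <= M & forall x, `|Pops P (fun z => H xs z i 0) x| <= M.
Proof.
by have [_ [M h]] := bPH i; exists `|M| => // x; rewrite (le_trans (h x))// ler_norm.
Qed.

Let bu i : bm (u i).
Proof. by have [M M0 h] := fM i; exact: (bm_poisson_sol kappa_ge0 rho01 ergodic M0 (bPH i) h). Qed.

Lemma measurable_Usol i : measurable_fun setT (U i).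
Proof. by apply: measurable_funD; [exact: mH|case: (bu i)]. Qed.

Lemma bm_Pops_Usol i : bm (Pops P (U i)).
Proof.
have -> : Pops P (U i) = (fun x => Pops P (fun z => H xs z i 0) x + Pops P (u i) x).
  apply/funext => x; apply: kintD; first by move=> y; exact: iHs.
  exact: (kintegrable_bm P (bu i)).
by apply: bmD; [exact: bPH|exact: bm_Pops].
Qed.

Lemma Usol_sqr_integrable i : pi.-integrable setT (EFin \o (fun z => U i z ^+ 2)).
Proof.
have h1 := integrableZl measurableT 2 (H_sqr i).
have bu2 : bm (fun z => 2 * u i z ^+ 2) by apply: bmZ; exact: (bmM (bu i) (bu i)).
have h2 := integrableD measurableT h1 (ipi bu2).
apply: (le_integrable measurableT _ _ h2).
  by apply/measurable_EFinP; apply: measurable_funX; exact: measurable_Usol.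
move=> z _ /=; rewrite lee_fin; apply: le_trans (ler_norm _).
rewrite ger0_norm ?sqr_ge0// /Usol -/(u i z).
by have := sqr_ge0 (H xs z i 0 - u i z); lra.
Qed.

Let PowE t z i : Pow P t (H xs) z i 0 = Pows P t (fun y => H xs y i 0) z.
Proof.
elim: t z => // t ih z; rewrite PowsS /Pow iterS mxE; congr (Pops P _ z).
by apply/funext => y; exact: ih.
Qed.

Let mean_Hs i : \int[pi]_y H xs y i 0 = 0.
Proof. by have := congr1 (fun v : 'cV[R]_d => v i 0) g_xs; rewrite !mxE. Qed.

(** In a partial sum of [N + 1] terms the one of time 0 is [H xs], and the others are the first [N]
    terms of the Poisson series of [P H], which is already centered because
    [pi (P H) = pi H = 0]. *)
Lemma UfunE z i : Ufun P pi H xs z i 0 = Usol P H xs pi i z.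
Proof.
rewrite mxE; apply/cvg_lim => //; rewrite -cvg_shiftS.
have mean0 : \int[pi]_y Pops P (fun y => H xs y i 0) y = 0.
  rewrite (pi_Pops pi_stat); first exact: mean_Hs.
    by move=> x; exact: iHs.
  exact: (pi_integrable_Hs mH H_sqr).
have [M M0 h] := fM i.
have hc := poisson_sol_cvg kappa_ge0 rho01 ergodic M0 (bPH i) h (x := z).
rewrite [X in X @ _ --> _](_ : _ = (fun N => H xs z i 0 +
  \sum_(t < N) (Pows P t (Pops P (fun y => H xs y i 0)) z - \int[pi]_y Pops P (fun y => H xs y i 0) y))).
  by apply: cvgD => //; exact: cvg_cst.
have g0 : gfun pi H xs i ord0 = 0 by rewrite g_xs mxE.
apply/funext => N; rewrite /= big_ord_recl g0 subr0; congr (_ + _).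
apply: eq_bigr => t _; rewrite subr0 mean0 subr0.
by rewrite -/(Pow P (lift ord0 t) (H xs) z i 0) (PowE (lift ord0 t)) /Pows lift0 iterSr.
Qed.

(** The entries of [Smat] are integrals of integrable products, so the quadratic form may be taken
    under the integral, where it becomes a difference of two squares. *)
Lemma quad_Smat (l : 'rV[R]_d) :
  (l *m Smat P pi H xs *m l^T) 0 0 =
  \int[pi]_z ((\sum_i l 0 i * U i z) ^+ 2 - Pops P (fun z => \sum_i l 0 i * U i z) z ^+ 2).
Proof.
have kU i : kintegrable P (fun _ => U i) by exact: (kintegrable_Usol iHs kappa_ge0 rho01 ergodic bPH).
pose K i j z := U i z * U j z - Pops P (U i) z * Pops P (U j) z.
have iK i j : pi.-integrable setT (EFin \o K i j).
  have hP := ipi (bmM (bm_Pops_Usol i) (bm_Pops_Usol j)).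
  suff hUU : pi.-integrable setT (EFin \o (fun z => U i z * U j z)).
    exact: (integrableB measurableT hUU hP).
  have h2 := integrableD measurableT (Usol_sqr_integrable i) (Usol_sqr_integrable j).
  apply: (le_integrable measurableT _ _ h2).
    by apply/measurable_EFinP; apply: measurable_funM; exact: measurable_Usol.
  move=> z _ /=; rewrite lee_fin; apply: le_trans (ler_norm _); rewrite ler_norml.
  set a := U i z; set b := U j z.
  have := sqr_ge0 (a + b); have := sqr_ge0 (a - b); have := sqr_ge0 a; have := sqr_ge0 b.
  by move=> *; apply/andP; split; lra.
have SE i j : Smat P pi H xs i j = \int[pi]_z K i j z.
  rewrite mxE; apply: eq_Rintegral => z _.
  have PE k : Pop P (Ufun P pi H xs) z k ord0 = Pops P (U k) z.
    by rewrite mxE; congr (Pops P _ z); apply/funext => y; exact: UfunE.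
  have UE k : Ufun P pi H xs z k ord0 = U k z := UfunE z k.
  by rewrite !PE !UE.
have -> : (l *m Smat P pi H xs *m l^T) 0 0 = \sum_i l 0 i * \sum_j l 0 j * \int[pi]_z K i j z.
  rewrite mxE; under eq_bigr => j _ do rewrite !mxE mulr_suml.
  rewrite exchange_big; apply: eq_bigr => i _ /=; rewrite mulr_sumr; apply: eq_bigr => j _.
  by rewrite SE; ring.
have h i := integrable_lin (l 0) (iK i).
have [_ E] := integrable_lin (l 0) (fun i => proj1 (h i)).
transitivity (\sum_i l 0 i * \int[pi]_z \sum_j l 0 j * K i j z).
  by apply: eq_bigr => i _; rewrite (proj2 (h i)).
rewrite -E; apply: eq_Rintegral => z _.
have -> : Pops P (fun z => \sum_i l 0 i * U i z) z = \sum_i l 0 i * Pops P (U i) z.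
  by have [_] := integrable_lin (l 0) (fun i => kU i z).
exact: (sqr_sum_sub (l 0) (fun i => U i z) (fun i => Pops P (U i) z)).
Qed.

End poisson_solution.

(** * The bound in each direction v *)

Theorem theorem3
  (R : realType) (Xi : ptopologicalType) (Xi_polish : polish R Xi)
  (d : nat) (nrm : 'cV[R]_d -> R) (nrm_norm : is_norm nrm)
  (P : R.-pker borelT Xi ~> borelT Xi) (pi : probability (borelT Xi) R)
  (H : 'cV[R]_d -> borelT Xi -> 'cV[R]_d)
  (H_meas : forall i, measurable_fun setT
              (fun q : borelT 'cV[R]_d * borelT Xi => H q.1 q.2 i 0))
  (xs : 'cV[R]_d) (g_xs : gfun pi H xs = 0)
  (nu : probability (borelT Xi) R)
  (* (A1) *)
  (G : 'M[R]_d) (LG deltaG : R)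
  (A1 : [/\ 0 < LG, 0 < deltaG, eig_pos_re G &
          forall x, nrm (x - xs) <= deltaG ->
            nrm (gfun pi H x - G *m (x - xs)) <= LG * nrm (x - xs) ^+ 2])
  (* (A2) *)
  (p sigma : R)
  (A2 : [/\ 2 < p, 0 < sigma,
          (exists C : R, forall t, (chainE nu P (@w1 _ _ _) t
              (fun s => ((nrm (H xs (last point s))) `^ p)%:E) <= C%:E)%E),
          (forall xi i, (P xi).-integrable setT (fun y => (H xs y i 0)%:E)) &
          (forall xi, nrm (Pop P (H xs) xi) <= sigma)])
  (* (A3) *)
  (LH : R)
  (A3 : forall x y xi,
          (\int[P xi]_z ((nrm (H x z - H y z)) `^ p)%:E
             <= ((LH * nrm (x - y)) `^ p)%:E)%E)
  (* (A4) *)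
  (kappa rho : R)
  (A4 : [/\ stationary P (@w1 _ _ _) pi,
          (forall mu : probability (borelT Xi) R, stationary P (@w1 _ _ _) mu ->
             forall A, measurable A -> mu A = pi A),
          expR 1 <= kappa, 0 <= rho < 1 &
          (forall xi t (A : set (borelT Xi)), measurable A ->
             `|Pows P t (fun y => \1_A y) xi - fine (pi A)| <= kappa * rho ^+ t / 2)])
  (* (A7) *)
  (gamma c : R)
  (A7 : [/\ 0 <= gamma < 1, 0 < c &
          forall x y xi,
            nrm (Pop P (fun z => H x z - H y z) xi - c *: (x - y))
              <= gamma * c * nrm (x - y)])
  (* the estimator *)
  (T : nat -> seq (borelT Xi) -> 'cV[R]_d)
  (T_meas : estimator_measurable T)
  (T_RAL : RAL nu P pi H nrm T xs)
  (* the limit M of n E (T_n - xs)(T_n - xs)^T *)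
  (M : 'M[R]_d)
  (M_finite : forall i, \forall n \near \oo,
      (chainE nu P (@w1 _ _ _) n (fun s => (((T n s - xs) i 0) ^+ 2)%:E) < +oo)%E)
  (M_lim : forall i j,
      (fun n => n%:R * fine (chainE nu P (@w1 _ _ _) n
                   (fun s => ((T n s - xs) i 0 * (T n s - xs) j 0)%:E)))
        @ \oo --> M i j) :
  loewner_ge M (invmx G *m Smat P pi H xs *m (invmx G)^T).
Proof.
have [LG0 dG0 Gpos gdiff] := A1; have [p2 sigma0 [C HC] iHs0 PHs] := A2.
have [pi_stat _ kappa1 rho01 erg] := A4; have [gamma01 c0 contr] := A7.
have [[Lim reg] _] := T_RAL.
have mH x i : measurable_fun setT (fun z => H x z i 0).
  have mx : measurable_fun setT (pair (x : borelT 'cV[R]_d) : borelT Xi -> _).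
    exact: pair1_measurable.
  exact: (measurableT_comp (H_meas i) mx).
have iHs xi i := iHs0 xi i.
have [cc' cc'0 cc'_nrm] := coord_le_nrm nrm_norm.
pose cc : R := cc' + 1.
have cc0 : 0 < cc by rewrite ltr_wpDl.
have cc_nrm (x : 'cV[R]_d) i : `|x i 0| <= cc * nrm x.
  by apply: le_trans (cc'_nrm x i) _; rewrite ler_wpM2r ?nrm_ge0// lerDl.
have kappa0 : 0 <= kappa by exact: le_trans (expR_ge0 1) kappa1.
have H_sqr i : pi.-integrable setT (EFin \o (fun z => H xs z i 0 ^+ 2)).
  exact: (stationary_sqr_integrable nrm_norm cc0 cc_nrm p2 rho01 erg (mH xs i) HC).
have bPH i : bm (Pops P (fun z => H xs z i 0)).
  split.
    by rewrite PopsE; apply: measurable_kint; exact: (jmeas_snd (mH xs i)).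
  exists (cc * sigma) => xi; have := cc_nrm (Pop P (H xs) xi) i; rewrite mxE => /le_trans; apply.
  by rewrite ler_wpM2l ?(ltW cc0).
have Gu := eig_pos_re_unit Gpos.
move=> v.
(* In dimension 0 the quadratic form is an empty sum; the sign of [LH] is available in positive
   dimension only. *)
have [d0|d0] := posnP d.
  rewrite mxE big1// => i _; exfalso.
  by have := leq_ltn_trans (leq0n i) (ltn_ord i); rewrite d0.
have LH0 := lipschitz_cst_ge0 nrm_norm mH p2 cc0 cc_nrm A3 gamma01 c0 contr d0.
have lip := mean_lipschitz nrm_norm mH p2 cc0 cc_nrm A3 gamma01 c0 contr.
have L0 : 0 <= 2 * cc * (LH + 1).
  by apply: mulr_ge0; [rewrite mulr_ge0// ltW|rewrite addr_ge0].
have ipiH i := pi_integrable_Hs mH H_sqr i.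
have root_pi : is_root_of pi H xs.
  move=> i; split; first exact: ipiH.
  rewrite -(EFin_Rint (ipiH i)).
  have := congr1 (fun v : 'cV[R]_d => v i 0) g_xs; rewrite !mxE => g0; exact: (congr1 EFin g0).
have B0 : classB P (fun _ _ => 0).
  split; first exact: measurable_cst.
    by exists 0 => x y; rewrite normr0.
  by move=> x; rewrite integral0.
(* Regularity along [h = 0], with the constant sequences [pi] and [xs], gives the limit law under
   [P] itself. *)
have conv0 : conv_dist nu P (wpert (fun _ _ => 0))
    (fun n s => Num.sqrt (n%:R) *: (T n s - xs)) Lim.
  apply: (reg _ B0 (fun=> pi)); apply: nearW => n.
  by split; [rewrite wpert0|exact: root_pi].
pose l : 'rV[R]_d := v^T *m invmx G.
have lower h : classB P h -> (forall i, bm (score P H xs pi h i)) -> forall a,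
    - (2 * a * \sum_i l 0 i * \int[pi]_x score P H xs pi h i x) <=
    quad_form M v + a ^+ 2 * (expR (\int[pi]_x kint P (fun x y => h x y ^+ 2) x) - 1).
  move=> hB bs a.
  have [pin [xn [pinP xn_rate]]] := perturbed_roots_cvg nrm_norm mH iHs L0 lip gamma01 c0 contr
    kappa0 rho01 erg pi_stat H_sqr bPH g_xs LG0 dG0 Gu gdiff hB bs.
  have convh := reg h hB pin xn pinP.
  have [u [u_cvg u_le]] := cE_lik_perturbed_le hB kappa0 rho01 erg nu.
  exact: (regular_lower_bound T_meas conv0 M_finite M_lim hB convh (xn_rate v) u_cvg u_le).
have := direction_variance_le pi_stat (measurable_Usol mH kappa0 rho01 erg bPH)
  (kintegrable_Usol iHs kappa0 rho01 erg bPH) (bm_Pops_Usol iHs kappa0 rho01 erg bPH)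
  (Usol_sqr_integrable mH kappa0 rho01 erg H_sqr bPH) lower.
rewrite -(quad_Smat mH iHs kappa0 rho01 erg pi_stat H_sqr bPH g_xs) => q_le.
rewrite mulmxBr mulmxBl mxE [X in _ + X]mxE subr_ge0; apply: le_trans q_le.
by rewrite /l trmx_mul trmxK !mulmxA.
Qed.
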